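(* Let $\Omega\subset\mathbb{R}^n$ be a bounded open set, $\vec s=(s_1,\dots,s_n)$ with $s_i\in(0,1)$, $\vec p=(p_1,\dots,p_n)$ with $p_i\in(1,\infty)$, such that $\overline{\vec s\vec p}<n$ and $p_{\max}<\vec p^{\,*}$, and let $f\in L^{(\vec p^{\,*})'}(\Omega)$. Let $1\le j\le n$, let $\delta_1^k,\dots,\delta_j^k>0$ with $\delta_i^k\to0$ as $k\to\infty$ for $i=1,\dots,j$, let $\delta_{j+1},\dots,\delta_n>0$ be fixed, and set $\vec\delta_k=(\delta^k_1,\dots,\delta^k_j,\delta_{j+1},\dots,\delta_n)$ and $\vec\delta_0=(0,\dots,0,\delta_{j+1},\dots,\delta_n)$. Then the functionals $\bar I_k:L^{p_{\min}}(\Omega)\to\overline{\mathbb{R}}$, $$\bar I_k(v)=\begin{cases}I_k(v)&\text{if }v\in W_0^{\vec s,\vec p,\vec\delta}(\Omega),\\ \infty&\text{elsewhere,}\end{cases}$$ $\Gamma$-converge as $k\to\infty$, in $L^{p_{\min}}(\Omega)$, to $\bar I:L^{p_{\min}}(\Omega)\to\overline{\mathbb{R}}$, $$\bar I(v)=\begin{cases}I_0(v)&\text{if }v\in W_0^{\vec s,\vec p,\vec\delta}(\Omega),\\ \infty&\text{elsewhere.}\end{cases}$$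
   Context: For $i=1,\dots,n$, $[u]^i_{s,p,\delta}=\int_{\mathbb{R}^n}\int_{|h|\le\delta}\frac{|u(x+he_i)-u(x)|^{p}}{|h|^{1+sp}}\,dh\,dx$ with $e_i$ the $i$-th canonical vector and $h\in\mathbb{R}$. For $\vec\delta$ with positive entries, $W_i^{s,p,\delta}(\mathbb{R}^n)=\{u\in L^{p}(\mathbb{R}^n):[u]^i_{s,p,\delta}<\infty\}$, $W^{\vec s,\vec p,\vec\delta}(\mathbb{R}^n)=\bigcap_{i=1}^nW_i^{s_i,p_i,\delta_i}(\mathbb{R}^n)$, and $W_0^{\vec s,\vec p,\vec\delta}(\Omega)=\{u\in W^{\vec s,\vec p,\vec\delta}(\mathbb{R}^n):u=0\text{ a.e. in }\mathbb{R}^n\setminus\Omega\}$; as a set this does not depend on the choice of $\vec\delta\in(0,\infty)^n$, and in the claim $\vec\delta$ is any such vector. Functions on $\Omega$ are identified with their extensions by zero. $p_{\min}=\min_ip_i$, $p_{\max}=\max_ip_i$, $\overline{\vec s}=\Big(\frac1n\sum_{i}\frac1{s_i}\Big)^{-1}$, $\overline{\vec s\vec p}=\Big(\frac1n\sum_{i}\frac1{s_ip_i}\Big)^{-1}$, $\vec p^{\,*}=\dfrac{n\,\overline{\vec s\vec p}/\overline{\vec s}}{n-\overline{\vec s\vec p}}$, and $(\vec p^{\,*})'$ is the conjugate exponent. $J^i_\delta(v)=\delta^{-p_i(1-s_i)}[v]^i_{s_i,p_i,\delta}$ for $\delta>0$, and $J^i(v)=\frac{2}{p_i(1-s_i)}\|\partial_iv\|_{p_i}^{p_i}$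 (equal to $+\infty$ if $\partial_iv\notin L^{p_i}(\mathbb{R}^n)$). $$I_k(v)=\sum_{i=1}^jJ^i_{\delta_i^k}(v)+\sum_{i=j+1}^nJ^i_{\delta_i}(v)-\int_\Omega fv\,dx,\qquad I_0(v)=\sum_{i=1}^jJ^i(v)+\sum_{i=j+1}^nJ^i_{\delta_i}(v)-\int_\Omega fv\,dx .$$ *)

(* Defs.v *)
From HB Require Import structures.
From mathcomp Require Import all_boot all_order all_algebra.
From mathcomp Require Import all_classical all_reals all_analysis.

Set Implicit Arguments.
Unset Strict Implicit.
Unset Printing Implicit Defensive.

Import Order.TTheory GRing.Theory Num.Theory.
Import numFieldTopology.Exports numFieldNormedType.Exports.

Local Open Scope classical_set_scope.
Local Open Scope ring_scope.

(* The Borel sigma-algebra of R^n, generated by the coordinate maps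
   (it contains the open sets, see measurable_open_rV). *)
Definition rV_display : measure_display. Proof. exact. Qed.

Section rV_measurable.
Variables (R : realType) (n : nat).

Let coor (i : 'I_n) (x : 'rV[R]_n) : R := x 0 i.

Let rV_set0 : g_sigma_preimage coor set0.
Proof. exact: sigma_algebra0. Qed.

Let rV_setC A : g_sigma_preimage coor A -> g_sigma_preimage coor (~` A).
Proof. exact: sigma_algebraC. Qed.

Let rV_bigcup (F : (set 'rV[R]_n)^nat) :
  (forall i, g_sigma_preimage coor (F i)) ->
  g_sigma_preimage coor (\bigcup_i (F i)).
Proof. exact: sigma_algebra_bigcup. Qed.

HB.instance Definition _ := @isMeasurable.Build rV_display
  'rV[R]_n (g_sigma_preimage coor) rV_set0 rV_setC rV_bigcup.

Lemma measurable_coor (i : 'I_n) :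
  measurable_fun [set: 'rV[R]_n] (fun x : 'rV[R]_n => x 0 i).
Proof.
move=> _ Y mY; rewrite setTI; apply: sub_sigma_algebra => /=.
rewrite -bigcup_seq/=; exists i => /=; first by rewrite mem_index_enum.
by exists Y => //; rewrite setTI.
Qed.

Lemma measurable_fun_rV d (T : measurableType d) (f : T -> 'rV[R]_n) :
  (forall i, measurable_fun [set: T] (fun x => f x 0 i)) ->
  measurable_fun [set: T] f.
Proof.
move=> mf _ Y mY; rewrite setTI.
pose G := image_set_system setT f (@measurable _ T).
suff : measurable `<=` G by move=> /(_ _ mY); rewrite /G /image_set_system/= setTI.
apply: smallest_sub => //.
  exact/sigma_algebra_image/sigma_algebra_measurable.
rewrite -bigcup_seq/=; apply: bigcup_sub => i _ A [B mB <-].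
rewrite /G /image_set_system/= !setTI -comp_preimage.
by rewrite -[X in measurable X]setTI; exact: mf.
Qed.

Lemma measurable_open_rV (U : set 'rV[R]_n) : open U -> measurable U.
Proof.
move=> oU.
pose B (q : 'rV[rat]_n * nat) : set 'rV[R]_n :=
  [set x | forall i, ball (ratr (q.1 0 i) : R) (q.2.+1%:R^-1) (x 0 i)].
have mB q : measurable (B q).
  rewrite (_ : B q = \bigcap_(i in [set: 'I_n])
    ((fun x : 'rV[R]_n => x 0 i) @^-1` ball (ratr (q.1 0 i) : R) (q.2.+1%:R^-1))); last first.
    by apply/seteqP; split=> x /= Bx i; [move=> _|]; exact: Bx.
  apply: fin_bigcap_measurable => // i _.
  rewrite -[X in measurable X]setTI; apply: measurable_coor => //.
  by rewrite ball_itv; exact: measurable_itv.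
rewrite (_ : U = \bigcup_(q in [set q | B q `<=` U]) B q); last first.
  apply/seteqP; split=> [x Ux|x [q qU]]; last exact: qU.
  have /nbhs_ballP[e /= e0 xeU] : nbhs x U by exact: open_nbhs_nbhs.
  have [k ke] : exists k, k.+1%:R^-1 < e / 2.
    by have [k _ /(_ _ (leqnn k))] := near_infty_natSinv_lt (PosNum (divr_gt0 e0 (ltr0Sn R 1))); exists k.
  have hk i : x 0 i - k.+1%:R^-1 < x 0 i + k.+1%:R^-1.
    by rewrite ltrD2l gtrN// invr_gt0.
  have /choice[q qx] : forall i, exists q : rat, ball (ratr q : R) (k.+1%:R^-1) (x 0 i).
    move=> i; have [q] := rat_in_itvoo (hk i).
    by rewrite in_itv/= => /andP[q1 q2]; exists q; rewrite /ball/= ltr_distlC; apply/andP; split; rewrite ?ltrBlDr // -ltrBlDr.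
  exists (\row_i q i, k); last by move=> i /=; rewrite mxE.
  move=> y /= By; apply: xeU; split => // i0 i; rewrite (ord1 i0).
  move: (By i); rewrite mxE => qy.
  apply: (@le_ball _ _ _ (k.+1%:R^-1 + k.+1%:R^-1)).
    by rewrite (splitr e) lerD// ltW.
  exact: ball_triangle (ball_sym (qx i)) qy.
rewrite bigcup_mkcond; apply: countable_bigcupT_measurable => // q.
by case: ifP.
Qed.

End rV_measurable.

Section lebesgue_rV.
Variable R : realType.
Local Open Scope ereal_scope.

Definition cons_rV n (q : R * 'rV[R]_n) : 'rV[R]_n.+1 :=
  row_mx (q.1%:M : 'rV[R]_1) q.2.

Lemma cons_rV0 n (q : R * 'rV[R]_n) : cons_rV q 0%R ord0 = q.1.
Proof.
have := row_mxEl (q.1%:M : 'rV[R]_1) q.2 0%R ord0.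
rewrite [RHS]mxE mulr1n => qE; rewrite -[RHS]qE /cons_rV.
by congr (row_mx _ _ _ _); exact: val_inj.
Qed.

Lemma cons_rV_lift n (q : R * 'rV[R]_n) (i : 'I_n) :
  cons_rV q 0%R (lift ord0 i) = q.2 0%R i.
Proof.
rewrite -[RHS](row_mxEr (q.1%:M : 'rV[R]_1) q.2) /cons_rV.
by congr (row_mx _ _ _ _); exact: val_inj.
Qed.

Lemma measurable_cons_rV n : measurable_fun [set: R * 'rV[R]_n] (@cons_rV n).
Proof.
apply: measurable_fun_rV => i; have [j ->|->] := unliftP ord0 i.
  under eq_fun do rewrite cons_rV_lift.
  by apply: (@measurableT_comp _ _ _ _ _ _ (fun x : 'rV[R]_n => x 0%R j)) => //;
    exact: measurable_coor.
by under eq_fun do rewrite cons_rV0; exact: measurable_fst.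
Qed.

Section step.
Variables (n : nat) (m : {sigma_finite_measure set 'rV[R]_n -> \bar R}).

Definition lebesgue_rV_step : set 'rV[R]_n.+1 -> \bar R :=
  pushforward (lebesgue_measure \x m) (@cons_rV n).

Let step0 : lebesgue_rV_step set0 = 0.
Proof. by rewrite /lebesgue_rV_step /pushforward preimage_set0 measure0. Qed.

Let step_ge0 A : 0 <= lebesgue_rV_step A.
Proof. by rewrite /lebesgue_rV_step /pushforward; exact: measure_ge0. Qed.

Let step_sigma_additive : semi_sigma_additive lebesgue_rV_step.
Proof.
move=> F mF tF mUF; rewrite /lebesgue_rV_step /pushforward preimage_bigcup.
have mcons A : measurable A -> measurable (@cons_rV n @^-1` A).
  by move=> mA; rewrite -[X in measurable X]setTI; exact: measurable_cons_rV.
apply: measure_semi_sigma_additive; [by move=> k; exact: mcons| |].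
  apply/trivIsetP => i j _ _ ij; rewrite -preimage_setI.
  by move/trivIsetP : tF => /(_ _ _ I I ij) ->; rewrite preimage_set0.
by rewrite -preimage_bigcup; exact: mcons.
Qed.

HB.instance Definition _ := isMeasure.Build _ _ _ lebesgue_rV_step
  step0 step_ge0 step_sigma_additive.

Let step_sigma_finite : sigma_finite setT lebesgue_rV_step.
Proof.
pose uncons (x : 'rV[R]_n.+1) : R * 'rV[R]_n :=
  (x 0%R ord0, \row_i x 0%R (lift ord0 i)).
have consK q : uncons (cons_rV q) = q.
  rewrite /uncons cons_rV0; case: q => a v; congr pair.
  by apply/rowP => i; rewrite mxE cons_rV_lift.
have muncons : measurable_fun setT uncons.
  apply/measurable_fun_pair; first exact: measurable_coor.
  apply: measurable_fun_rV => i; under eq_fun do rewrite mxE.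
  exact: measurable_coor.
have /sigma_finiteP[F [TF ndF Foo]] := sigma_finiteT (@lebesgue_measure R).
have /sigma_finiteP[G [TG ndG Goo]] := sigma_finiteT m.
exists (fun k => uncons @^-1` (F k `*` G k)).
  apply/esym; rewrite -preimage_bigcup -subTset => x _ /=.
  have [k _ Fk] : (\bigcup_k F k) (uncons x).1 by rewrite -TF.
  have [l _ Gl] : (\bigcup_k G k) (uncons x).2 by rewrite -TG.
  exists (maxn k l) => //; split.
    by move: Fk; exact/subsetPset/ndF/leq_maxl.
  by move: Gl; exact/subsetPset/ndG/leq_maxr.
move=> k; have [mF Fk] := Foo k; have [mG Gk] := Goo k; split.
  by rewrite -[X in measurable X]setTI; apply: muncons => //; exact: measurableX.
rewrite /lebesgue_rV_step /pushforward -comp_preimage.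
rewrite (_ : _ \o _ = id); last by apply/funext => q /=; exact: consK.
by rewrite preimage_id product_measure1E// lte_mul_pinfty// ge0_fin_numE.
Qed.

HB.instance Definition _ := Measure_isSigmaFinite.Build _ _ _ lebesgue_rV_step
  step_sigma_finite.

End step.

Fixpoint lebesgue_rV n : {sigma_finite_measure set 'rV[R]_n -> \bar R} :=
  match n with
  | 0 => \d_(0%R : 'rV[R]_0)
  | n'.+1 => lebesgue_rV_step (lebesgue_rV n')
  end.

Lemma lebesgue_rV_box n (A : 'I_n -> set R) : (forall i, measurable (A i)) ->
  lebesgue_rV n [set x | forall i, A i (x 0%R i)] =
  \prod_(i < n) lebesgue_measure (A i).
Proof.
elim: n => [|n IH] in A *; move=> mA.
  by rewrite big_ord0 /= diracE mem_set// => -[].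
rewrite big_ord_recl -IH => [|i]; last exact: mA.
rewrite /= /lebesgue_rV_step /pushforward.
have mB : measurable [set x : 'rV[R]_n | forall i, A (lift ord0 i) (x 0%R i)].
  rewrite (_ : mkset _ = \bigcap_(i in [set: 'I_n])
      ((fun x : 'rV[R]_n => x 0%R i) @^-1` A (lift ord0 i))); last first.
    by apply/seteqP; split=> x /= Bx i; [move=> _|]; exact: Bx.
  apply: fin_bigcap_measurable => // i _.
  by rewrite -[X in measurable X]setTI; exact: measurable_coor.
rewrite -(product_measure1E (@lebesgue_measure R) (lebesgue_rV n) (mA ord0) mB).
congr (product_measure1 _ _ _); apply/seteqP; split=> -[a v] /=.
  move=> Aq; split; first by have := Aq ord0; rewrite cons_rV0.
  by move=> i; have := Aq (lift ord0 i); rewrite cons_rV_lift.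
move=> [Aa Av] i; have [k ->|->] := unliftP ord0 i.
  by rewrite cons_rV_lift.
by rewrite cons_rV0.
Qed.

End lebesgue_rV.

Section spaces.
Variables (R : realType) (n : nat).
Local Notation mu := (@lebesgue_rV R n).
Local Notation "''e_' i" := (delta_mx 0%R i : 'rV[R]_n)
  (at level 8, i at level 2).
Implicit Types (i : 'I_n) (u v g phi : 'rV[R]_n -> R) (s p delta : 'I_n -> R).
Implicit Types (Omega : set 'rV[R]_n).
Local Open Scope ereal_scope.

(* At h = 0 the quotient is 0 / 0 = 0, which does not affect the integral. *)
Definition gagliardo i (s p delta : R) u : \bar R :=
  \int[mu]_x \int[lebesgue_measure]_(h in [set h : R | `|h| <= delta]%R)
    (`|u (x + h *: 'e_i)%R - u x| `^ p / `|h| `^ (1 + s * p))%:E.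

Definition Wdir i (s p delta : R) : set ('rV[R]_n -> R) :=
  [set u | u \in Lfun mu p%:E /\ gagliardo i s p delta u < +oo].

Definition Waniso s p delta : set ('rV[R]_n -> R) :=
  \bigcap_i Wdir i (s i) (p i) (delta i).

Definition W0 s p delta Omega : set ('rV[R]_n -> R) :=
  [set u | Waniso s p delta u /\ {ae mu, forall x, ~ Omega x -> u x = 0%R}].

(* \partial_(i_1) ... \partial_(i_k) phi for l = [:: i_1; ..; i_k] *)
Definition iter_partial (l : seq 'I_n) phi : 'rV[R]_n -> R :=
  foldr (fun i g x => 'D_('e_i) g x) phi l.

Definition test_function phi :=
  [/\ forall l i x, derivable (iter_partial l phi) x 'e_i,
      forall l, continuous (iter_partial l phi)
    & compact (closure [set x | phi x != 0%R])].

(* g represents the distributional derivative \partial_i v; it is only used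
   for v and g in some L^p with p >= 1, for which both integrals are finite *)
Definition is_weak_partial i v g :=
  forall phi, test_function phi ->
    \int[mu]_x (v x * 'D_('e_i) phi x)%:E =
    - \int[mu]_x (g x * phi x)%:E.

Definition Jdelta i (s p delta : R) v : \bar R :=
  (delta `^ (- (p * (1 - s))))%:E * gagliardo i s p delta v.

(* the representative g is unique up to a null set *)
Definition J0 i (s p : R) v : \bar R :=
  let D := [set g | g \in Lfun mu p%:E /\ is_weak_partial i v g] in
  if `[< D !=set0 >]
  then (2 / (p * (1 - s)))%:E * 'N[mu]_p%:E[EFin \o xget (cst 0%R) D] `^ p
  else +oo.

(* Indices are 0-based: the first j directions are those with i < j. *)
Definition Idelta j s p (dk d : 'I_n -> R) Omega (f v : 'rV[R]_n -> R) : \bar R :=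
  \sum_(i < n | (i < j)%N) Jdelta i (s i) (p i) (dk i) v
  + \sum_(i < n | (j <= i)%N) Jdelta i (s i) (p i) (d i) v
  - \int[mu]_(x in Omega) (f x * v x)%:E.

Definition I0 j s p (d : 'I_n -> R) Omega (f v : 'rV[R]_n -> R) : \bar R :=
  \sum_(i < n | (i < j)%N) J0 i (s i) (p i) v
  + \sum_(i < n | (j <= i)%N) Jdelta i (s i) (p i) (d i) v
  - \int[mu]_(x in Omega) (f x * v x)%:E.

End spaces.

Section exponents.
Variables (R : realType) (n : nat).
Implicit Types s p : 'I_n -> R.

Definition pmin p : \bar R := \big[Order.min/+oo%E]_(i < n) (p i)%:E.
Definition pmax p : \bar R := \big[Order.max/-oo%E]_(i < n) (p i)%:E.

Definition sbar s : R := (n%:R^-1 * \sum_(i < n) (s i)^-1)^-1.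
Definition spbar s p : R := (n%:R^-1 * \sum_(i < n) (s i * p i)^-1)^-1.
Definition pstar s p : R :=
  (n%:R * spbar s p / sbar s) / (n%:R - spbar s p).

Lemma pmin_ge1 p : (forall i, 1 < p i) -> (1 <= pmin p)%E.
Proof.
move=> p1; apply: le_bigmin => [|i _]; first exact: leey.
by rewrite lee_fin ltW.
Qed.

End exponents.

Definition LpOmega (R : realType) (n : nat) (Omega : set 'rV[R]_n)
    (oOmega : open Omega) (p : \bar R) (p1 : (1 <= p)%E) :=
  LspaceType (mrestr (lebesgue_rV R n) (measurable_open_rV oOmega)) p1.

Section functionals.
Variables (R : realType) (n : nat) (Omega : set 'rV[R]_n).
Variables (oOmega : open Omega) (p : \bar R) (p1 : (1 <= p)%E).
Local Notation L := (LpOmega oOmega p1).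

Definition Lp_cvg (v_ : nat -> L) (v : L) :=
  'N[mrestr (lebesgue_rV R n) (measurable_open_rV oOmega)]_p
    [(fun x => (v_ k x - v x)%:E)]%E @[k --> \oo] --> 0%E.

Definition zero_ext (v : L) : 'rV[R]_n -> R := patch (fun=> 0) Omega v.

Definition extend_pinfty (D : set ('rV[R]_n -> R))
    (F : ('rV[R]_n -> R) -> \bar R) (v : L) : \bar R :=
  if `[< D (zero_ext v) >] then F (zero_ext v) else +oo%E.

End functionals.

(* sequential definition, equivalent to the topological one when cvg comes
   from a metric, as for Lp_cvg *)
Definition Gamma_cvg (R : realType) (X : Type) (cvg : (nat -> X) -> X -> Prop)
    (F_ : nat -> X -> \bar R) (F : X -> \bar R) :=
  forall x,
    (forall x_ : nat -> X, cvg x_ x -> (F x <= limn_einf (fun k => F_ k (x_ k)))%E)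
    /\ (exists2 x_ : nat -> X, cvg x_ x &
          (limn_esup (fun k => F_ k (x_ k)) <= F x)%E).

(* Main.v *)
(** For a direction [i] let [N h] be the p_i-th power of the L^{p_i} norm of the
    increment [u (x + h e_i) - u x]. By Tonelli, [J^i_delta] is the integral of
    [N h / |h|^{p_i}] against a weight of total mass [2 / (p_i (1 - s_i))] on
    [|h| <= delta].

    Upper bound: [N h <= |h|^{p_i} ||d_i u||^{p_i}], so [J^i_delta <= J^i] and the
    constant sequence recovers the limit.

    Lower bound: truncating [u] at dyadic levels gives an anisotropic Sobolev
    inequality which bounds the p*-norm of [u], hence the linear term, by a power
    smaller than 1 of the energy. So sequences of bounded energy are bounded in
    L^{p*} and in each L^{p_i}; a subsequence converges almost everywhere, and
    Fatou's lemma handles the directions in which [delta_i] is fixed. In a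
    direction in which [delta_i^k] vanishes, some increment [h_k <> 0] does at
    least as well as the average, so the difference quotients of [u_k] with step
    [h_k] are bounded in L^{p_i} by the energy with the sharp constant. A weak
    limit of them, obtained here from the uniform convexity of the norm instead of
    weak compactness, is the weak derivative of the limit. *)

Require Import Defs.
From HB Require Import structures.
From mathcomp Require Import all_boot all_order all_algebra.
From mathcomp Require Import all_classical all_reals all_analysis.
From mathcomp Require Import measurable_realfun ring lra.

Set Implicit Arguments.
Unset Strict Implicit.
Unset Printing Implicit Defensive.

Import Order.TTheory GRing.Theory Num.Theory.
Import numFieldTopology.Exports numFieldNormedType.Exports.

Local Open Scope classical_set_scope.
Local Open Scope ring_scope.

(** * Lebesgue measure on boxes and translations *)

(** The obstacle is uniformity in [k]: the scales delta_i^k vanish, so their seminorms only see ever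
    shorter increments, whereas compactness needs a fixed scale. Splitting an increment in two gives
    N(2h) <= 2^p N(h), hence [u]_{2 delta} <= 2^{p(1-s)} [u]_delta: the normalization makes J_delta
    nonincreasing when delta doubles. Doubling a small scale up to a fixed one therefore costs a
    constant that stays bounded as delta tends to 0. The same halving, iterated, yields the sharp
    bound on N(h) for weak derivatives without smoothing [u]. With sigma = sum 1/(s_i p_i) and S =
    sum 1/s_i, the first hypothesis on the exponents says sigma > 1, the Sobolev exponent is
    S/(sigma - 1), and the linear term grows like the energy to the power sigma/S, below 1 because
    every s_i is. The Sobolev inequality uses increments alone: in a box of twice the volume of a
    set containing the support of a truncation, at least half of the increments lead out of that
    support, and the sides are tuned so that all directions carry the same factor. *)

Section boxes.
Variables (R : realType) (n : nat).
Local Notation mu := (@lebesgue_rV R n).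
Implicit Types a b : 'I_n -> R.

Definition obox a b : set 'rV[R]_n := [set x | forall i, a i < x 0 i < b i].

Lemma obox_itv a b :
  obox a b = [set x | forall i, `]a i, b i[%classic (x 0 i)].
Proof. by apply/seteqP; split=> x /= abx i; have := abx i; rewrite in_itv. Qed.

Lemma measurable_rV_coords (A : 'I_n -> set R) :
  (forall i, measurable (A i)) ->
  measurable [set x : 'rV[R]_n | forall i, A i (x 0 i)].
Proof.
move=> mA; rewrite (_ : mkset _ = \bigcap_(i in [set: 'I_n])
    ((fun x : 'rV[R]_n => x 0 i) @^-1` A i)); last first.
  by apply/seteqP; split=> x /= Ax i; [move=> _|]; exact: Ax.
apply: fin_bigcap_measurable => // i _.
by rewrite -[X in measurable X]setTI; exact: measurable_coor.
Qed.

Lemma measurable_obox a b : measurable (obox a b).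
Proof.
rewrite obox_itv.
by apply: (@measurable_rV_coords (fun i => `]a i, b i[%classic)) => i;
  exact: measurable_itv.
Qed.

Lemma lebesgue_rV_obox a b :
  mu (obox a b) = (\prod_(i < n) lebesgue_measure `]a i, b i[%classic)%E.
Proof.
by rewrite obox_itv (@lebesgue_rV_box R n (fun i => `]a i, b i[%classic)).
Qed.

Lemma obox_lty a b : (mu (obox a b) < +oo)%E.
Proof.
rewrite lebesgue_rV_obox ltey_eq prode_fin_num// => i _.
by rewrite lebesgue_measure_itv; case: ifP.
Qed.

Lemma obox_setI_closed : setI_closed [set B | exists a b, B = obox a b].
Proof.
move=> _ _ [a [b ->]] [a' [b' ->]].
exists (fun i => Num.max (a i) (a' i)), (fun i => Num.min (b i) (b' i)).
apply/seteqP; split=> x /=.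
  move=> [xab xab'] i; rewrite gt_max lt_min.
  by move: (xab i) (xab' i) => /andP[-> ->] /andP[-> ->].
by move=> xab; split=> i; move: (xab i); rewrite gt_max lt_min;
  move=> /andP[/andP[? ?] /andP[? ?]]; apply/andP.
Qed.

Definition cube (k : nat) := obox (fun=> - k%:R) (fun=> k%:R).

Lemma in_cube (x : 'rV[R]_n) : exists k0, forall k, (k0 <= k)%N -> cube k x.
Proof.
pose M := \sum_i `|x 0 i|; exists (Num.truncn M).+1 => k Mk i.
rewrite -ltr_norml; apply: (@le_lt_trans _ _ M).
  by rewrite /M (bigD1 i)//= lerDl sumr_ge0.
by apply: lt_le_trans (truncnS_gt M) _; rewrite ler_nat.
Qed.

Lemma cube_cover : \bigcup_k cube k = setT.
Proof.
rewrite -subTset => x _; have [k xk] := in_cube x.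
by exists k => //; exact: xk.
Qed.

(** Coordinate maps generate the sigma-algebra, and a half-line in one coordinate pulls back to a
    countable union of bounded boxes; so generators of finite measure suffice. *)
Lemma measurable_obox_gen :
  measurable = <<s [set B | exists a b, B = obox a b] >>.
Proof.
apply/seteqP; split; last first.
  apply: smallest_sub; first exact: sigma_algebra_measurable.
  by move=> _ [a [b ->]]; exact: measurable_obox.
pose G := [set B | exists a b, B = obox a b].
apply: smallest_sub; first exact: smallest_sigma_algebra.
rewrite -bigcup_seq/=; apply: bigcup_sub => i _ A [B mB <-].
rewrite setTI.
pose H := [set B : set R | <<s G >> ((fun x : 'rV[R]_n => x 0 i) @^-1` B)].
suff : measurable `<=` H by apply.
suff : <<s @RGenOInfty.G R >> `<=` H.
  move=> GH C mC; apply: GH.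
  suff <- : @measurable _ (measurableTypeR R) =
    <<s @RGenOInfty.G R >> by exact: mC.
  exact: RGenOInfty.measurableE.
apply: smallest_sub.
  split.
  - by rewrite /H /= preimage_set0; exact: sigma_algebra0.
  - by move=> C HC; rewrite /H /= setTD preimage_setC; exact: sigma_algebraC.
  - move=> F HF; rewrite /H /= preimage_bigcup; exact: sigma_algebra_bigcup.
move=> _ [c ->]; rewrite /H /=.
have -> : (fun x : 'rV[R]_n => x 0 i) @^-1` `]c, +oo[ =
    \bigcup_k obox (fun l => if l == i then c else - k%:R) (fun=> k%:R).
  apply/seteqP; split=> x /=; rewrite in_itv/= andbT.
    move=> cx; have [k xk] := in_cube x; exists k => // l.
    by have := xk _ (leqnn k) l; case: eqP => // -> /andP[_ ->]; rewrite cx.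
  by move=> [k _ /(_ i)]; rewrite eqxx => /andP[].
apply: sigma_algebra_bigcup => k; apply: sub_sigma_algebra.
by eexists; eexists.
Qed.

(** Boxes form a generating pi-system exhausted by cubes. Serves translation invariance and the
    fundamental lemma on test functions. *)
Lemma obox_measure_unique (m1 m2 : {measure set 'rV[R]_n -> \bar R}) :
  (forall a b, m1 (obox a b) = m2 (obox a b)) ->
  (forall a b, m1 (obox a b) < +oo)%E ->
  forall A, measurable A -> m1 A = m2 A.
Proof.
move=> m12 m1oo A mA.
apply: (measure_unique [set B | exists a b, B = obox a b] cube) => //.
- exact: measurable_obox_gen.
- exact: obox_setI_closed.
- by move=> k; eexists; eexists.
- exact: cube_cover.
- by move=> _ [a [b ->]].
- by move=> k; exact: m1oo.
Qed.

Lemma measurable_fun_addrV d (T : measurableType d) (f g : T -> 'rV[R]_n) :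
  measurable_fun setT f -> measurable_fun setT g ->
  measurable_fun setT (fun x => f x + g x).
Proof.
move=> mf mg; apply: measurable_fun_rV => i; under eq_fun do rewrite mxE.
apply: measurable_funD.
  exact: (measurableT_comp (measurable_coor i) mf).
exact: (measurableT_comp (measurable_coor i) mg).
Qed.

Lemma measurable_fun_scalerV d (T : measurableType d) (f : T -> R)
    (v : 'rV[R]_n) :
  measurable_fun setT f -> measurable_fun setT (fun x => f x *: v).
Proof.
move=> mf; apply: measurable_fun_rV => i; under eq_fun do rewrite mxE.
exact: measurable_funM.
Qed.

Lemma measurable_translation (y : 'rV[R]_n) :
  measurable_fun setT (fun x : 'rV[R]_n => x + y).
Proof. by apply: measurable_fun_addrV => //; exact: measurable_cst. Qed.

Lemma lebesgue_rV_translation (y : 'rV[R]_n) (A : set 'rV[R]_n) :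
  measurable A -> pushforward mu (fun x => x + y) A = mu A.
Proof.
move: A; pose mp := isMeasurableFun.Build _ _ _ _ _ (measurable_translation y).
pose f : {mfun 'rV[R]_n >-> 'rV[R]_n} := HB.pack (fun x => x + y) mp.
suff H a b : pushforward mu f (obox a b) = mu (obox a b).
  move=> A mA; apply: (@obox_measure_unique (pushforward mu f)) => // a b.
  by have := obox_lty a b; rewrite -(H a b).
rewrite /pushforward (_ : f @^-1` _ =
    obox (fun i => a i - y 0 i) (fun i => b i - y 0 i)); last first.
  by apply/seteqP; split=> x /= abx i; have := abx i;
    rewrite !mxE ltrBlDr ltrBrDr.
rewrite !lebesgue_rV_obox; apply: eq_bigr => i _.
rewrite !lebesgue_measure_itv/= !lte_fin ltrD2r.
by case: ifP => // _; rewrite -!EFinD; congr EFin; ring.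
Qed.

Lemma ge0_integral_translation (y : 'rV[R]_n) (f : 'rV[R]_n -> \bar R) :
  measurable_fun setT f -> (forall x, 0 <= f x)%E ->
  (\int[mu]_x f (x + y)%R = \int[mu]_x f x)%E.
Proof.
move=> mf f0.
pose mp := isMeasurableFun.Build _ _ _ _ _ (measurable_translation y).
pose t : {mfun 'rV[R]_n >-> 'rV[R]_n} := HB.pack (fun x => x + y) mp.
transitivity (\int[pushforward mu t]_x f x)%E.
  by rewrite ge0_integral_pushforward// preimage_setT.
by apply: eq_measure_integral => A mA _; exact: lebesgue_rV_translation.
Qed.

(** No integrability is assumed: positive and negative parts are translated separately. *)
Lemma integral_translation (y : 'rV[R]_n) (f : 'rV[R]_n -> \bar R) :
  measurable_fun setT f ->
  (\int[mu]_x f (x + y)%R = \int[mu]_x f x)%E.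
Proof.
move=> mf; rewrite integralE [RHS]integralE.
congr (_ - _)%E.
  rewrite -[RHS](@ge0_integral_translation y).
  - by apply: eq_integral => x _; rewrite !funeposE.
  - exact: measurable_funepos.
  - by move=> x; exact: funepos_ge0.
rewrite -[RHS](@ge0_integral_translation y).
- by apply: eq_integral => x _; rewrite !funenegE.
- exact: measurable_funeneg.
- by move=> x; exact: funeneg_ge0.
Qed.

End boxes.

(** * Directional increments *)

Section power_inequalities.
Variable R : realType.
Implicit Types a b p : R.

Lemma ler_powRl a b p : 0 <= p -> 0 <= a -> a <= b -> a `^ p <= b `^ p.
Proof.
by move=> p0 a0 ab; rewrite ge0_ler_powR ?nnegrE// (le_trans a0).
Qed.

Lemma powR_midpoint a b p : 1 <= p -> 0 <= a -> 0 <= b ->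
  ((a + b) / 2) `^ p <= (a `^ p + b `^ p) / 2.
Proof.
move=> p1 a0 b0.
have h0 : 0 <= 2^-1 :> R by rewrite invr_ge0.
have h1 : 2^-1 <= 1 :> R by lra.
have := @convex_powR R p p1 (Itv01 h0 h1) a b.
rewrite !inE/= !in_itv/= !andbT => /(_ a0 b0).
rewrite !convRE/= /unstable.onem => H.
rewrite (_ : (a + b) / 2 = 2^-1 * a + (1 - 2^-1) * b); last by lra.
apply: le_trans H _; lra.
Qed.

(** Midpoint convexity. The constant 2^(p-1) is attained at a = b, which is why repeated halving of
    an increment loses nothing. *)
Lemma powRD_le a b p : 1 <= p -> 0 <= a -> 0 <= b ->
  (a + b) `^ p <= 2 `^ p / 2 * (a `^ p + b `^ p).
Proof.
move=> p1 a0 b0; have -> : a + b = 2 * ((a + b) / 2) by lra.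
rewrite powRM//; last by rewrite divr_ge0// addr_ge0.
rewrite -mulrA ler_pM2l ?powR_gt0// [X in _ <= X]mulrC.
exact: powR_midpoint.
Qed.

Lemma powR_normD_le a b p : 1 <= p ->
  `|a + b| `^ p <= 2 `^ p / 2 * (`|a| `^ p + `|b| `^ p).
Proof.
move=> p1; apply: le_trans (powRD_le p1 (normr_ge0 _) (normr_ge0 _)).
by apply: ler_powRl; rewrite ?ler_normD// (le_trans ler01).
Qed.

End power_inequalities.

Section ge0_integral_setT.
Context d (T : measurableType d) (R : realType).
Variable mu : {measure set T -> \bar R}.
Implicit Types f g : T -> \bar R.
Local Open Scope ereal_scope.

Lemma ge0_le_integralT f g :
  measurable_fun setT f -> measurable_fun setT g ->
  (forall x, 0 <= f x) -> (forall x, f x <= g x) ->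
  \int[mu]_x f x <= \int[mu]_x g x.
Proof. by move=> mf mg f0 fg; exact: ge0_le_integral. Qed.

Lemma ge0_integralZlT f k : measurable_fun setT f -> (forall x, 0 <= f x) ->
  (0 <= k)%R -> \int[mu]_x (k%:E * f x) = k%:E * \int[mu]_x f x.
Proof. by move=> mf f0 k0; exact: ge0_integralZl_EFin. Qed.

Lemma ge0_integralZrT f k : measurable_fun setT f -> (forall x, 0 <= f x) ->
  (0 <= k)%R -> \int[mu]_x (f x * k%:E) = (\int[mu]_x f x) * k%:E.
Proof. by move=> mf f0 k0; exact: ge0_integralZr. Qed.

Lemma ge0_integralDT f g :
  measurable_fun setT f -> measurable_fun setT g ->
  (forall x, 0 <= f x) -> (forall x, 0 <= g x) ->
  \int[mu]_x (f x + g x) = \int[mu]_x f x + \int[mu]_x g x.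
Proof. by move=> mf mg f0 g0; exact: ge0_integralD. Qed.

End ge0_integral_setT.

Section lebesgue_scaling.
Variable R : realType.
Local Notation leb := (@lebesgue_measure R).
Local Open Scope ereal_scope.

(** Twice the image of Lebesgue measure under doubling has the right value on half-open intervals,
    hence is Lebesgue measure. *)
Lemma ge0_integral_double (f : R -> \bar R) :
  measurable_fun setT f -> (forall x, 0 <= f x) ->
  \int[leb]_x f x = 2%:E * \int[leb]_x f (2 * x)%R.
Proof.
move=> mf f0.
have m2 : measurable_fun setT (fun x : measurableTypeR R =>
  (2 * x)%R : measurableTypeR R) by exact: measurable_funM.
pose P := measure_function_pushforward__canonical__measure_function_Measure
  leb m2.
transitivity (\int[mscale ((2 : R)%:nng)%R P]_x f x); last first.
  rewrite ge0_integral_mscale//; congr (_ * _).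
  by rewrite ge0_integral_pushforward// preimage_setT.
apply: eq_measure_integral => A mA _; move: A mA.
apply: lebesgue_measure_unique => _ [[a b] _ <-].
transitivity (2%:E * leb `](a / 2)%R, (b / 2)%R]); last first.
  congr (_ * leb _); apply/seteqP; split=> x /=;
    by rewrite !in_itv/= => /andP[h1 h2]; apply/andP; split; lra.
rewrite !lebesgue_measure_itv/= !lte_fin ltr_pM2r ?invr_gt0//.
case: ifP => _; last by rewrite mule0.
by rewrite -!EFinB -EFinM; congr EFin; field.
Qed.

End lebesgue_scaling.

Section directional_differences.
Variables (R : realType) (n : nat).
Local Notation mu := (@lebesgue_rV R n).
Local Notation leb := (@lebesgue_measure R).
Local Notation "''e_' i" := (delta_mx 0%R i : 'rV[R]_n)
  (at level 8, i at level 2).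
Implicit Types (i : 'I_n) (u v : 'rV[R]_n -> R) (p s h : R).
Local Open Scope ereal_scope.

Definition dint i p u h : \bar R :=
  \int[mu]_x (`|u (x + h *: 'e_i)%R - u x| `^ p)%:E.

Lemma dint_ge0 i p u h : 0 <= dint i p u h.
Proof. by apply: integral_ge0 => x _; rewrite lee_fin powR_ge0. Qed.

Lemma measurable_fun_powR_norm d (T : measurableType d) (f : T -> R) p :
  measurable_fun setT f -> measurable_fun setT (fun x => `|f x| `^ p)%R.
Proof.
move=> mf; apply: (@measurableT_comp _ _ _ _ _ _ (@powR R ^~ p)) => //.
exact: measurableT_comp.
Qed.

Lemma measurable_shift_pair i u : measurable_fun setT u ->
  measurable_fun setT (fun z : 'rV[R]_n * R => u (z.1 + z.2 *: 'e_i)%R).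
Proof.
move=> mu_; apply: (measurableT_comp mu_).
by apply: measurable_fun_addrV => //; exact: measurable_fun_scalerV.
Qed.

Lemma measurable_shift u (y : 'rV[R]_n) : measurable_fun setT u ->
  measurable_fun setT (fun x : 'rV[R]_n => u (x + y)%R).
Proof. by move=> mu_; apply: (measurableT_comp mu_ (measurable_translation y)). Qed.

Lemma measurable_diff i u h : measurable_fun setT u ->
  measurable_fun setT (fun x : 'rV[R]_n => u (x + h *: 'e_i)%R - u x)%R.
Proof. by move=> mu_; apply: measurable_funB => //; exact: measurable_shift. Qed.

Lemma measurable_diff_pair i u : measurable_fun setT u ->
  measurable_fun setT
    (fun z : 'rV[R]_n * R => u (z.1 + z.2 *: 'e_i)%R - u z.1)%R.
Proof.
move=> mu_; apply: measurable_funB; first exact: measurable_shift_pair.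
exact: measurableT_comp.
Qed.

Lemma measurable_dint i p u : measurable_fun setT u ->
  measurable_fun setT (dint i p u).
Proof.
move=> mu_.
pose F := fun z : 'rV[R]_n * R =>
  (`|u (z.1 + z.2 *: 'e_i)%R - u z.1| `^ p)%:E.
apply: (@measurable_fun_fubini_tonelli_G _ _ _ _ _ mu F).
  apply/measurable_EFinP; apply: measurable_fun_powR_norm.
  exact: measurable_diff_pair.
by move=> z; rewrite lee_fin powR_ge0.
Qed.

Lemma ge0_tonelli_in (D : set R) (F : 'rV[R]_n * R -> \bar R) :
  measurable D -> measurable_fun setT F -> (forall z, 0 <= F z) ->
  \int[mu]_x \int[leb]_(h in D) F (x, h) =
  \int[leb]_(h in D) \int[mu]_x F (x, h).
Proof.
move=> mD mF F0.
pose G z := F z * (\1_D z.2)%:E.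
have mG : measurable_fun setT G.
  apply: emeasurable_funM => //; apply/measurable_EFinP.
  by apply: (@measurableT_comp _ _ _ _ _ _ (\1_D : measurableTypeR R -> R)).
have G0 z : 0 <= G z by rewrite mule_ge0.
rewrite [RHS]integral_mkcond.
transitivity (\int[mu]_x \int[leb]_h G (x, h)).
  apply: eq_integral => x _; rewrite integral_mkcond.
  apply: eq_integral => h _; rewrite /G patchE indicE/=.
  by case: ifP => _; rewrite ?mule1 ?mule0.
rewrite fubini_tonelli//; apply: eq_integral => h _.
rewrite patchE; case: ifPn => hD.
  by apply: eq_integral => x _; rewrite /G indicE/= hD mule1.
by rewrite integral0_eq// => x _; rewrite /G indicE/= (negbTE hD) mule0.
Qed.

Lemma measurable_norm_le (d : R) : measurable [set h : R | (`|h| <= d)%R].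
Proof.
rewrite (_ : mkset _ = `[(- d)%R, d]%classic); first exact: measurable_itv.
by apply/seteqP; split=> h /=; rewrite in_itv/= ler_norml.
Qed.

Definition gkernel i s p u h : \bar R := dint i p u h * (`|h| `^ (- (1 + s * p)))%:E.

Lemma gkernel_ge0 i s p u h : 0 <= gkernel i s p u h.
Proof. by rewrite mule_ge0 ?dint_ge0// lee_fin powR_ge0. Qed.

Lemma measurable_gkernel i s p u : measurable_fun setT u ->
  measurable_fun setT (gkernel i s p u).
Proof.
move=> mu_; apply: emeasurable_funM; first exact: measurable_dint.
by apply/measurable_EFinP; exact: measurable_fun_powR_norm.
Qed.

(** Tonelli. From here on a seminorm is a one-dimensional integral over the length of the
    increment. *)
Lemma gagliardoE i s p (delta : R) u : measurable_fun setT u ->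
  gagliardo i s p delta u =
  \int[leb]_(h in [set h : R | (`|h| <= delta)%R]) gkernel i s p u h.
Proof.
move=> mu_; rewrite /gagliardo.
rewrite (@ge0_tonelli_in _ (fun z => (`|u (z.1 + z.2 *: 'e_i)%R - u z.1| `^ p /
    `|z.2| `^ (1 + s * p))%:E)).
- apply: eq_integral => h _; rewrite /gkernel /dint.
  rewrite -ge0_integralZrT.
  + by apply: eq_integral => x _; rewrite -EFinM powRN.
  + apply/measurable_EFinP; apply: measurable_fun_powR_norm.
    exact: measurable_diff.
  + by move=> x; rewrite lee_fin powR_ge0.
  + by rewrite powR_ge0.
- exact: measurable_norm_le.
- apply/measurable_EFinP; apply: measurable_funM.
    by apply: measurable_fun_powR_norm; exact: measurable_diff_pair.
  under eq_fun do rewrite -powRN.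
  exact: measurable_fun_powR_norm.
- by move=> z; rewrite lee_fin divr_ge0// powR_ge0.
Qed.

Lemma gagliardo_ge0 i s p (delta : R) u : 0 <= gagliardo i s p delta u.
Proof.
apply: integral_ge0 => x _; apply: integral_ge0 => h _.
by rewrite lee_fin divr_ge0// powR_ge0.
Qed.

Lemma gagliardo_mono i s p (d1 d2 : R) u : measurable_fun setT u ->
  (d1 <= d2)%R -> gagliardo i s p d1 u <= gagliardo i s p d2 u.
Proof.
move=> mu_ d12; rewrite !gagliardoE//; apply: ge0_subset_integral.
- exact: measurable_norm_le.
- exact: measurable_norm_le.
- by apply: measurable_funTS; exact: measurable_gkernel.
- by move=> h _; exact: gkernel_ge0.
- by move=> h /= /le_trans; exact.
Qed.

Lemma measurable_powR_diff i p u h : measurable_fun setT u ->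
  measurable_fun setT
    (fun x : 'rV[R]_n => (`|u (x + h *: 'e_i)%R - u x| `^ p)%:E).
Proof.
move=> mu_; apply/measurable_EFinP; apply: measurable_fun_powR_norm.
exact: measurable_diff.
Qed.

(** The increment of length [2 * h] is a sum of two translates of the one of length [h]: convexity
    costs 2^(p-1), the two equal integrals another 2. *)
Lemma dint_double i p u h : (1 <= p)%R -> measurable_fun setT u ->
  dint i p u (2 * h) <= (2 `^ p)%:E * dint i p u h.
Proof.
move=> p1 mu_.
pose B (x : 'rV[R]_n) := (`|u (x + h *: 'e_i)%R - u x| `^ p)%:E.
pose A (x : 'rV[R]_n) := B (x + h *: 'e_i)%R.
have mB : measurable_fun setT B by exact: measurable_powR_diff.
have mA : measurable_fun setT A.
  exact: (measurableT_comp mB (measurable_translation _)).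
have B0 x : 0 <= B x by rewrite lee_fin powR_ge0.
have A0 x : 0 <= A x by rewrite lee_fin powR_ge0.
have mAB : measurable_fun setT (fun x => A x + B x) by exact: emeasurable_funD.
have AB0 x : 0 <= A x + B x by rewrite adde_ge0.
have c0 : (0 <= 2 `^ p / 2 :> R)%R by rewrite divr_ge0// powR_ge0.
have IA : \int[mu]_x A x = dint i p u h by exact: ge0_integral_translation.
apply: (@le_trans _ _ (\int[mu]_x ((2 `^ p / 2)%:E * (A x + B x)))).
  apply: ge0_le_integralT.
  - exact: measurable_powR_diff.
  - exact: measurable_funeM.
  - by move=> x; rewrite lee_fin powR_ge0.
  - move=> x; rewrite /A /B -EFinD -EFinM lee_fin.
    apply: le_trans (powR_normD_le _ _ p1).
    rewrite addrA subrK -addrA -scalerDl (_ : h + h = 2 * h)%R//; ring.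
rewrite (ge0_integralZlT _ mAB AB0 c0) (ge0_integralDT _ mA mB A0 B0) IA.
rewrite -/(dint i p u h) le_eqVlt; apply/orP; left; apply/eqP.
have -> : dint i p u h + dint i p u h = 2%:E * dint i p u h.
  by rewrite -[2%R]/(1 + 1)%R EFinD ge0_muleDl ?mul1e// lee_fin.
by rewrite muleA -EFinM divfK.
Qed.

(** Substituting 2h for h produces 2 from the measure, 2^p from [dint_double] and 2^(-(1+sp)) from
    the weight. Equivalently, [Jdelta] does not increase when its scale doubles. *)
Lemma gagliardo_double i s p (d : R) u : (1 <= p)%R -> measurable_fun setT u ->
  gagliardo i s p (2 * d) u <= (2 `^ (p * (1 - s)))%:E * gagliardo i s p d u.
Proof.
move=> p1 mu_; rewrite !gagliardoE//.
pose K (c : R) := gkernel i s p u \_ [set h : R | (`|h| <= c)%R].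
have mK c : measurable_fun setT (K c).
  apply/(measurable_restrictT _ (measurable_norm_le c)).
  by apply: measurable_funTS; exact: measurable_gkernel.
have K0 c h : 0 <= K c h.
  by rewrite /K patchE; case: ifP => // _; exact: gkernel_ge0.
rewrite integral_mkcond -/(K _) [X in _ <= _ * X]integral_mkcond -/(K _).
have mK2 : measurable_fun setT (fun h : R => K (2 * d)%R (2 * h)%R).
  by apply: (@measurableT_comp _ _ _ _ _ _ (K (2 * d)%R)).
rewrite (ge0_integral_double (mK _) (K0 _)).
have -> : 2%:E * \int[leb]_h K (2 * d)%R (2 * h)%R =
    \int[leb]_h (2%:E * K (2 * d)%R (2 * h)%R).
  by apply/esym/ge0_integralZlT => // h; exact: K0.
have -> : (2 `^ (p * (1 - s)))%:E * \int[leb]_h K d h =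
    \int[leb]_h ((2 `^ (p * (1 - s)))%:E * K d h).
  by apply/esym/ge0_integralZlT => //; exact: mK.
have key (h : R) : 2%:E * K (2 * d)%R (2 * h)%R <= (2 `^ (p * (1 - s)))%:E * K d h.
  rewrite /K !patchE.
  have -> : ((2 * h)%R \in [set h : R | (`|h| <= 2 * d)%R]) =
      (h \in [set h : R | (`|h| <= d)%R]).
    by apply/idP/idP; rewrite !inE/= normrM ger0_norm// => ?; lra.
  case: ifP => _; last by rewrite !mule0.
  rewrite /gkernel; apply: (@le_trans _ _ (2%:E * ((2 `^ p)%:E * dint i p u h *
      (`|2 * h| `^ (- (1 + s * p)))%:E))).
    rewrite lee_wpmul2l ?lee_fin// lee_wpmul2r ?lee_fin ?powR_ge0//.
    exact: dint_double.
  rewrite -muleA [X in 2%:E * (_ * X)]muleC !muleA [leRHS]muleAC -!EFinM.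
  rewrite lee_wpmul2r ?dint_ge0// lee_fin.
  rewrite normrM (ger0_norm (ler0n _ 2)) powRM// mulrA ler_wpM2r ?powR_ge0//.
  rewrite -{1}(powRr1 (ler0n R 2)) -!powRD; try by apply/implyP => _; rewrite pnatr_eq0.
  by rewrite le_eqVlt; apply/orP; left; apply/eqP; congr (_ `^ _)%R; ring.
apply: ge0_le_integralT.
- exact: measurable_funeM.
- by apply: measurable_funeM; exact: mK.
- by move=> h; rewrite mule_ge0.
- exact: key.
Qed.

End directional_differences.

Section lebesgue_integral_on.
Variable R : realType.
Local Notation leb := (@lebesgue_measure R).
Implicit Types (D : set R) (f g : R -> \bar R).
Local Open Scope ereal_scope.

Lemma ge0_le_integral_leb D f g : measurable D ->
  measurable_fun setT f -> measurable_fun setT g ->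
  (forall h, D h -> 0 <= f h) -> (forall h, D h -> f h <= g h) ->
  \int[leb]_(h in D) f h <= \int[leb]_(h in D) g h.
Proof.
move=> mD mf mg f0 fg; apply: ge0_le_integral => //.
- by apply: measurable_funTS; exact: mf.
- by apply: measurable_funTS; exact: mg.
Qed.

Lemma ge0_integralZl_leb D f k : measurable D -> measurable_fun setT f ->
  (forall h, 0 <= f h) -> (0 <= k)%R ->
  \int[leb]_(h in D) (k%:E * f h) = k%:E * \int[leb]_(h in D) f h.
Proof.
move=> mD mf f0 k0; apply: ge0_integralZl_EFin => //.
by apply: measurable_funTS; exact: mf.
Qed.

Lemma integral_cst_leb (a b : R) (a1 b1 : bool) (c : \bar R) : (a < b)%R ->
  \int[leb]_(h in [set` Interval (BSide a1 a) (BSide b1 b)]) c =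
  c * (b - a)%:E.
Proof.
move=> ab; rewrite -[LHS]/(\int[leb]_(h in _) (cst c h)) integral_cst//.
congr (_ * _); etransitivity; first exact: lebesgue_measure_itv.
by rewrite /= lte_fin ab EFinB.
Qed.

End lebesgue_integral_on.

(** * Seminorms at different scales, and a Poincare inequality for bounded supports *)

Section gagliardo_comparison.
Variables (R : realType) (n : nat).
Local Notation mu := (@lebesgue_rV R n).
Local Notation leb := (@lebesgue_measure R).
Local Notation "''e_' i" := (delta_mx 0%R i : 'rV[R]_n)
  (at level 8, i at level 2).
Implicit Types (i : 'I_n) (u v : 'rV[R]_n -> R) (p s h : R).
Local Open Scope ereal_scope.

Lemma gagliardo_pow2 i s p (d : R) u k : (1 <= p)%R ->
  measurable_fun setT u ->
  gagliardo i s p (2 ^+ k * d) u <=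
    ((2 ^+ k) `^ (p * (1 - s)))%:E * gagliardo i s p d u.
Proof.
move=> p1 mu_; elim: k => [|k IH].
  by rewrite !expr0 mul1r powR1 mul1e.
rewrite exprS -mulrA; apply: le_trans (gagliardo_double _ _ _ p1 mu_) _.
rewrite powRM ?exprn_ge0// EFinM -muleA lee_wpmul2l// lee_fin powR_ge0.
Qed.

(** The bound 2c + d covers both cases: no doubling when c <= d, and a value below 2c by minimality
    of the power otherwise. *)
Lemma pow2_between (c d : R) : (0 < c)%R -> (0 < d)%R ->
  exists k, (c <= 2 ^+ k * d <= 2 * c + d)%R.
Proof.
move=> c0 d0.
have ex : exists k, (c <= 2 ^+ k * d)%R.
  exists (Num.truncn (c / d)).+1; rewrite -ler_pdivrMr//.
  apply: le_trans (ltW (truncnS_gt _)) _.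
  by rewrite -natrX ler_nat ltnW// ltn_expl.
case: (ex_minnP ex) => -[|k] ck kmin; [exists 0%N | exists k.+1].
  by rewrite ck/= expr0 mul1r lerDr mulr_ge0// ltW.
rewrite ck/=; have : (2 ^+ k * d < c)%R.
  by rewrite ltNge; apply/negP => /kmin; rewrite ltnn.
rewrite exprS => h; rewrite -mulrA; lra.
Qed.

(** Double [d] until it exceeds [c]. The coefficient stays bounded as [d] tends to 0, so vanishing
    scales still control the seminorm at a fixed scale. *)
Lemma gagliardo_le i s p (c d : R) u : (1 <= p)%R -> (s < 1)%R ->
  (0 < c)%R -> (0 < d)%R -> measurable_fun setT u ->
  gagliardo i s p c u <=
    ((2 * c + d) `^ (p * (1 - s)))%:E * Jdelta i s p d u.
Proof.
move=> p1 s1 c0 d0 mu_; have [k /andP[ck kc]] := pow2_between c0 d0.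
apply: le_trans (gagliardo_mono i s p mu_ ck) _.
apply: le_trans (gagliardo_pow2 i s d k p1 mu_) _.
rewrite /Jdelta muleA -EFinM lee_wpmul2r ?gagliardo_ge0// lee_fin.
have a0 : (0 <= p * (1 - s))%R by rewrite mulr_ge0 ?subr_ge0 ?(le_trans ler01)// ltW.
rewrite powRN ler_pdivlMr ?powR_gt0// -powRM ?exprn_ge0 ?(ltW d0)//.
by apply: ler_powRl => //; rewrite mulr_ge0 ?exprn_ge0 ?(ltW d0).
Qed.

Lemma Jdelta_ge0 i s p (d : R) u : 0 <= Jdelta i s p d u.
Proof. by rewrite mule_ge0 ?lee_fin ?powR_ge0 ?gagliardo_ge0. Qed.

Lemma dint0 i p u : (p != 0)%R -> dint i p u 0 = 0.
Proof.
move=> p0; rewrite /dint integral0_eq// => x _.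
by rewrite scale0r addr0 subrr normr0 powR0.
Qed.

Lemma measurable_powR_fun p u : measurable_fun setT u ->
  measurable_fun setT (fun x : 'rV[R]_n => (`|u x| `^ p)%:E).
Proof. by move=> mu_; apply/measurable_EFinP; exact: measurable_fun_powR_norm. Qed.

Lemma dint_le_norm i p u h : (1 <= p)%R -> measurable_fun setT u ->
  dint i p u h <= (2 `^ p)%:E * \int[mu]_x (`|u x| `^ p)%:E.
Proof.
move=> p1 mu_.
pose B (x : 'rV[R]_n) := (`|u x| `^ p)%:E.
pose A (x : 'rV[R]_n) := B (x + h *: 'e_i)%R.
have mB : measurable_fun setT B by exact: measurable_powR_fun.
have mA : measurable_fun setT A.
  exact: (measurableT_comp mB (measurable_translation _)).
have B0 x : 0 <= B x by rewrite lee_fin powR_ge0.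
have A0 x : 0 <= A x by rewrite lee_fin powR_ge0.
have mAB : measurable_fun setT (fun x => A x + B x) by exact: emeasurable_funD.
have AB0 x : 0 <= A x + B x by rewrite adde_ge0.
have c0 : (0 <= 2 `^ p / 2 :> R)%R by rewrite divr_ge0// powR_ge0.
have IA : \int[mu]_x A x = \int[mu]_x B x by exact: ge0_integral_translation.
apply: (@le_trans _ _ (\int[mu]_x ((2 `^ p / 2)%:E * (A x + B x)))).
  apply: ge0_le_integralT.
  - exact: measurable_powR_diff.
  - exact: measurable_funeM.
  - by move=> x; rewrite lee_fin powR_ge0.
  - move=> x; rewrite /A /B -EFinD -EFinM lee_fin -(normrN (u x)).
    exact: powR_normD_le.
rewrite (ge0_integralZlT _ mAB AB0 c0) (ge0_integralDT _ mA mB A0 B0) IA.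
rewrite -/B le_eqVlt; apply/orP; left; apply/eqP.
have -> : \int[mu]_x B x + \int[mu]_x B x = 2%:E * \int[mu]_x B x.
  by rewrite -[2%R]/(1 + 1)%R EFinD ge0_muleDl ?mul1e// lee_fin.
by rewrite muleA -EFinM divfK.
Qed.

Section supported.
Variables (Omega : set 'rV[R]_n) (r : R).
Hypothesis r0 : (0 < r)%R.
Hypothesis Omegar : forall x, Omega x -> forall i, (`|x ord0 i| <= r)%R.

(** A shift longer than the width 2r carries every point of [Omega] out of it, so the increment
    there is just [- u x]. *)
Lemma norm_le_dint i p u h : (0 < p)%R -> measurable_fun setT u ->
  (forall x, ~ Omega x -> u x = 0%R) -> (2 * r < h)%R ->
  \int[mu]_x (`|u x| `^ p)%:E <= dint i p u h.
Proof.
move=> p0 mu_ u0 hr; apply: ge0_le_integralT.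
- exact: measurable_powR_fun.
- exact: measurable_powR_diff.
- by move=> x; rewrite lee_fin powR_ge0.
- move=> x; rewrite lee_fin; have [Ox|/u0 ->] := pselect (Omega x); last first.
    by rewrite normr0 powR0 ?gt_eqF// powR_ge0.
  rewrite (u0 (x + h *: 'e_i)%R) ?sub0r ?normrN// => /Omegar/(_ i).
  rewrite !mxE eqxx/= mulr1 => xh.
  have := Omegar Ox i; rewrite ler_norml => /andP[x1 x2].
  by move: xh; rewrite ler_norml => /andP[x3 x4]; lra.
Qed.

(** Integrate [norm_le_dint] over 2r < h <= 3r, an interval of length r on which the weight is at
    least (3r)^(-(1+sp)). *)
Lemma norm_le_gagliardo3 i s p u : (0 < p)%R -> (0 < s)%R ->
  measurable_fun setT u -> (forall x, ~ Omega x -> u x = 0%R) ->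
  \int[mu]_x (`|u x| `^ p)%:E <=
    ((3 * r) `^ (1 + s * p) / r)%:E * gagliardo i s p (3 * r) u.
Proof.
move=> p0 s0 mu_ u0; set N := \int[mu]_x _.
have N0 : 0 <= N by apply: integral_ge0 => x _; rewrite lee_fin powR_ge0.
have b0 : (0 < (3 * r) `^ (1 + s * p))%R by rewrite powR_gt0// mulr_gt0.
suff H : (r / (3 * r) `^ (1 + s * p))%:E * N <= gagliardo i s p (3 * r) u.
  rewrite -[N]mul1e; have -> : 1 = ((3 * r) `^ (1 + s * p) / r)%:E *
      (r / (3 * r) `^ (1 + s * p))%:E :> \bar R.
    by rewrite -EFinM; congr EFin; field; rewrite !gt_eqF.
  rewrite -muleA lee_wpmul2l// lee_fin divr_ge0 ?ltW//.
rewrite gagliardoE//.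
apply: (@le_trans _ _ (\int[leb]_(h in `](2 * r)%R, (3 * r)%R]) gkernel i s p u h)); last first.
  apply: ge0_subset_integral => //.
  - exact: measurable_norm_le.
  - by apply: measurable_funTS; exact: measurable_gkernel.
  - by move=> h _; exact: gkernel_ge0.
  - move=> h /=; rewrite in_itv/= => /andP[h1 h2]; rewrite ger0_norm//; lra.
apply: (@le_trans _ _ (\int[leb]_(h in `](2 * r)%R, (3 * r)%R])
    (N * ((3 * r) `^ (- (1 + s * p)))%:E))); last first.
  apply: ge0_le_integral_leb => //.
  - exact: measurable_gkernel.
  - by move=> h _; rewrite mule_ge0// lee_fin powR_ge0.
  - move=> h /=; rewrite in_itv/= => /andP[h1 h2].
    apply: lee_pmul => //; first by rewrite lee_fin powR_ge0.
      exact: norm_le_dint.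
    have h0 : (0 < h)%R by lra.
    rewrite lee_fin !powRN lef_pV2 ?posrE ?powR_gt0 ?normr_gt0 ?gt_eqF ?mulr_gt0//.
    apply: ler_powRl => //; first by rewrite addr_ge0// mulr_ge0// ltW.
    by rewrite ger0_norm// ltW.
rewrite integral_cst_leb ?ltr_pM2r ?ltr_nat// (_ : 3 * r - 2 * r = r)%R; last by ring.
rewrite -[leRHS]muleA -EFinM [leRHS]muleC lee_wpmul2r// lee_fin powRN mulrC.
exact: lexx.
Qed.

Lemma norm_le_gagliardo i s p (d : R) : (1 <= p)%R -> (0 < s < 1)%R ->
  (0 < d)%R -> exists2 C : R, (0 <= C)%R &
    forall u, measurable_fun setT u -> (forall x, ~ Omega x -> u x = 0%R) ->
    \int[mu]_x (`|u x| `^ p)%:E <= C%:E * gagliardo i s p d u.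
Proof.
move=> p1 /andP[s0 s1] d0.
have p0 : (0 < p)%R by rewrite (lt_le_trans ltr01).
exists ((3 * r) `^ (1 + s * p) / r *
    ((2 * (3 * r) + d) `^ (p * (1 - s)) * d `^ (- (p * (1 - s)))))%R.
  by rewrite !mulr_ge0 ?powR_ge0// invr_ge0 ltW.
move=> u mu_ u0; apply: le_trans (norm_le_gagliardo3 i p0 s0 mu_ u0) _.
rewrite [X in _ <= X * _]EFinM -[leRHS]muleA.
apply: lee_wpmul2l; first by rewrite lee_fin divr_ge0 ?powR_ge0 ?(ltW r0).
by rewrite EFinM -muleA; apply: gagliardo_le => //; rewrite mulr_gt0.
Qed.

(** Up to [d] the seminorm suffices, since h^(1+sp) <= t^(1+sp). Beyond [d] the increments are
    bounded by the norm, which the Poincare inequality controls, and (t/d)^(sp) >= 1. Every [t] has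
    to be covered because the box sides used in the Sobolev inequality depend on [u]. *)
Lemma average_dint_le i s p (d : R) : (1 <= p)%R -> (0 < s < 1)%R ->
  (0 < d)%R -> exists2 K : R, (0 <= K)%R &
    forall u, measurable_fun setT u -> (forall x, ~ Omega x -> u x = 0%R) ->
    forall t : R, (0 < t)%R ->
    \int[leb]_(h in `[0%R, t]) dint i p u h <=
      (K * (t * t `^ (s * p)))%:E * gagliardo i s p d u.
Proof.
move=> p1 s01 d0; have [C C0 HC] := norm_le_gagliardo i p1 s01 d0.
have p0 : (0 < p)%R by rewrite (lt_le_trans ltr01).
move: s01 => /andP[s0 s1].
exists (1 + 2 `^ p * C / d `^ (s * p))%R.
  by rewrite addr_ge0// divr_ge0 ?mulr_ge0 ?powR_ge0.
move=> u mu_ u0 t t0.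
have sp0 : (0 <= s * p)%R by rewrite mulr_ge0// ltW.
have tt0 : (0 <= t * t `^ (s * p))%R by rewrite mulr_ge0 ?powR_ge0 ?ltW.
have [td|dt] := leP t d.
- apply: (@le_trans _ _ ((t * t `^ (s * p))%:E * gagliardo i s p d u)); last first.
    rewrite lee_wpmul2r ?gagliardo_ge0// lee_fin mulrDl mul1r lerDl.
    by rewrite mulr_ge0// divr_ge0 ?mulr_ge0 ?powR_ge0.
  apply: (@le_trans _ _ (\int[leb]_(h in `[0%R, t])
      ((t * t `^ (s * p))%:E * gkernel i s p u h))).
    apply: ge0_le_integral_leb => //.
    + exact: measurable_dint.
    + by apply: measurable_funeM; exact: measurable_gkernel.
    + by move=> h _; exact: dint_ge0.
    + move=> h /=; rewrite in_itv/= => /andP[]; rewrite le_eqVlt => /predU1P[<- _|h0 ht].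
        by rewrite dint0 ?gt_eqF// mule_ge0// gkernel_ge0.
      rewrite /gkernel muleCA -EFinM -[leLHS]mule1 lee_wpmul2l ?dint_ge0// lee_fin.
      rewrite (gtr0_norm h0) powRN ler_pdivlMr ?powR_gt0// mul1r.
      rewrite powRD ?powRr1 ?(ltW h0)//; last by apply/implyP => _; rewrite gt_eqF.
      by rewrite ler_pM ?powR_ge0 ?(ltW h0)//; apply: ler_powRl => //; exact: ltW.
  rewrite ge0_integralZl_leb//; [|exact: measurable_gkernel|by move=> h; exact: gkernel_ge0].
  rewrite lee_wpmul2l ?lee_fin// gagliardoE//; apply: ge0_subset_integral => //.
  + exact: measurable_norm_le.
  + by apply: measurable_funTS; exact: measurable_gkernel.
  + by move=> h _; exact: gkernel_ge0.
  + move=> h /=; rewrite in_itv/= => /andP[h1 h2]; rewrite ger0_norm//; lra.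
- apply: (@le_trans _ _ (\int[leb]_(h in `[0%R, t])
      ((2 `^ p)%:E * \int[mu]_x (`|u x| `^ p)%:E))).
    apply: ge0_le_integral_leb => //.
    + exact: measurable_dint.
    + by move=> h _; exact: dint_ge0.
    + by move=> h _; exact: dint_le_norm.
  rewrite integral_cst_leb// subr0 muleC.
  apply: (@le_trans _ _ (t%:E * ((2 `^ p)%:E * (C%:E * gagliardo i s p d u)))).
    rewrite lee_wpmul2l ?lee_fin ?(ltW t0)// lee_wpmul2l ?lee_fin ?powR_ge0//.
    exact: HC.
  rewrite !muleA -!EFinM lee_wpmul2r ?gagliardo_ge0// lee_fin.
  rewrite mulrDl mul1r -[leLHS]add0r lerD//.
  rewrite -[leLHS]mulrA [leLHS]mulrC -!mulrA ler_wpM2l ?powR_ge0// ler_wpM2l//.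
  rewrite mulrCA ler_peMr ?(ltW t0)// mulrC ler_pdivlMr ?powR_gt0// mul1r.
  by apply: ler_powRl; rewrite // ltW.
Qed.

End supported.
End gagliardo_comparison.

(** * The anisotropic Sobolev inequality *)

Section integral_mrestr.
Context d (T : measurableType d) (R : realType).
Variables (mu : {measure set T -> \bar R}) (D : set T) (mD : measurable D).
Local Open Scope ereal_scope.

(** The measure is the sum of its restrictions to [D] and to the complement, and an integrand cut
    off outside [D] only sees the first. *)
Lemma ge0_integral_mrestr (f : T -> \bar R) :
  measurable_fun setT f -> (forall x, 0 <= f x) ->
  \int[mrestr mu mD]_x f x = \int[mu]_(x in D) f x.
Proof.
move=> mf f0.
pose fD := f \_ D.
have mfD : measurable_fun setT fD.
  by apply/(measurable_restrictT _ mD); exact: measurable_funTS.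
have fD0 x : 0 <= fD x by rewrite /fD patchE; case: ifP.
rewrite [RHS]integral_mkcond -/fD.
transitivity (\int[mrestr mu mD]_x fD x).
  apply: ae_eq_integral => //; exists (~` D); split.
  - exact: measurableC.
  - by rewrite /= /mrestr setICl measure0.
  - move=> x /= fx Dx; apply: fx => _; rewrite /fD patchE mem_set//.
transitivity (\int[mrestr mu mD]_x fD x + \int[mrestr mu (measurableC mD)]_x fD x).
  rewrite [X in _ + X](_ : _ = 0) ?adde0//.
  transitivity (\int[mrestr mu (measurableC mD)]_x (cst 0 x)); last exact: integral0.
  apply: ae_eq_integral => //; exists D; split => //.
  - by rewrite /= /mrestr setICr measure0.
  - move=> x /= fx; apply: contrapT => Dx; apply: fx => _.
    by rewrite /fD patchE memNset.
rewrite -ge0_integral_measure_add//; apply: eq_measure_integral => A mA _.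
etransitivity; first exact: measure_addE.
rewrite /= /mrestr -measureU//; try exact: measurableI.
- by rewrite -setIUr setUv setIT.
- by apply: measurableI => //; exact: measurableC.
- by rewrite setIACA setICr setI0.
Qed.

End integral_mrestr.

(** * Measure of a superlevel set in terms of coordinate increments *)

Section box_inequality.
Variables (R : realType) (n : nat).
Local Notation mu := (@lebesgue_rV R n).
Local Notation leb := (@lebesgue_measure R).
Local Notation "''e_' i" := (delta_mx 0%R i : 'rV[R]_n)
  (at level 8, i at level 2).
Implicit Types (i : 'I_n) (u v : 'rV[R]_n -> R).
Local Open Scope ereal_scope.

Section cbox.
Variable r : 'I_n -> R.
Hypothesis r0 : forall i, (0 < r i)%R.

Definition cbox : set 'rV[R]_n := [set h | forall i, `[0%R, r i]%classic (h 0%R i)].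

Lemma measurable_cbox : measurable cbox.
Proof.
by apply: (@measurable_rV_coords R n (fun i => `[0%R, r i]%classic)) => i;
  exact: measurable_itv.
Qed.

Lemma lebesgue_rV_cbox : mu cbox = (\prod_i r i)%:E.
Proof.
rewrite (@lebesgue_rV_box R n (fun i => `[0%R, r i]%classic)); last first.
  by move=> i; exact: measurable_itv.
rewrite -prodEFin; apply: eq_bigr => i _.
by rewrite lebesgue_measure_itv/= lte_fin r0 -EFinB subr0.
Qed.

(** The image of the measure on the box under one coordinate is the measure on that side times the
    product of the other sides. *)
Lemma ge0_integral_cbox_coord i (phi : R -> \bar R) :
  measurable_fun setT phi -> (forall t, 0 <= phi t) ->
  \int[mu]_(h in cbox) phi (h 0%R i) =
  (\prod_(l | l != i) r l)%:E * \int[leb]_(t in `[0%R, r i]) phi t.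
Proof.
move=> mphi phi0.
have mc : measurable_fun setT
    (fun x : 'rV[R]_n => x 0%R i : measurableTypeR R) := @measurable_coor R n i.
have q0 : (0 <= \prod_(l | l != i) r l)%R by apply: prodr_ge0 => l _; exact: ltW.
rewrite -(ge0_integral_mrestr _ measurable_cbox); last 2 first.
- exact: (measurableT_comp mphi mc).
- by move=> h.
have mI : measurable (`[0%R, r i]%classic : set (measurableTypeR R)).
  exact: measurable_itv.
pose P := measure_function_pushforward__canonical__measure_function_Measure
  (mrestr mu measurable_cbox) mc.
transitivity (\int[P]_t phi t).
  by rewrite ge0_integral_pushforward// preimage_setT.
transitivity (\int[mscale (NngNum q0) (mrestr leb mI)]_t phi t); last first.
  by rewrite ge0_integral_mscale// (ge0_integral_mrestr _ mI).
apply: eq_measure_integral => A mA _.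
transitivity (mu [set h | forall l, (if l == i then A `&` `[0%R, r i]
    else `[0%R, r l])%classic (h 0%R l)]).
  congr (mu _); apply/seteqP; split=> h /=.
    move=> [Ah Qh] l; case: eqP => [->|_]; last exact: Qh.
    by split=> //; exact: Qh.
  move=> H; split; first by have := H i; rewrite eqxx => -[].
  by move=> l; have := H l; case: eqP => [->|_] // [].
rewrite (@lebesgue_rV_box R n (fun l => if l == i then A `&` `[0%R, r i]
    else `[0%R, r l])%classic); last first.
  move=> l; case: eqP => _; last exact: measurable_itv.
  by apply: measurableI => //; exact: measurable_itv.
rewrite (bigD1 i)//= eqxx muleC; congr (_ * _).
rewrite -prodEFin; apply: eq_bigr => l li.
by rewrite (negbTE li) lebesgue_measure_itv/= lte_fin r0 -EFinB subr0.
Qed.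

End cbox.

(** Vertices of the path from 0 to [h] that follows the coordinate axes one after the other. *)
Definition partial_sum (h : 'rV[R]_n) (k : nat) : 'rV[R]_n :=
  \sum_(l < n | (l < k)%N) h 0%R l *: 'e_l.

Lemma partial_sum0 h : partial_sum h 0 = 0%R.
Proof. by rewrite /partial_sum big_pred0. Qed.

Lemma partial_sumn h : partial_sum h n = h.
Proof.
rewrite [RHS]row_sum_delta /partial_sum; apply: eq_bigl => l.
by rewrite ltn_ord.
Qed.

Lemma partial_sumS h i :
  partial_sum h i.+1 = (partial_sum h i + h 0%R i *: 'e_i)%R.
Proof.
rewrite /partial_sum (bigD1 i)//= addrC; congr (_ + _)%R.
by apply: eq_bigl => l; rewrite ltnS andbC ltn_neqAle.
Qed.

Lemma measurable_partial_sum k :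
  measurable_fun setT (fun h : 'rV[R]_n => partial_sum h k).
Proof.
apply: measurable_fun_rV => i.
have [ik|ki] := boolP (i < k)%N.
  rewrite (_ : (fun h => _) = (fun h : 'rV[R]_n => h 0%R i)); last first.
    apply/funext => h; rewrite summxE (bigD1 i)//= big1 ?addr0.
      by rewrite !mxE !eqxx mulr1.
    by move=> l /andP[_ li]; rewrite !mxE eqxx/= eq_sym (negbTE li) mulr0.
  exact: measurable_coor.
rewrite (_ : (fun h => _) = cst 0%R); first exact: measurable_cst.
apply/funext => h; rewrite summxE big1// => l lk.
rewrite !mxE eqxx/= eq_sym; case: eqP => [li|]; last by rewrite mulr0.
by move: ki; rewrite -li lk.
Qed.

Lemma telescope_partial_sum (g : 'rV[R]_n -> R) x h :
  (g (x + h) - g x = \sum_(i < n) (g (x + partial_sum h i.+1) -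
     g (x + partial_sum h i)))%R.
Proof.
rewrite -(big_mkord xpredT (fun i : nat => g (x + partial_sum h i.+1) -
     g (x + partial_sum h i))%R).
by rewrite telescope_sumr// partial_sumn partial_sum0 addr0.
Qed.

(** Along the axis-parallel path [g] changes by at least [lam] in [n] steps, so one step is at least
    lam/n, and its term alone reaches 1. *)
Lemma jump_le (g : 'rV[R]_n -> R) (lam : R) (p : 'I_n -> R) x h :
  (0 < lam)%R -> (forall i, 0 < p i)%R ->
  (lam <= `|g x|)%R -> g (x + h)%R = 0%R ->
  (1 <= \sum_i (n%:R / lam) `^ p i *
     `|g (x + partial_sum h i + h 0 i *: 'e_i) - g (x + partial_sum h i)| `^ p i)%R.
Proof.
move=> lam0 p0 gx gh0; set t := fun i : 'I_n =>
  (g (x + partial_sum h i + h 0 i *: 'e_i) - g (x + partial_sum h i))%R.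
have t0 i : (0 <= (n%:R / lam) `^ p i * `|t i| `^ p i)%R.
  by rewrite mulr_ge0 ?powR_ge0.
have lamt : (lam <= \sum_i `|t i|)%R.
  apply: le_trans (ler_norm_sum _ _ _).
  rewrite (_ : \sum_i t i = g (x + h) - g x)%R; last first.
    rewrite telescope_partial_sum; apply: eq_bigr => i _.
    by rewrite partial_sumS addrA.
  by rewrite gh0 sub0r normrN.
have [i ti] : exists i, (lam / n%:R <= `|t i|)%R.
  apply/not_existsP => H.
  have n0 : (0 < n)%N.
    rewrite lt0n; apply/eqP => n0; move: lamt; rewrite big1 ?leNgt ?lam0// => i _.
    by have := ltn_ord i; rewrite [in X in (_ < X)%N]n0.
  have : (\sum_i `|t i| < \sum_(i < n) lam / n%:R)%R.
    apply: ltr_sum; first by apply/hasP; exists (Ordinal n0); rewrite ?mem_index_enum.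
    by move=> i _; rewrite ltNge; apply/negP; exact: H.
  rewrite sumr_const card_ord -(mulr_natr (lam / n%:R)%R).
  rewrite divfK ?pnatr_eq0 -?lt0n//.
  by rewrite ltNge lamt.
have n0 : (0 < n)%N by exact: leq_ltn_trans (ltn_ord i).
rewrite (bigD1 i)//= -[leLHS]addr0 lerD//; last by apply: sumr_ge0 => l _; exact: t0.
rewrite -powRM//; last by rewrite divr_ge0// ltW.
apply: (@le_trans _ _ (1 `^ p i)%R); first by rewrite powR1.
apply: ler_powRl => //; first exact: ltW.
rewrite mulrAC ler_pdivlMr// mul1r -ler_pdivrMl ?ltr0n// mulrC.
exact: ti.
Qed.

(** Integrate [jump_le] over the pairs (x, h) with x in [E], h in the box and g(x+h) = 0. As the set
    where [g] is nonzero has at most half the volume of the box, at least half of the h qualify for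
    every x: this is the left side. On the right a translation removes the starting vertex of each
    step, so that a single coordinate of h survives. *)
Lemma box_level_le (r : 'I_n -> R) (g : 'rV[R]_n -> R) (lam : R)
    (p : 'I_n -> R) (E : set 'rV[R]_n) :
  (forall i, 0 < r i)%R -> (0 < lam)%R -> (forall i, 0 < p i)%R ->
  measurable_fun setT g -> measurable E ->
  (forall x, E x -> lam <= `|g x|)%R ->
  mu [set x | g x != 0%R] <= (2^-1 * \prod_i r i)%:E ->
  (2^-1 * \prod_i r i)%:E * mu E <=
  \sum_i ((n%:R / lam) `^ p i * \prod_(l | l != i) r l)%:E *
     \int[leb]_(h in `[0%R, r i]) dint i (p i) g h.
Proof.
move=> r0 lam0 p0 mg mE Eg Fq.
set q := (\prod_i r i)%R in Fq *.
have q0 : (0 <= q)%R by apply: prodr_ge0 => i _; exact: ltW.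
pose Q := cbox r.
have mQ : measurable Q := measurable_cbox r.
have muQ : mu Q = q%:E by exact: lebesgue_rV_cbox.
have mgp : measurable_fun setT (fun z : 'rV[R]_n * 'rV[R]_n => g (z.1 + z.2)%R).
  by apply: (measurableT_comp mg); exact: measurable_fun_addrV.
pose Z : set 'rV[R]_n := [set x | g x = 0%R].
have mZ : measurable Z.
  rewrite (_ : Z = g @^-1` [set 0%R])//.
  by rewrite -[X in measurable X]setTI; exact: mg.
have mF : measurable [set x | g x != 0%R].
  rewrite (_ : mkset _ = ~` Z); first exact: measurableC.
  by apply/seteqP; split=> x /=; [move/eqP|move/eqP].
pose L (z : 'rV[R]_n * 'rV[R]_n) : \bar R :=
  (\1_E z.1)%:E * ((\1_Q z.2)%:E * (\1_Z (z.1 + z.2)%R)%:E).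
pose t i (z : 'rV[R]_n * 'rV[R]_n) := ((n%:R / lam) `^ p i *
  `|g (z.1 + partial_sum z.2 i + z.2 0 i *: 'e_i) - g (z.1 + partial_sum z.2 i)| `^ p i)%R.
have mt i : measurable_fun setT (t i).
  apply: measurable_funM => //; apply: measurable_fun_powR_norm.
  have mp : measurable_fun setT (fun z : 'rV[R]_n * 'rV[R]_n => z.1 + partial_sum z.2 i)%R.
    apply: measurable_fun_addrV => //.
    exact: (measurableT_comp (measurable_partial_sum i) measurable_snd).
  apply: measurable_funB; last exact: (measurableT_comp mg mp).
  apply: (measurableT_comp mg); apply: measurable_fun_addrV => //.
  apply: measurable_fun_scalerV.
  exact: (measurableT_comp (measurable_coor i) measurable_snd).
have t0 i z : (0 <= t i z)%R by rewrite mulr_ge0 ?powR_ge0.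
pose Rg (z : 'rV[R]_n * 'rV[R]_n) : \bar R :=
  (\1_Q z.2)%:E * (\sum_i t i z)%:E.
have LR z : L z <= Rg z.
  rewrite /L /Rg -!EFinM lee_fin !indicE.
  have S0 : (0 <= \sum_i t i z)%R by apply: sumr_ge0 => i _.
  have [zE|] := boolP (z.1 \in E); last by rewrite mul0r mulr_ge0.
  have [zQ|] := boolP (z.2 \in Q); last by rewrite !mul0r mulr0.
  have [zZ|] := boolP ((z.1 + z.2)%R \in Z); last by rewrite !mulr0 mul1r.
  rewrite !mul1r; apply: jump_le => //; first by apply: Eg; exact: set_mem zE.
  exact: (set_mem zZ).
have mQ2 : measurable_fun setT (fun z : 'rV[R]_n * 'rV[R]_n => (\1_Q z.2 : R)%:E).
  apply/measurable_EFinP; apply: (@measurableT_comp _ _ _ _ _ _ (\1_Q : _ -> R)) => //.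
have mL : measurable_fun setT L.
  apply: emeasurable_funM.
    by apply/measurable_EFinP; apply: (@measurableT_comp _ _ _ _ _ _ (\1_E : _ -> R)).
  apply: emeasurable_funM => //; apply/measurable_EFinP.
  apply: (@measurableT_comp _ _ _ _ _ _ (\1_Z : _ -> R)) => //.
  exact: measurable_fun_addrV.
have mR : measurable_fun setT Rg.
  apply: emeasurable_funM => //; apply/measurable_EFinP.
  exact: measurable_sum.
have L0 z : 0 <= L z by rewrite !mule_ge0.
have R0 z : 0 <= Rg z by apply: le_trans (L0 z) (LR z).
(* The bad h form a translate of the set where [g] is nonzero, of measure at most q/2. *)
have muZ x : (2^-1 * q)%:E <= mu (Q `&` [set h | Z (x + h)%R]).
  have mZx : measurable [set h | Z (x + h)%R].
    rewrite (_ : mkset _ = (fun h => h + x)%R @^-1` Z); last first.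
      by apply/seteqP; split=> h /=; rewrite addrC.
    by rewrite -[X in measurable X]setTI; exact: measurable_translation.
  have H : q%:E <= mu (Q `&` [set h | Z (x + h)%R]) + (2^-1 * q)%:E.
    have mS : measurable ((fun h => h + x)%R @^-1` [set y | g y != 0%R]).
      by rewrite -[X in measurable X]setTI; exact: measurable_translation.
    apply: le_trans (leeD (lexx _) Fq).
    rewrite -muQ -(lebesgue_rV_translation x mF).
    apply: le_trans (measureU2 _ _ mS); last exact: measurableI.
    apply: le_measure; rewrite ?inE//.
      by apply: measurableU => //; exact: measurableI.
    move=> h Qh; have [Zh|Zh] := pselect (Z (x + h)%R); [by left|right].
    by apply/eqP; rewrite addrC.
  rewrite (_ : 2^-1 * q = q - 2^-1 * q)%R; last by field.
  by rewrite EFinB leeBlDr.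
have IL : (2^-1 * q)%:E * mu E <= \int[mu]_x \int[mu]_h L (x, h).
  rewrite -[E]setIT -integral_indic//.
  have mE1 : measurable_fun setT (fun x : 'rV[R]_n => (\1_E x : R)%:E).
    by apply/measurable_EFinP.
  rewrite -ge0_integralZlT//; last by rewrite mulr_ge0.
  apply: ge0_le_integralT.
  - exact: measurable_funeM.
  - exact: (@measurable_fun_fubini_tonelli_F _ _ _ _ _ mu L).
  - by move=> x; rewrite mule_ge0// lee_fin ?mulr_ge0.
  - move=> x; rewrite (_ : \int[mu]_h _ =
        (\1_E x)%:E * mu (Q `&` [set h | Z (x + h)%R])).
      by rewrite muleC lee_wpmul2l.
    have mZx : measurable [set h | Z (x + h)%R].
      rewrite (_ : mkset _ = (fun h => h + x)%R @^-1` Z); last first.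
        by apply/seteqP; split=> h /=; rewrite addrC.
      by rewrite -[X in measurable X]setTI; exact: measurable_translation.
    rewrite -[Q `&` _]setIT -integral_indic//; last exact: measurableI.
    rewrite -ge0_integralZlT//.
      apply: eq_integral => h _; rewrite /L/= !indicE in_setI -!EFinM; congr EFin; congr (_ * _)%R.
      rewrite -natrM mulnb; congr ((_ && _)%:R)%R.
    apply/measurable_EFinP; apply: measurable_indic; exact: measurableI.
apply: le_trans IL _.
apply: (@le_trans _ _ (\int[mu]_x \int[mu]_h Rg (x, h))).
  apply: ge0_le_integralT.
  - exact: (@measurable_fun_fubini_tonelli_F _ _ _ _ _ mu L).
  - exact: (@measurable_fun_fubini_tonelli_F _ _ _ _ _ mu Rg).
  - by move=> x; apply: integral_ge0.
  - move=> x; apply: ge0_le_integralT => //.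
    + exact: (measurableT_comp mL (pair1_measurable x)).
    + exact: (measurableT_comp mR (pair1_measurable x)).
rewrite (@fubini_tonelli _ _ _ _ _ mu mu Rg mR R0).
rewrite (_ : \int[mu]_h _ = \int[mu]_(h in Q) \sum_i
    ((n%:R / lam) `^ p i)%:E * dint i (p i) g (h 0%R i)); last first.
  rewrite [RHS]integral_mkcond; apply: eq_integral => h _.
  rewrite patchE /Rg/= indicE; case: ifPn => hQ; last first.
    by rewrite integral0_eq// => x _; rewrite mul0e.
  under eq_integral do rewrite mul1e -sumEFin.
  rewrite ge0_integral_sum//; last 2 first.
  - move=> i; apply/measurable_EFinP.
    exact: (measurableT_comp (mt i) (pair2_measurable h)).
  - by move=> i x _; rewrite lee_fin.
  apply: eq_bigr => i _; rewrite /t/=.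
  under eq_integral do rewrite EFinM.
  have md := measurable_powR_diff i (p i) (h 0%R i) mg.
  pose B (x : 'rV[R]_n) := (`|g (x + h 0%R i *: 'e_i)%R - g x| `^ p i)%:E.
  have B0 x : 0 <= B x by rewrite lee_fin powR_ge0.
  have mBh : measurable_fun setT (fun x : 'rV[R]_n => B (x + partial_sum h i)%R).
    exact: (measurableT_comp md (measurable_translation _)).
  rewrite (ge0_integralZlT mu mBh (fun x => B0 _) (powR_ge0 _ _)).
  by congr (_ * _); exact: (ge0_integral_translation _ md B0).
have mdc i : measurable_fun setT (fun h : 'rV[R]_n => dint i (p i) g (h 0%R i)).
  exact: (measurableT_comp (measurable_dint i (p i) mg) (measurable_coor i)).
rewrite ge0_integral_sum//; last 2 first.
- by move=> i; apply: measurable_funTS; apply: measurable_funeM; exact: mdc.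
- by move=> i h _; rewrite mule_ge0 ?lee_fin ?powR_ge0 ?dint_ge0.
apply: lee_sum => i _; rewrite ge0_integralZl_EFin ?powR_ge0//; last 2 first.
- by move=> h _; exact: dint_ge0.
- by apply: measurable_funTS; exact: mdc.
rewrite (ge0_integral_cbox_coord r0); last 2 first.
- exact: measurable_dint.
- by move=> t'; exact: dint_ge0.
by rewrite muleA -EFinM.
Qed.

End box_inequality.

(** * Dyadic truncation and the recursion over levels *)

Section truncation.
Variable R : realType.
Implicit Types (a b y : R).

(** Each y^p is y y^(p-1) <= y Y^(p-1), where Y is the whole sum. *)
Lemma sum_powR_le (p : R) (N : nat) (y : nat -> R) :
  1 <= p -> (forall k, 0 <= y k) ->
  \sum_(k < N) y k `^ p <= (\sum_(k < N) y k) `^ p.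
Proof.
move=> p1 y0; set Y := \sum_(k < N) y k.
have p0 : 0 < p by rewrite (lt_le_trans ltr01).
have Y0 : 0 <= Y by apply: sumr_ge0.
rewrite -[leRHS](mulr_powRB1 Y0 p0) {1}/Y mulr_suml; apply: ler_sum => k _.
rewrite -[leLHS](mulr_powRB1 (y0 k) p0) ler_wpM2l//.
apply: ler_powRl => //; first by rewrite subr_ge0.
by rewrite /Y (bigD1 k)//= lerDl sumr_ge0.
Qed.

Lemma prod_powR (I : finType) (w : R) (e : I -> R) : 0 < w ->
  \prod_i w `^ e i = w `^ (\sum_i e i).
Proof.
move=> w0; apply: (big_rec2 (fun x y => x = w `^ y)); first by rewrite powRr0.
by move=> i x y _ ->; rewrite powRD//; apply/implyP => _; rewrite gt_eqF.
Qed.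

Local Ltac case_minmax :=
  repeat match goal with
  | |- context [Order.max ?a ?b] => case: (leP a b) => ?
  end;
  repeat match goal with
  | |- context [Order.min ?a ?b] => case: (leP a b) => ?
  end.

Definition trunc (k : nat) y : R :=
  Num.min (Num.max y (2 ^+ k)) (2 ^+ k.+1) - 2 ^+ k.

Lemma trunc_mono k a b : a <= b -> trunc k a <= trunc k b.
Proof. by move=> ab; rewrite /trunc; case_minmax; lra. Qed.

Lemma trunc_neq0 k y : trunc k y != 0 -> 2 ^+ k <= y.
Proof.
apply: contraNT; rewrite -ltNge => yk; rewrite /trunc.
rewrite (max_idPr (ltW yk)) (min_idPl _) ?subrr// exprS.
by rewrite ler_peMl ?exprn_ge0// ler1n.
Qed.

Lemma trunc_top k y : 2 ^+ k.+1 <= y -> trunc k y = 2 ^+ k.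
Proof.
move=> yk; rewrite /trunc (min_idPr _); last by rewrite le_max yk.
by rewrite exprS; ring.
Qed.

Lemma sum_trunc N y :
  \sum_(k < N) trunc k y = Num.min (Num.max y 1) (2 ^+ N) - 1.
Proof.
elim: N => [|N IH].
  rewrite big_ord0 expr0; apply/eqP; rewrite eq_sym subr_eq0; apply/eqP.
  by apply/min_idPr; rewrite le_max lexx orbT.
rewrite big_ord_recr/= IH /trunc !exprS.
set c : R := 2 ^+ N.
have c1 : 1 <= c by apply: exprn_ege1; rewrite ler1n.
by clearbody c; case_minmax; lra.
Qed.

Lemma sum_trunc_diff N a b :
  \sum_(k < N) `|trunc k a - trunc k b| <= `|a - b|.
Proof.
wlog ba : a b / b <= a => [H|].
  have [/H//|/ltW ab] := leP b a.
  rewrite distrC; under eq_bigr do rewrite distrC.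
  exact: H.
rewrite (eq_bigr (fun k : 'I_N => trunc k a - trunc k b)); last first.
  by move=> k _; rewrite ger0_norm// subr_ge0 trunc_mono.
rewrite big_split/= sumrN !sum_trunc ger0_norm ?subr_ge0//.
set c : R := 2 ^+ N.
have c1 : 1 <= c by apply: exprn_ege1; rewrite ler1n.
by clearbody c; case_minmax; lra.
Qed.

(** Truncations are monotone and telescope, so their differences add up to at most [|a - b|], and
    p-th powers are superadditive. Consequently the truncations share the seminorm of [u] among
    themselves. *)
Lemma sum_trunc_diff_powR (p : R) N a b : 1 <= p ->
  \sum_(k < N) `|trunc k `|a| - trunc k `|b| | `^ p <= `|a - b| `^ p.
Proof.
move=> p1.
pose y k := `|trunc k `|a| - trunc k `|b| |.
apply: le_trans (@sum_powR_le p N y p1 (fun k => normr_ge0 _)) _.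
apply: ler_powRl; first by rewrite (le_trans ler01).
  by apply: sumr_ge0 => k _; exact: normr_ge0.
by apply: le_trans (sum_trunc_diff _ _ _) _; exact: ler_dist_dist.
Qed.

(** [M] is such that V <= M and C B M^theta <= M. Since each [beta k] is at most [B], induction
    keeps every [A k] below [M]; summing the recursion then bounds the terms after the first by C B
    M^theta, hence by [M] again. *)
Lemma level_recursion (A beta : nat -> R) (V C B theta : R) :
  (forall k, 0 <= A k) -> (forall k, 0 <= beta k) -> 0 <= C -> 0 <= V ->
  0 < theta < 1 -> A 0%N <= V ->
  (forall k, A k.+1 <= C * beta k * A k `^ theta) ->
  (forall N, \sum_(k < N) beta k <= B) ->
  forall N, \sum_(k < N) A k <= 2 * (V + (C * B) `^ (1 - theta)^-1).
Proof.
move=> A0 b0 C0 V0 /andP[t0 t1] AV rec sumb.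
have B0 : 0 <= B by have := sumb 0%N; rewrite big_ord0.
set M := V + _.
have M0 : 0 <= M by rewrite addr_ge0 ?powR_ge0.
have VM : V <= M by rewrite lerDl powR_ge0.
have tN0 : 1 - theta != 0 by rewrite subr_eq0 gt_eqF.
have CBM : C * B * M `^ theta <= M.
  have E : M = M `^ (1 - theta) * M `^ theta.
    by rewrite -powRD ?subrK ?powRr1// oner_eq0.
  rewrite [leRHS]E.
  rewrite ler_wpM2r ?powR_ge0//.
  have CB0 : 0 <= C * B by rewrite mulr_ge0.
  have -> : C * B = ((C * B) `^ (1 - theta)^-1) `^ (1 - theta).
    by rewrite -powRrM mulVf// powRr1.
  apply: ler_powRl => //.
  - by rewrite subr_ge0 ltW.
  - exact: powR_ge0.
  - by rewrite /M lerDr.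
have AM k : A k <= M.
  elim: k => [|k IH]; first exact: le_trans AV VM.
  apply: le_trans (rec k) (le_trans _ CBM).
  apply: ler_pM; rewrite ?mulr_ge0 ?powR_ge0//.
    rewrite ler_wpM2l//; apply: le_trans (sumb k.+1).
    by rewrite big_ord_recr/= lerDr sumr_ge0.
  by apply: ler_powRl => //; exact: ltW.
move=> [|N]; first by rewrite big_ord0 mulr_ge0.
rewrite big_ord_recl/= mulr_natl mulr2n lerD//.
apply: (@le_trans _ _ (\sum_(k < N) C * beta k * M `^ theta)).
  apply: ler_sum => k _; apply: le_trans (rec k) _.
  by rewrite ler_wpM2l ?mulr_ge0//; apply: ler_powRl => //; exact: ltW.
rewrite -mulr_suml -mulr_sumr; apply: le_trans CBM.
by rewrite ler_wpM2r ?powR_ge0// ler_wpM2l.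
Qed.

End truncation.

(** * Level sets of a function with bounded support, and the Sobolev exponent *)

Section sobolev.
Variables (R : realType) (n : nat).
Local Notation mu := (@lebesgue_rV R n).
Local Notation leb := (@lebesgue_measure R).
Local Notation "''e_' i" := (delta_mx 0%R i : 'rV[R]_n)
  (at level 8, i at level 2).
Implicit Types (i : 'I_n) (u v : 'rV[R]_n -> R).
Local Open Scope ereal_scope.

Lemma sum_fine_le N (g : nat -> \bar R) (c : \bar R) :
  (forall k, g k \is a fin_num) -> c \is a fin_num ->
  \sum_(k < N) g k <= c -> (\sum_(k < N) fine (g k) <= fine c)%R.
Proof.
move=> gfin cfin gc; rewrite -lee_fin -sumEFin fineK//.
by apply: le_trans gc; apply: lee_sum => k _; rewrite fineK.
Qed.

Definition truncf (k : nat) u : 'rV[R]_n -> R := fun x => trunc k `|u x|.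

Lemma measurable_truncf k u :
  measurable_fun setT u -> measurable_fun setT (truncf k u).
Proof.
move=> mu_; apply: measurable_funB => //.
apply: measurable_minr => //; apply: measurable_maxr => //.
exact: measurableT_comp.
Qed.

Lemma sum_dint_truncf i (p : R) u h N : (1 <= p)%R -> measurable_fun setT u ->
  \sum_(k < N) dint i p (truncf k u) h <= dint i p u h.
Proof.
move=> p1 mu_; rewrite /dint -ge0_integral_sum//; last first.
  by move=> k; apply: measurable_powR_diff; exact: measurable_truncf.
apply: ge0_le_integralT.
- apply: emeasurable_sum => k; apply: measurable_powR_diff.
  exact: measurable_truncf.
- exact: measurable_powR_diff.
- by move=> x; apply: sume_ge0 => k _; rewrite lee_fin powR_ge0.
- by move=> x; rewrite sumEFin lee_fin; exact: sum_trunc_diff_powR.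
Qed.

Lemma sum_gagliardo_truncf i (s p d : R) u N : (1 <= p)%R ->
  measurable_fun setT u ->
  \sum_(k < N) gagliardo i s p d (truncf k u) <= gagliardo i s p d u.
Proof.
move=> p1 mu_; rewrite gagliardoE//.
rewrite (eq_bigr (fun k : 'I_N =>
  \int[leb]_(h in [set h : R | (`|h| <= d)%R]) gkernel i s p (truncf k u) h)); last first.
  by move=> k _; apply: gagliardoE; exact: measurable_truncf.
have mD := @measurable_norm_le R d.
rewrite -ge0_integral_sum//; last 2 first.
- by move=> k; apply: measurable_funTS; apply: measurable_gkernel; exact: measurable_truncf.
- by move=> k h _; exact: gkernel_ge0.
apply: ge0_le_integral_leb => //.
- by apply: emeasurable_sum => k; apply: measurable_gkernel; exact: measurable_truncf.
- exact: measurable_gkernel.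
- by move=> h _; apply: sume_ge0 => k _; exact: gkernel_ge0.
- move=> h _; rewrite /gkernel -ge0_sume_distrl; last by move=> k _; exact: dint_ge0.
  by rewrite lee_wpmul2r ?lee_fin ?powR_ge0// sum_dint_truncf.
Qed.

Section level_sets.
Variables (Omega : set 'rV[R]_n) (rho : R).
Hypothesis mOmega : measurable Omega.
Hypothesis rho0 : (0 < rho)%R.
Hypothesis Omegarho : forall x, Omega x -> forall i, (`|x ord0 i| <= rho)%R.
Variables (s p delta : 'I_n -> R).
Hypothesis s01 : forall i, (0 < s i < 1)%R.
Hypothesis p1 : forall i, (1 < p i)%R.
Hypothesis delta0 : forall i, (0 < delta i)%R.

Let sigma := (\sum_i (s i * p i)^-1)%R.
Let S := (\sum_i (s i)^-1)%R.
Hypothesis sigma1 : (1 < sigma)%R.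

Let p0 i : (0 < p i)%R. Proof. exact: lt_trans ltr01 (p1 i). Qed.
Let p1' i : (1 <= p i)%R. Proof. exact: ltW. Qed.
Let s0 i : (0 < s i)%R. Proof. by case/andP: (s01 i). Qed.
Let sp0 i : (0 < s i * p i)%R. Proof. exact: mulr_gt0. Qed.

Lemma bounded_support_lty : mu Omega < +oo.
Proof.
apply: le_lt_trans (obox_lty (fun=> - (rho + 1))%R (fun=> rho + 1)%R).
apply: le_measure; rewrite ?inE//; first exact: measurable_obox.
move=> x /Omegarho xr i; have := xr i; rewrite ler_norml => /andP[h1 h2].
by apply/andP; split; lra.
Qed.

Definition level u (k : nat) : set 'rV[R]_n := [set x | (2 ^+ k <= `|u x|)%R].

Lemma measurable_level u k : measurable_fun setT u -> measurable (level u k).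
Proof.
move=> mu_; rewrite (_ : level u k = (fun x => `|u x|)%R @^-1` `[(2 ^+ k)%R, +oo[).
  rewrite -[X in measurable X]setTI.
  have : measurable_fun setT (fun x : 'rV[R]_n => `|u x|)%R by exact: measurableT_comp.
  by apply => //; exact: measurable_itv.
by apply/seteqP; split=> x /=; rewrite in_itv/= andbT.
Qed.

Lemma level_sub u k : (forall x, ~ Omega x -> u x = 0%R) -> level u k `<=` Omega.
Proof.
move=> u0 x ux; apply: contrapT => /u0 ux0; move: ux.
by rewrite /level/= ux0 normr0 leNgt exprn_gt0.
Qed.

Lemma level_fin_num u k : measurable_fun setT u ->
  (forall x, ~ Omega x -> u x = 0%R) -> mu (level u k) \is a fin_num.
Proof.
move=> mu_ u0; rewrite ge0_fin_numE//; apply: le_lt_trans bounded_support_lty.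
by apply: le_measure; rewrite ?inE//; [exact: measurable_level|exact: level_sub].
Qed.

Lemma gagliardo_truncf_le i k u : measurable_fun setT u ->
  gagliardo i (s i) (p i) (delta i) (truncf k u) <=
  gagliardo i (s i) (p i) (delta i) u.
Proof.
move=> mu_; apply: le_trans (sum_gagliardo_truncf _ _ _ k.+1 (p1' i) mu_).
by rewrite big_ord_recr/= leeDr// sume_ge0// => l _; exact: gagliardo_ge0.
Qed.

(** [box_level_le] for the [k]-th truncation, which equals 2^k on the next level set and vanishes
    off the current one. *)
Lemma level_step : exists2 C : R, (0 <= C)%R &
  forall u k, measurable_fun setT u -> (forall x, ~ Omega x -> u x = 0%R) ->
  (forall i, gagliardo i (s i) (p i) (delta i) u < +oo) ->
  (fine (mu (level u k.+1)) <=
   C * (\sum_i fine (gagliardo i (s i) (p i) (delta i) (truncf k u))) *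
   (2 * fine (mu (level u k)) * (2 ^+ k) `^ (- S)) `^ sigma^-1)%R.
Proof.
have /choice[K HK] : forall i, exists K : R, (0 <= K)%R /\
    forall u, measurable_fun setT u -> (forall x, ~ Omega x -> u x = 0%R) ->
    forall t : R, (0 < t)%R ->
    \int[leb]_(h in `[0%R, t]) dint i (p i) u h <=
      (K * (t * t `^ (s i * p i)))%:E * gagliardo i (s i) (p i) (delta i) u.
  move=> i; have [K K0 H] := average_dint_le rho0 Omegarho i (p1' i) (s01 i) (delta0 i).
  by exists K.
have K0 i : (0 <= K i)%R by case: (HK i).
have n0 i : (0 <= n%:R `^ p i * K i :> R)%R by rewrite mulr_ge0 ?powR_ge0.
exists (2 * \sum_i n%:R `^ p i * K i)%R.
  by rewrite mulr_ge0// sumr_ge0.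
move=> u k mu_ u0 gu.
set lam := (2 ^+ k)%R; set a := fine (mu (level u k)).
have lam0 : (0 < lam)%R by rewrite exprn_gt0.
have a0 : (0 <= a)%R by rewrite fine_ge0.
pose G i := fine (gagliardo i (s i) (p i) (delta i) (truncf k u)).
have G0 i : (0 <= G i)%R by rewrite fine_ge0// gagliardo_ge0.
have GE i : gagliardo i (s i) (p i) (delta i) (truncf k u) = (G i)%:E.
  rewrite fineK// ge0_fin_numE ?gagliardo_ge0//.
  exact: le_lt_trans (gagliardo_truncf_le _ _ mu_) (gu i).
have sub : level u k.+1 `<=` level u k.
  move=> x; apply: le_trans; rewrite exprS ler_peMl ?exprn_ge0//.
  by rewrite ler1n.
have ak1 : (fine (mu (level u k.+1)) <= a)%R.
  rewrite /a fine_le ?level_fin_num//.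
  by apply: le_measure; rewrite ?inE//; exact: measurable_level.
(* A null level set would make the box degenerate; the next level set is then null as well. *)
have [az|aN0] := eqVneq a 0%R.
  apply: le_trans ak1 _; rewrite az; apply: mulr_ge0; last exact: powR_ge0.
  apply: mulr_ge0; first by rewrite mulr_ge0// sumr_ge0.
  by apply: sumr_ge0 => i _; exact: G0.
have apos : (0 < a)%R by rewrite lt0r aN0.
set w := (X in (_ <= _ * X)%R).
have s0' : (0 < sigma)%R by rewrite (lt_trans ltr01).
have w0 : (0 < w)%R by rewrite powR_gt0// !mulr_gt0// powR_gt0.
(* Two requirements determine the sides: r_i^(s_i p_i) = w lam^(p_i), so that [lam] cancels and all
   directions get the same factor w, and volume 2a, so that the support fills at most half of the
   box. The latter means w^sigma lam^S = 2a, which fixes w. *)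
pose r i := (w `^ (s i * p i)^-1 * lam `^ (s i)^-1)%R.
have r0 i : (0 < r i)%R by rewrite mulr_gt0// powR_gt0.
have prodr : (\prod_i r i = 2 * a)%R.
  rewrite big_split/= !prod_powR// -/sigma -/S /w -powRrM mulVf ?gt_eqF//.
  rewrite powRr1 ?mulr_ge0 ?powR_ge0// powRN divfK//.
  by rewrite gt_eqF// powR_gt0.
clearbody w.
have rsp i : (r i `^ (s i * p i) = w * lam `^ p i)%R.
  rewrite powRM ?powR_ge0// -!powRrM mulVf ?gt_eqF// mulrA mulVf ?gt_eqF// mul1r.
  by rewrite powRr1// ltW.
have box := @box_level_le R n r (truncf k u) lam p (level u k.+1) r0 lam0 p0
  (measurable_truncf k mu_) (measurable_level k.+1 mu_).
have {}box : (2^-1 * \prod_i r i)%:E * mu (level u k.+1) <=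
    \sum_i ((n%:R / lam) `^ p i * \prod_(l | l != i) r l)%:E *
     \int[leb]_(h in `[0%R, r i]) dint i (p i) (truncf k u) h.
  apply: box.
    move=> x xk; rewrite /truncf trunc_top// ger0_norm//.
  rewrite prodr mulrA mulVf ?mul1r// /a fineK ?level_fin_num//.
  apply: le_measure; rewrite ?inE//.
  - rewrite (_ : mkset _ = ~` (truncf k u @^-1` [set 0%R])).
      apply: measurableC; rewrite -[X in measurable X]setTI.
      by apply: measurable_truncf => //.
    by apply/seteqP; split=> x /=; [move/eqP|move/eqP].
  - exact: measurable_level.
  - by move=> x /= /trunc_neq0.
have T0 x : ~ Omega x -> truncf k u x = 0%R.
  move=> /u0 ux; apply/eqP/negPn/negP => /trunc_neq0.
  by rewrite ux normr0 leNgt lam0.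
have : (2^-1 * \prod_i r i)%:E * mu (level u k.+1) <=
    \sum_i ((n%:R / lam) `^ p i * \prod_(l | l != i) r l)%:E *
     ((K i * (r i * r i `^ (s i * p i)))%:E * (G i)%:E).
  apply: le_trans box _; apply: lee_sum => i _.
  rewrite lee_wpmul2l ?lee_fin ?mulr_ge0 ?powR_ge0//.
    by apply: prodr_ge0 => l _; exact: ltW.
  have [_ H] := HK i; rewrite -GE; apply: H => //.
  exact: measurable_truncf.
rewrite prodr mulrA mulVf ?mul1r//.
rewrite -[mu _]fineK ?level_fin_num//.
under eq_bigr do rewrite -!EFinM.
rewrite sumEFin lee_fin.
rewrite (eq_bigr (fun i => a * (2 * w * (n%:R `^ p i * K i * G i)))%R); last first.
  move=> i _; rewrite rsp powRM ?invr_ge0 ?(ltW lam0)//.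
  have -> : (lam^-1 `^ p i = (lam `^ p i)^-1)%R.
    by rewrite -powR_inv1 ?(ltW lam0)// -powRrM mulN1r powRN.
  have lp : (lam `^ p i != 0)%R by rewrite gt_eqF// powR_gt0.
  have -> : (2 = (\prod_(l | l != i) r l) * r i / a)%R.
    have pr : (r i * \prod_(l | l != i) r l = 2 * a)%R by rewrite -prodr [RHS](bigD1 i).
    by rewrite (mulrC (\prod_(l | _) _)%R) pr mulfK.
  by field; rewrite aN0 lp.
rewrite -mulr_sumr ler_pM2l// => H; apply: le_trans H _.
rewrite -mulr_sumr -[leLHS]mulrA mulrCA [leRHS]mulrC ler_wpM2l ?(ltW w0)//.
rewrite -mulrA ler_wpM2l// mulr_suml; apply: ler_sum => i _.
by rewrite ler_wpM2l// (bigD1 i)//= lerDl; apply: sumr_ge0 => l _; exact: G0.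
Qed.

(** If [|u x|] lies between 2^m and 2^(m+1), the term k = m alone dominates; values below 1 are
    absorbed by the indicator of [Omega]. *)
Lemma powR_norm_le_levels (q : R) u x : (0 < q)%R ->
  (forall x, ~ Omega x -> u x = 0%R) ->
  (`|u x| `^ q)%:E <= (\1_Omega x)%:E +
    \sum_(k <oo) ((2 ^+ k.+1) `^ q)%:E * (\1_(level u k) x)%:E.
Proof.
move=> q0' u0; have q0 := ltW q0'.
have T0 k : 0 <= ((2 ^+ k.+1) `^ q)%:E * (\1_(level u k) x)%:E :> \bar R.
  by rewrite mule_ge0// lee_fin ?powR_ge0.
have S0 : 0 <= \sum_(k <oo) ((2 ^+ k.+1) `^ q)%:E * (\1_(level u k) x)%:E.
  by apply: nneseries_ge0 => k _ _; exact: T0.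
have [Ox|/u0 ->] := pselect (Omega x); last first.
  by rewrite normr0 powR0 ?gt_eqF// adde_ge0.
have [ux|ux] := ltP `|u x|%R 1%R.
  rewrite -[leLHS]adde0 leeD//; rewrite indicE mem_set// lee_fin.
  apply: (@le_trans _ _ (1 `^ q)%R); last by rewrite powR1.
  by apply: ler_powRl => //; exact: ltW.
have ex : exists m, (`|u x| < 2 ^+ m)%R.
  exists (Num.truncn `|u x|).+1; apply: lt_trans (truncnS_gt _) _.
  by rewrite -natrX ltr_nat ltn_expl.
case: (ex_minnP ex) => -[|m] um mmin; first by move: um; rewrite expr0 ltNge ux.
have mu_ : (2 ^+ m <= `|u x|)%R.
  by rewrite leNgt; apply/negP => /mmin; rewrite ltnn.
rewrite -[leLHS]add0e leeD//.
apply: (@le_trans _ _ (\sum_(0 <= k < m.+1) ((2 ^+ k.+1) `^ q)%:E * (\1_(level u k) x)%:E)).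
  rewrite big_nat_recr//= -[leLHS]add0e leeD//; first exact: sume_ge0.
  rewrite indicE mem_set// mule1 lee_fin; apply: ler_powRl => //.
  exact: ltW.
by apply: nneseries_lim_ge => k _ _; exact: T0.
Qed.

Variable q : R.
Hypothesis qE : (q * (sigma - 1) = S)%R.
Hypothesis q0 : (0 < q)%R.

Lemma integral_powR_le_levels (c : R) u : measurable_fun setT u ->
  (forall x, ~ Omega x -> u x = 0%R) ->
  (forall N, \sum_(k < N) ((2 ^+ k.+1) `^ q * fine (mu (level u k))) <= c)%R ->
  \int[mu]_x (`|u x| `^ q)%:E <= mu Omega + c%:E.
Proof.
move=> mu_ u0 H.
have ml k := measurable_level k mu_.
have mk k : measurable_fun setT (fun x : 'rV[R]_n =>
    ((2 ^+ k.+1) `^ q)%:E * (\1_(level u k) x)%:E : \bar R).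
  by apply: measurable_funeM; apply/measurable_EFinP; exact: measurable_indic.
have k0 k (x : 'rV[R]_n) : 0 <= ((2 ^+ k.+1) `^ q)%:E * (\1_(level u k) x)%:E :> \bar R.
  by rewrite mule_ge0// lee_fin ?powR_ge0.
have mS : measurable_fun setT (fun x : 'rV[R]_n =>
    \sum_(k <oo) ((2 ^+ k.+1) `^ q)%:E * (\1_(level u k) x)%:E : \bar R).
  exact: ge0_emeasurable_sum.
have mO : measurable_fun setT (fun x : 'rV[R]_n => (\1_Omega x : R)%:E).
  by apply/measurable_EFinP; exact: measurable_indic.
apply: (@le_trans _ _ (\int[mu]_x ((\1_Omega x)%:E +
    \sum_(k <oo) ((2 ^+ k.+1) `^ q)%:E * (\1_(level u k) x)%:E))).
  apply: ge0_le_integralT.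
  - exact: measurable_powR_fun.
  - exact: emeasurable_funD.
  - by move=> x; rewrite lee_fin powR_ge0.
  - by move=> x; exact: powR_norm_le_levels.
rewrite ge0_integralDT//; last first.
  by move=> x; apply: nneseries_ge0 => k _ _; exact: k0.
rewrite integral_indic// setIT leeD2l//.
rewrite integral_nneseries//.
apply: lime_le; first by apply: is_cvg_nneseries => k _ _; apply: integral_ge0.
apply: nearW => N.
rewrite big_mkord (eq_bigr (fun k : 'I_N =>
    ((2 ^+ k.+1) `^ q * fine (mu (level u k)))%:E)); last first.
  move=> k _; rewrite ge0_integralZlT ?powR_ge0//; last first.
    by apply/measurable_EFinP; exact: measurable_indic.
  by rewrite integral_indic// setIT EFinM fineK// level_fin_num.
by rewrite sumEFin lee_fin; exact: H.
Qed.

(** Weighted by 2^(kq), the measures of the level sets obey the recursion of [level_recursion] with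
    exponent 1/sigma: the relation q (sigma - 1) = S is exactly what makes the powers of 2^k match.
    The sum of [beta] is bounded because the truncations share the seminorms of [u]. *)
Lemma anisotropic_sobolev : exists2 C : R, (0 <= C)%R &
  forall u, measurable_fun setT u -> (forall x, ~ Omega x -> u x = 0%R) ->
  (forall i, gagliardo i (s i) (p i) (delta i) u < +oo) ->
  \int[mu]_x (`|u x| `^ q)%:E <=
  (C * (1 + \sum_i fine (gagliardo i (s i) (p i) (delta i) u)) `^
     (sigma / (sigma - 1)))%:E.
Proof.
have [C0 C00 step] := level_step.
have s0' : (0 < sigma)%R by rewrite (lt_trans ltr01).
have sN0 : (sigma != 0)%R by rewrite gt_eqF.
have s1N0 : (sigma - 1 != 0)%R by rewrite subr_eq0 gt_eqF.
set e := (sigma / (sigma - 1))%R.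
have e0 : (0 <= e)%R by rewrite divr_ge0 ?subr_ge0 ?(ltW s0') ?(ltW sigma1).
have eE : ((1 - sigma^-1)^-1 = e)%R.
  by rewrite /e; field; rewrite s1N0 sN0.
pose C := (2 `^ q * 2 `^ sigma^-1 * C0)%R.
have CC0 : (0 <= C)%R by rewrite !mulr_ge0 ?powR_ge0.
pose V := fine (mu Omega).
have V0 : (0 <= V)%R by rewrite fine_ge0.
have VE : mu Omega = V%:E by rewrite fineK// ge0_fin_numE// bounded_support_lty.
exists (V + 2 `^ q * (2 * (V + C `^ e)))%R.
  by rewrite addr_ge0// !mulr_ge0 ?powR_ge0// addr_ge0 ?powR_ge0.
move=> u mu_ u0 gu.
set B := (\sum_i _)%R.
have B0 : (0 <= B)%R by apply: sumr_ge0 => i _; rewrite fine_ge0// gagliardo_ge0.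
pose A k := ((2 ^+ k) `^ q * fine (mu (level u k)))%R.
pose beta k := (\sum_i fine (gagliardo i (s i) (p i) (delta i) (truncf k u)))%R.
have gfin k i : gagliardo i (s i) (p i) (delta i) (truncf k u) \is a fin_num.
  rewrite ge0_fin_numE ?gagliardo_ge0//.
  exact: le_lt_trans (gagliardo_truncf_le _ _ mu_) (gu i).
have gufin i : gagliardo i (s i) (p i) (delta i) u \is a fin_num.
  by rewrite ge0_fin_numE ?gagliardo_ge0.
have A0 k : (0 <= A k)%R by rewrite mulr_ge0 ?powR_ge0// fine_ge0.
have b0 k : (0 <= beta k)%R.
  by apply: sumr_ge0 => i _; rewrite fine_ge0// gagliardo_ge0.
have AV : (A 0%N <= V)%R.
  rewrite /A expr0 powR1 mul1r /V fine_le ?level_fin_num ?VE//.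
  rewrite -VE; apply: le_measure; rewrite ?inE//; first exact: measurable_level.
  exact: level_sub.
have sumb N : (\sum_(k < N) beta k <= B)%R.
  rewrite exchange_big/=; apply: ler_sum => i _.
  apply: (@sum_fine_le N (fun k => gagliardo i (s i) (p i) (delta i) (truncf k u))) => //.
  exact: sum_gagliardo_truncf.
have rec k : (A k.+1 <= C * beta k * A k `^ sigma^-1)%R.
  have l0 : (0 < 2 ^+ k :> R)%R by rewrite exprn_gt0.
  have := step u k mu_ u0 gu; rewrite -/(beta k) => H.
  rewrite {1}/A; apply: le_trans (ler_wpM2l (powR_ge0 _ _) H) _.
  rewrite exprS powRM ?(ltW l0)// le_eqVlt; apply/orP; left; apply/eqP.
  have mu0 : (0 <= fine (mu (level u k)))%R by rewrite fine_ge0.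
  rewrite /A /C !powRM ?powR_ge0 ?mulr_ge0 ?fine_ge0//.
  have -> : (((2 ^+ k) `^ q) `^ sigma^-1 =
      (2 ^+ k) `^ q * ((2 ^+ k) `^ (- S)) `^ sigma^-1 :> R)%R.
    rewrite -!powRrM -powRD; last by apply/implyP => _; rewrite gt_eqF.
    by congr (_ `^ _)%R; rewrite -qE; field.
  ring.
have main := level_recursion A0 b0 CC0 V0 _ AV rec sumb.
have {}main N : (\sum_(k < N) A k <= 2 * (V + (C * B) `^ e))%R.
  rewrite -eE; apply: main; rewrite invr_gt0 s0'/=.
  by rewrite invf_lt1.
apply: le_trans (@integral_powR_le_levels (2 `^ q * (2 * (V + (C * B) `^ e)))%R u mu_ u0 _) _.
  move=> N; rewrite (eq_bigr (fun k : 'I_N => 2 `^ q * A k)%R); last first.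
    by move=> k _; rewrite exprS powRM ?exprn_ge0// mulrA.
  by rewrite -mulr_sumr ler_wpM2l ?powR_ge0//; exact: main.
rewrite VE -EFinD lee_fin.
have B1 : (1 <= (1 + B) `^ e)%R.
  apply: (@le_trans _ _ (1 `^ e)%R); first by rewrite powR1.
  by apply: ler_powRl => //; rewrite lerDl.
have CBe : ((C * B) `^ e <= C `^ e * (1 + B) `^ e)%R.
  by rewrite powRM// ler_wpM2l ?powR_ge0// ler_powRl// lerDr.
rewrite [leRHS]mulrDl; apply: lerD; first by rewrite ler_peMr.
rewrite -[leRHS]mulrA ler_wpM2l ?powR_ge0// -[leRHS]mulrA ler_wpM2l//.
by rewrite [leRHS]mulrDl; apply: lerD; rewrite // ler_peMr.
Qed.

End level_sets.

End sobolev.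

(** * Weak limits by uniform convexity *)

Section uniform_convexity.
Variable R : realType.
Implicit Types (a b t p : R).

(* Compare [exp w] with its tangent at [w / p], for [w = p ln X] and for [w = 0]. *)
Lemma powR_gt_tangent (X p : R) : 1 < p -> 0 < X -> X != 1 ->
  p * X - (p - 1) < X `^ p.
Proof.
move=> p1 X0 X1; have p0 : 0 < p by rewrite (lt_trans ltr01).
pose v := ln X; have v0 : v != 0.
  by rewrite ln_eq0.
have Xv : X = expR v by rewrite lnK// posrE.
have -> : X `^ p = expR (p * v) by rewrite /powR gt_eqF.
have h1 : expR v * (1 + (p * v - v)) < expR (p * v).
  rewrite -{2}(subrK v (p * v)) expRD mulrC ltr_pM2r ?expR_gt0//.
  apply: expR_gt1Dx; rewrite -{2}[v]mul1r -mulrBl mulf_neq0//.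
  by rewrite subr_eq0 gt_eqF.
have h2 : expR v * (1 - v) < 1.
  rewrite -[ltRHS](expRxMexpNx_1 v) ltr_pM2l ?expR_gt0//.
  by apply: expR_gt1Dx; rewrite oppr_eq0.
rewrite Xv.
have h3 : (p - 1) * (expR v * (1 - v)) < (p - 1) * 1.
  by rewrite ltr_pM2l// subr_gt0.
have h4 : expR v * (1 + (p * v - v)) + (p - 1) * (expR v * (1 - v)) = p * expR v.
  ring.
lra.
Qed.

(** After division by the midpoint m, add the strict tangent inequalities at a/m and b/m: the linear
    terms sum to 2p, leaving 2 after the constants. The case of a zero argument is direct. *)
Lemma powR_midpoint_strict (x y p : R) : 1 < p -> 0 <= x -> 0 <= y -> x != y ->
  2 * ((x + y) / 2) `^ p < x `^ p + y `^ p.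
Proof.
move=> p1; have p0 : 0 < p by rewrite (lt_trans ltr01).
suff H a b : 0 < a -> 0 < b -> a != b -> 2 * ((a + b) / 2) `^ p < a `^ p + b `^ p.
  have H0 b : 0 < b -> 2 * ((0 + b) / 2) `^ p < 0 `^ p + b `^ p.
    move=> b0; rewrite !add0r powR0 ?gt_eqF// add0r powRM ?invr_ge0 ?(ltW b0)//.
    rewrite mulrCA gtr_pMr ?powR_gt0//.
    have -> : 2^-1 `^ p = (2 `^ p)^-1 :> R by rewrite -powR_inv1// -powRrM mulN1r powRN.
    rewrite ltr_pdivrMr ?powR_gt0// mul1r -[ltLHS]powRr1//.
    by rewrite /powR gt_eqF// ltr_expR mul1r ltr_pMl// ln_gt0// ltr1n.
  rewrite le_eqVlt => /predU1P[<-|x0]; rewrite le_eqVlt => /predU1P[<-|y0].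
  - by rewrite eqxx.
  - by move=> _; exact: H0.
  - by move=> _; rewrite addrC [ltRHS]addrC; exact: H0.
  - exact: H.
move=> a0 b0 ab; pose m := (a + b) / 2.
have m0 : 0 < m by rewrite divr_gt0// addr_gt0.
have Ea : a `^ p = m `^ p * (a / m) `^ p.
  have E : m * (a / m) = a by rewrite mulrC divfK// gt_eqF.
  by rewrite -{1}E powRM//; [exact: ltW | apply: divr_ge0; exact: ltW].
have Eb : b `^ p = m `^ p * (b / m) `^ p.
  have E : m * (b / m) = b by rewrite mulrC divfK// gt_eqF.
  by rewrite -{1}E powRM//; [exact: ltW | apply: divr_ge0; exact: ltW].
rewrite -/m Ea Eb -mulrDr mulrC ltr_pM2l ?powR_gt0//.
have am : a / m != 1.
  apply: contra ab => /eqP am; apply/eqP.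
  have : a = m by rewrite -[RHS]mul1r -am divfK// gt_eqF.
  rewrite /m; lra.
have bm : b / m != 1.
  apply: contra ab => /eqP bm; apply/eqP.
  have : b = m by rewrite -[RHS]mul1r -bm divfK// gt_eqF.
  rewrite /m; lra.
have := powR_gt_tangent p1 (divr_gt0 a0 m0) am.
have := powR_gt_tangent p1 (divr_gt0 b0 m0) bm.
have : p * (a / m) + p * (b / m) = 2 * p.
  rewrite -mulrDr -mulrDl /m; field.
  by rewrite gt_eqF// addr_gt0.
lra.
Qed.

Lemma midpoint_gap_gt0 (p t : R) : 1 < p -> -1 <= t < 1 ->
  0 < 1 + `|t| `^ p - 2 * `|(1 + t) / 2| `^ p.
Proof.
move=> p1 /andP[t1 t2]; have p0 : 0 < p by rewrite (lt_trans ltr01).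
have ht : `|(1 + t) / 2| = (1 + t) / 2 by rewrite ger0_norm// divr_ge0//; lra.
rewrite subr_gt0 ht; have [t0|t0] := leP 0 t.
  have := @powR_midpoint_strict 1 t p p1 ler01 t0.
  by rewrite powR1 (ger0_norm t0); apply; rewrite gt_eqF.
apply: (@lt_le_trans _ _ (2 * ((1 + `|t|) / 2) `^ p)).
  rewrite ltr_pM2l//; apply: gt0_ltr_powR => //; rewrite ?nnegrE ?divr_ge0//; last first.
  - by rewrite ltr_pM2r ?invr_gt0// ltrD2l ltr0_norm//; lra.
  - lra.
have := @powR_midpoint R 1 `|t| p (ltW p1) ler01 (normr_ge0 _).
by rewrite powR1; lra.
Qed.

Lemma continuous_norm_powR (p : R) : 0 < p -> continuous (fun t : R => `|t| `^ p).
Proof.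
move=> p0 t; have [->|tN0] := eqVneq t 0.
  rewrite /continuous_at normr0 powR0 ?gt_eqF//.
  apply/cvgrPdist_lt => e e0; near=> x; rewrite sub0r normrN.
  rewrite ger0_norm ?powR_ge0//.
  have xe : `|x| < e `^ p^-1.
    near: x; exists (e `^ p^-1) => /=; first by rewrite powR_gt0.
    by move=> y /=; rewrite sub0r normrN.
  have -> : e = (e `^ p^-1) `^ p by rewrite -powRrM mulVf ?gt_eqF// powRr1// ltW.
  by apply: gt0_ltr_powR => //; rewrite nnegrE ?powR_ge0.
apply: (@continuous_comp _ _ _ (fun t : R => `|t|) (fun y => y `^ p)).
  exact: norm_continuous.
apply: differentiable_continuous; apply/derivable1_diffP; apply: derivable_powR.
by rewrite in_itv/= andbT normr_gt0.
Unshelve. all: by end_near. Qed.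

(** Up to 1 - k the midpoint gap has a positive minimum by compactness and 2^p bounds the left side;
    closer to 1 the left side is at most k^p <= eta. *)
Lemma uniform_convexity_unit (p eta : R) : 1 < p -> 0 < eta ->
  exists2 C : R, 0 <= C & forall t, -1 <= t <= 1 ->
    `|1 - t| `^ p <= eta + C * (1 + `|t| `^ p - 2 * `|(1 + t) / 2| `^ p).
Proof.
move=> p1 eta0; have p0 : 0 < p by rewrite (lt_trans ltr01).
pose g t := 1 + `|t| `^ p - 2 * `|(1 + t) / 2| `^ p.
pose k := Num.min 1 (eta `^ p^-1).
have k0 : 0 < k by rewrite lt_min ltr01 powR_gt0.
have k1 : k <= 1 by rewrite ge_min lexx.
have kp : k `^ p <= eta.
  have -> : eta = (eta `^ p^-1) `^ p.
    by rewrite -powRrM mulVf ?gt_eqF// powRr1// ltW.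
  by apply: ler_powRl; rewrite ?(ltW p0) ?(ltW k0)// ge_min lexx orbT.
have gc : continuous g.
  move=> t; apply: cvgB.
    by apply: cvgD; [exact: cvg_cst|exact: continuous_norm_powR].
  apply: cvgM; first exact: cvg_cst.
  apply: (@continuous_comp _ _ _ (fun t : R => (1 + t) / 2) (fun y => `|y| `^ p)).
    by apply: cvgM; [apply: cvgD; [exact: cvg_cst|exact: cvg_id]|exact: cvg_cst].
  exact: continuous_norm_powR.
have g0 t : -1 <= t <= 1 -> 0 <= g t.
  move=> /andP[t1]; rewrite le_eqVlt => /predU1P[->|t2].
    by rewrite /g (_ : (1 + 1) / 2 = 1) ?normr1 ?powR1; [lra|field].
  by apply: ltW; apply: midpoint_gap_gt0 => //; rewrite t1.
have /(EVT_min (_ : -1 <= 1 - k))[] : {within `[-1, 1 - k], continuous g}.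
- by move=> *; exact: continuous_subspaceT.
- lra.
move=> c; rewrite in_itv/= => /andP[c1 c2] cmin.
have gc0 : 0 < g c by apply: midpoint_gap_gt0 => //; rewrite c1; lra.
exists (2 `^ p / g c); first by rewrite divr_ge0 ?powR_ge0 ?(ltW gc0).
move=> t /andP[t1 t2]; rewrite -/(g t).
have gt0 : 0 <= g t by apply: g0; rewrite t1.
have C0 : 0 <= 2 `^ p / g c by rewrite divr_ge0 ?powR_ge0 ?(ltW gc0).
have [tk|kt] := leP t (1 - k).
  rewrite -[leLHS]add0r lerD ?(ltW eta0)//.
  apply: (@le_trans _ _ (2 `^ p)).
    apply: ler_powRl; rewrite ?(ltW p0)// ler_norml; lra.
  rewrite mulrAC ler_pdivlMr// ler_wpM2l ?powR_ge0//.
  by apply: cmin; rewrite in_itv/= t1.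
rewrite -[leLHS]addr0; apply: lerD; last exact: mulr_ge0.
apply: le_trans kp.
apply: ler_powRl; rewrite ?(ltW p0)// ler_norml; lra.
Qed.

(** Homogeneity, with b = a t and t in [-1, 1]. This form treats all p > 1 alike, and the term with
    [eta] is harmless on bounded sets. *)
Lemma uniform_convexity (p eta : R) : 1 < p -> 0 < eta ->
  exists2 C : R, 0 <= C & forall a b,
    `|a - b| `^ p <= eta * (`|a| `^ p + `|b| `^ p) +
      C * (`|a| `^ p + `|b| `^ p - 2 * `|(a + b) / 2| `^ p).
Proof.
move=> p1 eta0; have [C C0 H] := uniform_convexity_unit p1 eta0.
have p0 : 0 < p by rewrite (lt_trans ltr01).
exists C => // a b; wlog ab : a b / `|b| <= `|a|.
  move=> W; have [/W//|/ltW/W] := leP `|b| `|a|.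
  by rewrite distrC [`|b| `^ p + _]addrC [b + a]addrC.
have [a0|aN0] := eqVneq a 0.
  move: ab; rewrite a0 normr0 normr_le0 => /eqP ->.
  by rewrite subrr addr0 mul0r normr0 powR0 ?gt_eqF// !mulr0 !addr0 subr0 !mulr0 addr0.
have na : 0 < `|a| by rewrite normr_gt0.
pose t := b / a.
have bE : b = a * t by rewrite mulrC divfK.
have t1 : -1 <= t <= 1 by rewrite -ler_norml normf_div ler_pdivrMr// mul1r.
have := H t t1; rewrite -(ler_pM2l (powR_gt0 p na)) => Ht.
rewrite bE (_ : a - a * t = a * (1 - t)); last by ring.
rewrite (_ : (a + a * t) / 2 = a * ((1 + t) / 2)); last by ring.
rewrite (normrM a t) (normrM a (1 - t)) (normrM a ((1 + t) / 2)) !powRM//.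
clear bE; clearbody t; apply: le_trans Ht _.
have tp : 0 <= `|t| `^ p by exact: powR_ge0.
have ap : 0 <= `|a| `^ p by exact: powR_ge0.
rewrite mulrDr lerD//; last by rewrite le_eqVlt; apply/orP; left; apply/eqP; ring.
by rewrite mulrC ler_wpM2l ?(ltW eta0)// lerDl mulr_ge0.
Qed.

(** Compare [a] with e b^(q-1): in each case one of the two terms alone dominates the product. *)
Lemma young_eps (p q a b e : R) : 1 < p -> q = p / (p - 1) ->
  0 <= a -> 0 <= b -> 0 < e ->
  a * b <= e * b `^ q + e `^ (1 - p) * a `^ p.
Proof.
move=> p1 qE a0 b0 e0.
have p0 : 0 < p by rewrite (lt_trans ltr01).
have pN1 : p - 1 != 0 by rewrite subr_eq0 gt_eqF.
have q0 : 0 < q by rewrite qE divr_gt0// subr_gt0.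
have q1 : (q - 1) * (p - 1) = 1 by rewrite qE; field.
have [h|h] := leP a (e * b `^ (q - 1)).
  rewrite -[leLHS]addr0 lerD ?mulr_ge0 ?powR_ge0//.
  rewrite -[b `^ q](mulr_powRB1 b0 q0) mulrCA mulrC.
  by rewrite ler_wpM2l.
rewrite -[leLHS]add0r lerD ?mulr_ge0 ?powR_ge0 ?(ltW e0)//.
have hb : b <= (a / e) `^ (p - 1).
  have {1}-> : b = (b `^ (q - 1)) `^ (p - 1) by rewrite -powRrM q1 powRr1.
  apply: ler_powRl; rewrite ?powR_ge0 ?subr_ge0 ?(ltW p1)//.
  by rewrite ler_pdivlMr// mulrC ltW.
apply: le_trans (ler_wpM2l a0 hb) _.
rewrite powRM ?invr_ge0 ?(ltW e0)// mulrA (mulr_powRB1 a0 p0) mulrC.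
rewrite -powR_inv1 ?(ltW e0)// -powRrM mulN1r opprB.
exact: lexx.
Qed.

End uniform_convexity.

(** * L^p functions through integrals of powers, and the duality pairing *)

Section Lp_functions.
Context d (T : measurableType d) (R : realType) (mu : {measure set T -> \bar R}).
Implicit Types (p q : R) (w v phi : T -> R).
Local Open Scope ereal_scope.

Definition Lp p w := measurable_fun setT w /\ \int[mu]_x (`|w x| `^ p)%:E < +oo.

Definition np p w : R := fine (\int[mu]_x (`|w x| `^ p)%:E).

Lemma measurable_powR_normE p w : measurable_fun setT w ->
  measurable_fun setT (fun x => (`|w x| `^ p)%:E).
Proof.
by move=> mw; apply/measurable_EFinP; apply: measurable_fun_powR_norm.
Qed.

Lemma int_powR_ge0 p w : 0 <= \int[mu]_x (`|w x| `^ p)%:E.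
Proof. by apply: integral_ge0 => x _; rewrite lee_fin powR_ge0. Qed.

Lemma np_ge0 p w : (0 <= np p w)%R.
Proof. by rewrite fine_ge0// int_powR_ge0. Qed.

Lemma npE p w : Lp p w -> \int[mu]_x (`|w x| `^ p)%:E = (np p w)%:E.
Proof. by move=> [_ w1]; rewrite fineK// ge0_fin_numE// int_powR_ge0. Qed.

Lemma Lp_Lfun p w : (0 < p)%R -> (w \in Lfun mu p%:E) <-> Lp p w.
Proof.
move=> p0; rewrite inE; split.
  move=> /andP[]; rewrite !inE/= => mw; rewrite /finite_norm => H.
  split => //; have := poweR_lty p H.
  by rewrite powR_Lnorm ?gt_eqF.
move=> [mw H]; apply/andP; split; rewrite inE//= /finite_norm unlock.
exact: poweR_lty.
Qed.

Lemma Lp_dominated p (c : R) w v1 v2 : (0 <= c)%R -> measurable_fun setT w ->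
  Lp p v1 -> Lp p v2 ->
  (forall x, `|w x| `^ p <= c * (`|v1 x| `^ p + `|v2 x| `^ p))%R -> Lp p w.
Proof.
move=> c0 mw [m1 i1] [m2 i2] H; split; first exact: mw.
have M1 := measurable_powR_normE p m1; have M2 := measurable_powR_normE p m2.
have P0 (v : T -> R) x : 0 <= (`|v x| `^ p)%:E by rewrite lee_fin powR_ge0.
apply: (@le_lt_trans _ _ (\int[mu]_x (c%:E * ((`|v1 x| `^ p)%:E + (`|v2 x| `^ p)%:E)))).
  apply: ge0_le_integralT => //.
  - exact: measurable_powR_normE.
  - by apply: measurable_funeM; exact: emeasurable_funD.
rewrite ge0_integralZlT//; [|exact: emeasurable_funD|by move=> x; rewrite adde_ge0].
rewrite ge0_integralDT//.
by rewrite lte_mul_pinfty// lte_add_pinfty.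
Qed.

Lemma Lp_add p w v : (1 <= p)%R -> Lp p w -> Lp p v -> Lp p (fun x => w x + v x)%R.
Proof.
move=> p1 Lw Lv; apply: (Lp_dominated _ _ Lw Lv (c := 2 `^ p / 2)).
- by rewrite divr_ge0 ?powR_ge0.
- by apply: measurable_funD; [exact: Lw.1|exact: Lv.1].
- by move=> x; exact: powR_normD_le.
Qed.

Lemma Lp_scale p (k : R) w : Lp p w -> Lp p (fun x => k * w x)%R.
Proof.
move=> Lw; apply: (Lp_dominated _ _ Lw Lw (c := `|k| `^ p)).
- exact: powR_ge0.
- by apply: measurable_funM => //; exact: Lw.1.
- by move=> x; rewrite normrM powRM// ler_wpM2l ?powR_ge0// lerDl powR_ge0.
Qed.

Lemma Lp_sub p w v : (1 <= p)%R -> Lp p w -> Lp p v -> Lp p (fun x => w x - v x)%R.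
Proof.
move=> p1 Lw Lv; have := Lp_add p1 Lw (Lp_scale (-1) Lv).
by under eq_fun do rewrite mulN1r.
Qed.

Section duality.
Variables p q : R.
Hypothesis p1 : (1 < p)%R.
Hypothesis qE : q = (p / (p - 1))%R.

Let p0 : (0 < p)%R. Proof. exact: lt_trans ltr01 p1. Qed.

Lemma Lp_mul_integrable w phi : Lp p w -> Lp q phi ->
  mu.-integrable setT (fun x => (w x * phi x)%:E).
Proof.
move=> [mw iw] [mphi iphi]; apply/integrableP; split.
  by apply/measurable_EFinP; exact: measurable_funM.
have M1 := measurable_powR_normE q mphi; have M2 := measurable_powR_normE p mw.
have P0 (r : R) (v : T -> R) x : 0 <= (`|v x| `^ r)%:E by rewrite lee_fin powR_ge0.
apply: (@le_lt_trans _ _ (\int[mu]_x ((`|phi x| `^ q)%:E + (`|w x| `^ p)%:E))).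
  apply: ge0_le_integralT => //.
  - do 2 apply: measurableT_comp => //; exact: measurable_funM.
  - exact: emeasurable_funD.
  - move=> x /=; rewrite lee_fin normrM.
    have := young_eps p1 qE (normr_ge0 (w x)) (normr_ge0 (phi x)) ltr01.
    by rewrite powR1 !mul1r.
by rewrite ge0_integralDT// lte_add_pinfty.
Qed.

Definition pairing w phi : R := \int[mu]_x (w x * phi x).

Lemma pairingE w phi : Lp p w -> Lp q phi ->
  \int[mu]_x (w x * phi x)%:E = (pairing w phi)%:E.
Proof.
by move=> Lw Lphi; rewrite /pairing /Rintegral fineK// integrable_fin_num// Lp_mul_integrable.
Qed.

(** Young with a free parameter, used where Hoelder would be customary: it is linear in the p-th
    powers of norms, and [e] is tuned at each use. *)
Lemma pairing_le w phi (e : R) : (0 < e)%R -> Lp p w -> Lp q phi ->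
  (`|pairing w phi| <= e * np q phi + e `^ (1 - p) * np p w)%R.
Proof.
move=> e0 Lw Lphi; have iw := Lp_mul_integrable Lw Lphi.
rewrite -lee_fin EFinD !EFinM -(npE Lw) -(npE Lphi).
have M1 := measurable_powR_normE q Lphi.1; have M2 := measurable_powR_normE p Lw.1.
have P0 (r : R) (v : T -> R) x : 0 <= (`|v x| `^ r)%:E by rewrite lee_fin powR_ge0.
rewrite -!ge0_integralZlT ?powR_ge0 ?(ltW e0)//.
rewrite -ge0_integralDT; [|exact: measurable_funeM|exact: measurable_funeM| |]; last 2 first.
- by move=> x; rewrite mule_ge0// lee_fin (ltW e0).
- by move=> x; rewrite mule_ge0// lee_fin powR_ge0.
rewrite -abse_EFin -pairingE//.
apply: le_trans (le_abse_integral _ _ _) _ => //; first by case/integrableP: iw.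
apply: ge0_le_integralT.
- by apply: measurableT_comp => //; case/integrableP: iw.
- by apply: emeasurable_funD; exact: measurable_funeM.
- by move=> x.
- move=> x /=; rewrite normrM -!EFinM -EFinD lee_fin.
  exact: young_eps.
Qed.

Lemma pairing_sub w v phi : Lp p w -> Lp p v -> Lp q phi ->
  pairing (fun x => w x - v x)%R phi = (pairing w phi - pairing v phi)%R.
Proof.
move=> Lw Lv Lphi; rewrite /pairing -RintegralB//; [|exact: Lp_mul_integrable..].
by apply: eq_Rintegral => x _; rewrite mulrBl.
Qed.

Lemma pairing_mid w v phi : Lp p w -> Lp p v -> Lp q phi ->
  pairing (fun x => 2^-1 * (w x + v x))%R phi =
  (2^-1 * (pairing w phi + pairing v phi))%R.
Proof.
move=> Lw Lv Lphi; rewrite /pairing -RintegralD//; [|exact: Lp_mul_integrable..].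
rewrite -RintegralZl//; last first.
  exact: (integrableD measurableT (Lp_mul_integrable Lw Lphi)
    (Lp_mul_integrable Lv Lphi)).
by apply: eq_Rintegral => x _; ring.
Qed.

(** The pointwise inequality integrated, with the midpoint term first moved to the left so that all
    integrands are nonnegative. *)
Lemma np_uniform_convexity (eta : R) : (0 < eta)%R -> exists2 C : R, (0 <= C)%R &
  forall w v, Lp p w -> Lp p v ->
  (np p (fun x => w x - v x) <= eta * (np p w + np p v) +
    C * (np p w + np p v - 2 * np p (fun x => 2^-1 * (w x + v x))))%R.
Proof.
move=> eta0; have [C C0 H] := uniform_convexity p1 eta0; exists C => // w v Lw Lv.
have Ld := Lp_sub (ltW p1) Lw Lv.
have Lm := Lp_scale 2^-1 (Lp_add (ltW p1) Lw Lv).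
have Mw := measurable_powR_normE p Lw.1.
have Mv := measurable_powR_normE p Lv.1.
have Md := measurable_powR_normE p Ld.1.
have Mm := measurable_powR_normE p Lm.1.
have P0 (u : T -> R) x : 0 <= (`|u x| `^ p)%:E by rewrite lee_fin powR_ge0.
have C2 : (0 <= C * 2)%R by rewrite mulr_ge0.
have eC : (0 <= eta + C)%R by rewrite addr_ge0// ltW.
have aux (a b c c' : R) : (a + (C * 2) * b <= (eta + C) * (c + c') ->
    a <= eta * (c + c') + C * (c + c' - 2 * b))%R by lra.
apply: aux.
have MmC : measurable_fun setT (fun x => (C * 2)%:E * (`|2^-1 * (w x + v x)| `^ p)%:E).
  exact: measurable_funeM.
have MmC0 x : 0 <= (C * 2)%:E * (`|2^-1 * (w x + v x)| `^ p)%:E.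
  by rewrite mule_ge0.
have Mwv : measurable_fun setT (fun x => (`|w x| `^ p)%:E + (`|v x| `^ p)%:E).
  exact: emeasurable_funD.
have Mwv0 x : 0 <= (`|w x| `^ p)%:E + (`|v x| `^ p)%:E by rewrite adde_ge0.
have : \int[mu]_x ((`|w x - v x| `^ p)%:E + (C * 2)%:E * (`|2^-1 * (w x + v x)| `^ p)%:E) <=
    \int[mu]_x ((eta + C)%:E * ((`|w x| `^ p)%:E + (`|v x| `^ p)%:E)).
  apply: ge0_le_integralT.
  - exact: emeasurable_funD.
  - exact: measurable_funeM.
  - by move=> x; rewrite adde_ge0.
  - move=> x; rewrite -EFinM -!EFinD -EFinM lee_fin.
    have aux2 (a b c c' : R) : (a <= eta * (c + c') + C * (c + c' - 2 * b) ->
      a + (C * 2) * b <= (eta + C) * (c + c'))%R by lra.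
    by apply: aux2; have := H (w x) (v x); rewrite (mulrC (w x + v x)%R).
rewrite (ge0_integralDT _ Md MmC (P0 _) MmC0).
rewrite (ge0_integralZlT _ Mm (P0 _) C2) (ge0_integralZlT _ Mwv Mwv0 eC).
rewrite (ge0_integralDT _ Mw Mv (P0 _) (P0 _)).
by rewrite (npE Ld) (npE Lm) (npE Lw) (npE Lv) -EFinM -!EFinD -EFinM lee_fin.
Qed.

End duality.

Lemma ae_summable (f : nat -> T -> \bar R) :
  (forall k, measurable_fun setT (f k)) -> (forall k x, 0 <= f k x) ->
  \sum_(k <oo) \int[mu]_x f k x < +oo ->
  {ae mu, forall x, \sum_(k <oo) f k x < +oo}.
Proof.
move=> mf f0 S; rewrite -integral_nneseries// in S.
have F0 x : 0 <= \sum_(k <oo) f k x by apply: nneseries_ge0.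
have : mu.-integrable setT (fun x => \sum_(k <oo) f k x).
  apply/integrableP; split; first exact: ge0_emeasurable_sum.
  by under eq_integral do rewrite gee0_abs//.
move=> /(integrable_ae measurableT); apply: filterS => x /(_ I).
by rewrite fin_numE => /andP[_]; rewrite ltey.
Qed.

Lemma nneseries_le_term (f : nat -> \bar R) (k : nat) :
  (forall k, 0 <= f k) -> f k <= \sum_(i <oo) f i.
Proof.
move=> f0; apply: (@le_trans _ _ (\sum_(0 <= i < k.+1) f i)).
  by rewrite big_nat_recr//= leeDr// sume_ge0.
by apply: nneseries_lim_ge => i _ _.
Qed.

Lemma nneseries_geometric_lty (f : nat -> \bar R) : (forall k, 0 <= f k) ->
  (forall k, f k <= (2^-1 ^+ k)%:E) -> \sum_(k <oo) f k < +oo.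
Proof.
move=> f0 fk; apply: (@le_lt_trans _ _ 2%:E); last exact: ltry.
apply: lime_le; first by apply: is_cvg_nneseries.
apply: nearW => N; apply: (@le_trans _ _ (\sum_(0 <= k < N) (2^-1 ^+ k)%:E)).
  by apply: lee_sum => k _.
rewrite sumEFin lee_fin.
have -> : (\sum_(0 <= k < N) 2^-1 ^+ k = 2 - 2 * 2^-1 ^+ N :> R)%R.
  elim: N => [|N IH]; first by rewrite big_nil expr0; ring.
  by rewrite big_nat_recr//= IH exprS; field.
by rewrite lerBlDr lerDl mulr_ge0// exprn_ge0// invr_ge0.
Qed.

Lemma measurable_fun_limn_einf (H : nat -> T -> \bar R) :
  (forall k, measurable_fun setT (H k)) ->
  measurable_fun setT (fun x => limn_einf (fun k => H k x)).
Proof.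
move=> mH; under eq_fun do rewrite -[limn_einf _]oppeK -limn_esupN.
apply: measurableT_comp => //; apply: measurable_fun_limn_esup => k.
exact: measurableT_comp.
Qed.

Lemma ae_fatou_liminf (H : nat -> T -> \bar R) (G : T -> \bar R) :
  (forall k, measurable_fun setT (H k)) -> (forall k x, 0 <= H k x) ->
  measurable_fun setT G -> (forall x, 0 <= G x) ->
  {ae mu, forall x, H k x @[k --> \oo] --> G x} ->
  \int[mu]_x G x <= limn_einf (fun k => \int[mu]_x H k x).
Proof.
move=> mH H0 mG G0 HG.
have I0 x : 0 <= limn_einf (fun k => H k x).
  rewrite limn_einf_lim; apply: lime_ge; first exact: is_cvg_einfs.
  by apply: nearW => N; apply: le_ereal_inf_tmp => _ [k _ <-].
apply: le_trans (fatou mu measurableT mH (fun k x _ => H0 k x)).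
apply: ae_ge0_le_integral => //.
- exact: measurable_fun_limn_einf.
- apply: filterS HG => x hx _.
  by rewrite (cvg_limn_einf_sup hx).1.
Qed.

Lemma limn_einf_le (h : nat -> \bar R) (c : \bar R) :
  (forall k, h k <= c) -> limn_einf h <= c.
Proof.
move=> hc; rewrite limn_einf_lim; apply: lime_le; first exact: is_cvg_einfs.
apply: nearW => N; apply: le_trans (hc N).
by apply: ereal_inf_lbound; exists N => /=.
Qed.

Lemma ae_fatou (H : nat -> T -> \bar R) (G : T -> \bar R) (c : \bar R) :
  (forall k, measurable_fun setT (H k)) -> (forall k x, 0 <= H k x) ->
  measurable_fun setT G -> (forall x, 0 <= G x) ->
  {ae mu, forall x, H k x @[k --> \oo] --> G x} ->
  (forall k, \int[mu]_x H k x <= c) -> \int[mu]_x G x <= c.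
Proof.
move=> mH H0 mG G0 HG Hc.
exact: le_trans (ae_fatou_liminf mH H0 mG G0 HG) (limn_einf_le Hc).
Qed.

Section completeness.
Variable p : R.
Hypothesis p1 : (1 < p)%R.

Let p0 : (0 < p)%R. Proof. exact: lt_trans ltr01 p1. Qed.

Lemma geometric_cvg (v : nat -> R) (S : R) : (0 <= S)%R ->
  (forall k, `|v k.+1 - v k| <= S * 2^-1 ^+ k)%R -> cvgn v.
Proof.
move=> S0 H.
have : cvgn (series (telescope v)).
  apply: normed_cvg; apply: (@series_le_cvg _ _ (geometric S 2^-1)%R).
  - by move=> k /=.
  - by move=> k /=; rewrite mulr_ge0// exprn_ge0.
  - by move=> k /=; exact: H.
  - apply: is_cvg_geometric_series; rewrite ger0_norm//; lra.
rewrite telescopeK => c.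
have -> : v = (fun n => [sequence v n - v 0%N]_n n + v 0%N)%R.
  by apply/funext => n /=; rewrite subrK.
by apply: is_cvgD => //; exact: is_cvg_cst.
Qed.

(** The series of (2^k |v_{k+1} - v_k|)^p has finite integral, so almost everywhere its sum S is
    finite and bounds each term: the increments are at most S^(1/p) 2^(-k). *)
Lemma Lp_fast_cauchy_ae (v : nat -> T -> R) :
  (forall k, measurable_fun setT (v k)) ->
  (forall k, \int[mu]_x (`|v k.+1 x - v k x| `^ p)%:E <=
     ((2^-1 ^+ k) `^ p * 2^-1 ^+ k)%:E) ->
  {ae mu, forall x, cvgn (fun k => v k x)}.
Proof.
move=> mv H.
pose f k x := (((2 ^+ k) `^ p)%:E * (`|v k.+1 x - v k x| `^ p)%:E).
have mf k : measurable_fun setT (f k).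
  apply: measurable_funeM; apply: measurable_powR_normE.
  exact: measurable_funB.
have f0 k x : 0 <= f k x by rewrite mule_ge0// lee_fin powR_ge0.
have : {ae mu, forall x, \sum_(k <oo) f k x < +oo}.
  apply: ae_summable => //; apply: nneseries_geometric_lty => k.
    by apply: integral_ge0 => x _; exact: f0.
  rewrite ge0_integralZlT ?powR_ge0//; last first.
    by apply: measurable_powR_normE; exact: measurable_funB.
  apply: le_trans (lee_wpmul2l _ (H k)) _; first by rewrite lee_fin powR_ge0.
  rewrite -EFinM lee_fin mulrA -powRM ?exprn_ge0//.
  by rewrite -exprMn mulfV// expr1n powR1 mul1r.
apply: filterS => x Sx.
pose S := fine (\sum_(k <oo) f k x).
have S0' : 0 <= \sum_(k <oo) f k x by apply: nneseries_ge0.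
have SE : \sum_(k <oo) f k x = S%:E by rewrite fineK// ge0_fin_numE.
have S0 : (0 <= S)%R by rewrite fine_ge0.
apply: (@geometric_cvg _ (S `^ p^-1)); first exact: powR_ge0.
move=> k.
have : f k x <= S%:E.
  by rewrite -SE; apply: (@nneseries_le_term (fun k => f k x)).
rewrite /f -EFinM lee_fin -powRM ?exprn_ge0// => h.
have : (2 ^+ k * `|v k.+1 x - v k x| <= S `^ p^-1)%R.
  have -> : (2 ^+ k * `|v k.+1 x - v k x| =
      ((2 ^+ k * `|v k.+1 x - v k x|) `^ p) `^ p^-1)%R.
    by rewrite -powRrM mulfV ?gt_eqF// powRr1// mulr_ge0// exprn_ge0.
  by apply: ler_powRl; rewrite ?invr_ge0 ?(ltW p0) ?powR_ge0.
by rewrite exprVn ler_pdivlMr ?exprn_gt0// mulrC.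
Qed.

(** A fast subsequence converges almost everywhere, and Fatou's lemma passes bounds to the limit.
    The last clause carries the norm bound that [weak_limit] asserts. *)
Lemma Lp_complete (w : nat -> T -> R) : (forall k, Lp p (w k)) ->
  (forall e : R, (0 < e)%R -> exists K, forall k l, (K <= k)%N -> (K <= l)%N ->
     (np p (fun x => w k x - w l x) <= e)%R) ->
  exists g, [/\ Lp p g,
    (forall e : R, (0 < e)%R -> exists K, forall k, (K <= k)%N ->
      (np p (fun x => w k x - g x) <= e)%R) &
    (forall (c : R) K, (forall k, (K <= k)%N -> (np p (w k) <= c)%R) ->
      (np p g <= c)%R)].
Proof.
move=> Lw cau.
have /choice[f Hf] : forall j, exists K, forall k l, (K <= k)%N -> (K <= l)%N ->
    (np p (fun x => w k x - w l x) <= (2^-1 ^+ j) `^ p * 2^-1 ^+ j)%R.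
  by move=> j; apply: cau; rewrite mulr_gt0 ?powR_gt0 ?exprn_gt0.
(* Summing makes the indices monotone while dominating both [f j] and [j]. *)
pose F j := (\sum_(i < j.+1) f i + j)%N.
have Ff j : (f j <= F j)%N.
  by rewrite /F big_ord_recr/= -addnA addnCA leq_addr.
have FS j : (F j <= F j.+1)%N.
  by rewrite /F [in leqRHS]big_ord_recr/= leq_add// leq_addr.
have Fj j : (j <= F j)%N by rewrite /F leq_addl.
pose v j := w (F j).
have mv k : measurable_fun setT (v k) by exact: (Lw _).1.
have Hv k : \int[mu]_x (`|v k.+1 x - v k x| `^ p)%:E <=
     ((2^-1 ^+ k) `^ p * 2^-1 ^+ k)%:E.
  have Ld := Lp_sub (ltW p1) (Lw (F k.+1)) (Lw (F k)).
  rewrite (npE Ld) lee_fin; apply: Hf => //.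
  exact: leq_trans (FS k).
have aev := Lp_fast_cauchy_ae mv Hv.
(* An upper limit is measurable whether or not the sequence converges, and almost everywhere it is
   the limit. *)
pose g x := fine (limn_esup (fun k => (v k x)%:E)).
have mg : measurable_fun setT g.
  apply: (measurableT_comp (fine_measurable measurableT)).
  by apply: measurable_fun_limn_esup => k; apply/measurable_EFinP.
have aeg : {ae mu, forall x, v k x @[k --> \oo] --> g x}.
  apply: filterS aev => x cvx.
  rewrite /g.
  have vl : (v k x)%:E @[k --> \oo] --> (limn (fun k => v k x))%:E.
    by apply: cvg_EFin; [exact: nearW|].
  by rewrite (cvg_limn_einf_sup vl).2.
have ae_np (h : nat -> T -> R) (g' : T -> R) (c : R) :
    (forall k, Lp p (h k)) -> measurable_fun setT g' ->
    {ae mu, forall x, h k x @[k --> \oo] --> g' x} ->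
    (forall k, (np p (h k) <= c)%R) ->
    \int[mu]_x (`|g' x| `^ p)%:E <= c%:E.
  move=> Lh mg' hg hc.
  apply: (@ae_fatou (fun k x => (`|h k x| `^ p)%:E)).
  - by move=> k; apply: measurable_powR_normE; exact: (Lh k).1.
  - by move=> k x; rewrite lee_fin powR_ge0.
  - exact: measurable_powR_normE.
  - by move=> x; rewrite lee_fin powR_ge0.
  - apply: filterS hg => x hx; apply: cvg_EFin; first exact: nearW.
    exact: (cvg_comp _ _ hx (continuous_norm_powR p0 (x := g' x))).
  - by move=> k; rewrite (npE (Lh k)) lee_fin.
have key k (e : R) K : (forall k l, (K <= k)%N -> (K <= l)%N ->
    (np p (fun x => w k x - w l x) <= e)%R) -> (K <= k)%N ->
    \int[mu]_x (`|w k x - g x| `^ p)%:E <= e%:E.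
  move=> HK Kk; apply: (ae_np (fun l x => w k x - v (l + K)%N x)%R).
  + by move=> l; exact: (Lp_sub (ltW p1) (Lw k) (Lw _)).
  + by apply: measurable_funB => //; exact: (Lw k).1.
  + apply: filterS aeg => x hx; apply: cvgB; first exact: cvg_cst.
    by rewrite (cvg_shiftn K (fun k => v k x)).
  + by move=> l; apply: HK => //; apply: leq_trans (Fj _); exact: leq_addl.
have Lkg e K k : (forall k l, (K <= k)%N -> (K <= l)%N ->
    (np p (fun x => w k x - w l x) <= e)%R) -> (K <= k)%N ->
    Lp p (fun x => w k x - g x)%R.
  move=> HK Kk; split; first by apply: measurable_funB => //; exact: (Lw k).1.
  by apply: le_lt_trans (key _ _ _ HK Kk) _; exact: ltry.
have Lg : Lp p g.
  have [K HK] := cau 1%R ltr01.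
  have := Lp_sub (ltW p1) (Lw K) (Lkg _ _ _ HK (leqnn K)).
  by under eq_fun do rewrite opprB addrC subrK.
exists g; split => //.
- move=> e /cau[K HK]; exists K => k Kk.
  by rewrite -lee_fin -npE; [exact: key HK Kk|exact: Lkg HK Kk].
- move=> c K HK; rewrite -lee_fin -npE//.
  apply: (ae_np (fun k => v (k + K)%N)).
  + by move=> k; exact: Lw.
  + exact: mg.
  + by apply: filterS aeg => x; rewrite (cvg_shiftn K (fun k => v k x)).
  + by move=> k; apply: HK; apply: leq_trans (Fj _); exact: leq_addl.
Qed.

End completeness.

(** * Weak limits of bounded sequences against a class of test functions *)

Section weak_limit.
Variables p q : R.
Hypothesis p1 : (1 < p)%R.
Hypothesis qE : q = (p / (p - 1))%R.

(* The near-minimizers of the norm over the decreasing convex sets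
   [near_limit K], which contain [W k] for [k >= K], are strongly Cauchy. *)
Lemma weak_limit (W : nat -> T -> R) (D : set (T -> R)) (L : (T -> R) -> R) (c : R) :
  (forall k, Lp p (W k)) -> (forall k, (np p (W k) <= c)%R) ->
  (forall phi, D phi -> Lp q phi) ->
  (forall phi, D phi -> pairing (W k) phi @[k --> \oo] --> L phi) ->
  exists g, [/\ Lp p g, (np p g <= c)%R & forall phi, D phi -> pairing g phi = L phi].
Proof.
move=> LW Wc LD WL.
(* This plays the role of the closed convex hull of the tail from [K]: it retains every bound around
   [L phi] that the tail satisfies, and such bounds survive midpoints. *)
pose near_limit K w := Lp p w /\ forall phi (e : R), D phi ->
  (forall k, (K <= k)%N -> (`|pairing (W k) phi - L phi| <= e)%R) ->
  (`|pairing w phi - L phi| <= e)%R.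
have AW K k : (K <= k)%N -> near_limit K (W k).
  by move=> Kk; split => // phi e Dphi; apply.
have Asub K K' w : (K <= K')%N -> near_limit K' w -> near_limit K w.
  move=> KK' [Lw H]; split => // phi e Dphi He; apply: H => // k /(leq_trans KK').
  exact: He.
have Amid K w v : near_limit K w -> near_limit K v ->
    near_limit K (fun x => 2^-1 * (w x + v x))%R.
  move=> [Lw Hw] [Lv Hv]; split; first exact: Lp_scale (Lp_add (ltW p1) Lw Lv).
  move=> phi e Dphi He.
  rewrite (pairing_mid p1 qE Lw Lv (LD _ Dphi)).
  have := Hw _ _ Dphi He; have := Hv _ _ Dphi He.
  by rewrite !ler_distl => /andP[? ?] /andP[? ?]; apply/andP; split; lra.
pose B K := [set np p w | w in near_limit K].
have B0 K : B K !=set0 by exists (np p (W K)), (W K) => //; exact: AW.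
have Blb K : has_lbound (B K) by exists 0%R => _ [w _ <-]; exact: np_ge0.
have Binf K : has_inf (B K) by split.
pose m K := inf (B K).
have mle K w : near_limit K w -> (m K <= np p w)%R.
  by move=> Aw; apply: ge_inf => //; exists w.
have mc K : (m K <= c)%R by apply: le_trans (mle _ _ (AW K K (leqnn _))) (Wc K).
have mS : nondecreasing_seq m.
  move=> K K' KK'; apply: lb_le_inf => // _ [w Aw <-]; apply: mle.
  exact: Asub Aw.
pose r (K : nat) : R := (K.+1%:R^-1)%R.
have r0 K : (0 < r K)%R by rewrite invr_gt0.
have /choice[w Hw] : forall K, exists w, near_limit K w /\ (np p w < m K + r K)%R.
  move=> K; have [_ [w Aw <-] Hw] := inf_adherent (r0 K) (Binf K).
  by exists w.
have Lw K : Lp p (w K) by exact: (Hw K).1.1.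
have rS K K' : (K <= K')%N -> (r K' <= r K)%R.
  by move=> KK'; rewrite lef_pV2 ?posrE// ler_nat ltnS.
have rlim : r K @[K --> \oo] --> (0 : R)%R by exact: cvg_harmonic.
have small (e : R) : (0 < e)%R -> exists K, (r K <= e)%R.
  move=> e0; have /cvgrPdist_le/(_ _ e0)[K _ HK] := rlim.
  by exists K; have := HK K (leqnn K); rewrite sub0r normrN ger0_norm// ltW.
have mlim : m K @[K --> \oo] --> sup (range m).
  by apply: nondecreasing_cvgn => //; exists c => _ [K _ <-]; exact: mc.
have msup K : (m K <= sup (range m))%R.
  apply: ub_le_sup; last by exists K.
  by exists c => _ [K' _ <-]; exact: mc.
have c0 : (0 <= c)%R by apply: le_trans (Wc 0%N); exact: np_ge0.
have wc K : (np p (w K) <= c + r K)%R.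
  by rewrite (le_trans (ltW (Hw K).2))// lerD2r mc.
have r1 K : (r K <= 1)%R by rewrite /r invf_le1// ler1n.
have [g [Lg wg gc]] : exists g, [/\ Lp p g,
    (forall e : R, (0 < e)%R -> exists K, forall k, (K <= k)%N ->
      (np p (fun x => w k x - g x) <= e)%R) &
    (forall (c : R) K, (forall k, (K <= k)%N -> (np p (w k) <= c)%R) ->
      (np p g <= c)%R)].
  (* For k, l >= K the midpoint of [w k] and [w l] lies in [near_limit K], so its p-th power norm is
     at least [m K], while those of [w k] and [w l] exceed [m K] by at most 2 e/(8(C+1)). The
     convexity gap is thus at most 4 e/(8(C+1)), and since both norms are at most c + 1 the
     parameter e/(4(c+1)) bounds the other term by e/2. *)
  apply: (Lp_complete p1 Lw) => e e0.
  have eta0 : (0 < e / (4 * (c + 1)))%R by rewrite divr_gt0// mulr_gt0// ltr_wpDl.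
  have [C C0 HC] := np_uniform_convexity p1 eta0.
  have e1 : (0 < e / (8 * (C + 1)))%R by rewrite divr_gt0// mulr_gt0// ltr_wpDl.
  have [K1 rK1] := small _ e1.
  have /cvgrPdist_le/(_ _ e1)[K2 _ HK2] := mlim.
  pose K := maxn K1 K2.
  have KM : (sup (range m) - m K <= e / (8 * (C + 1)))%R.
    have := HK2 K (leq_maxr _ _).
    by rewrite ger0_norm// subr_ge0.
  have Kr k : (K <= k)%N -> (r k <= e / (8 * (C + 1)))%R.
    by move=> Kk; apply: le_trans rK1; apply: rS; apply: leq_trans Kk; exact: leq_maxl.
  have Kw k : (K <= k)%N -> (np p (w k) <= m K + 2 * (e / (8 * (C + 1))))%R.
    move=> Kk; have := (Hw k).2; have := msup k; have := Kr k Kk; lra.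
  exists K => k l Kk Kl; apply: le_trans (HC _ _ (Lw k) (Lw l)) _.
  have Ak := Asub _ _ _ Kk (Hw k).1; have Al := Asub _ _ _ Kl (Hw l).1.
  have := mle _ _ (Amid _ _ _ Ak Al).
  have := Kw k Kk; have := Kw l Kl.
  have := wc k; have := wc l; have := r1 k; have := r1 l.
  set a := np p (w k); set b := np p (w l); set d' := np p (fun _ => _).
  move: e1 eta0; set e2 := (e / (8 * (C + 1)))%R; set e3 := (e / (4 * (c + 1)))%R.
  move=> e1 eta0 rl rk bc ac bm am dm.
  have E3 : (e3 * (2 * (c + 1)) = e / 2)%R by rewrite /e3; field; rewrite gt_eqF// ltr_wpDl.
  have E2 : ((C + 1) * (4 * e2) = e / 2)%R by rewrite /e2; field; rewrite gt_eqF// ltr_wpDl.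
  have H1 : (e3 * (a + b) <= e / 2)%R.
    by rewrite -E3 ler_pM2l//; lra.
  have H2 : (C * (a + b - 2 * d') <= e / 2)%R.
    apply: (@le_trans _ _ (C * (4 * e2))%R); first by rewrite ler_wpM2l//; lra.
    by rewrite -E2 ler_wpM2r//; [rewrite mulr_ge0// ltW|rewrite lerDl].
  by rewrite (splitr e) lerD.
exists g; split => //.
  apply/ler_addgt0Pr => e e0; have [K rK] := small _ e0; apply: (gc _ K) => k Kk.
  by apply: le_trans (wc k) _; rewrite lerD2l (le_trans (rS _ _ Kk)).
move=> phi Dphi; have Lphi := LD _ Dphi.
apply/eqP; rewrite -subr_eq0 -normr_le0; apply/ler_addgt0Pr => e e0; rewrite add0r.
have e30 : (0 < e / 3)%R by rewrite divr_gt0.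
have /cvgrPdist_le/(_ _ e30)[K1 _ HK1] := WL _ Dphi.
(* Keeps the [phi] term of [pairing_le] below e/3; strong convergence of [w k] handles the other
   term. *)
pose e' := (e / 3 / (np q phi + 1))%R.
have e'0 : (0 < e')%R by rewrite divr_gt0// ltr_wpDl// np_ge0.
have pe'0 : (0 < e' `^ (1 - p))%R by exact: powR_gt0.
have [K2 HK2] := wg (e / 3 / e' `^ (1 - p))%R (divr_gt0 e30 pe'0).
pose k := maxn K1 K2.
have H1 : (`|pairing (w k) phi - L phi| <= e / 3)%R.
  apply: (Asub _ _ _ (leq_maxl _ _) (Hw k).1).2 => // l Kl.
  by rewrite distrC; exact: HK1.
have H2 : (`|pairing (w k) phi - pairing g phi| <= e / 3 + e / 3)%R.
  rewrite -(pairing_sub p1 qE (Lw k) Lg Lphi).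
  have Ls : Lp p (fun x => w k x - g x)%R by exact: (Lp_sub (ltW p1) (Lw k) Lg).
  apply: le_trans (pairing_le p1 qE e'0 Ls Lphi) _; apply: lerD.
    have nq : (0 < np q phi + 1)%R by rewrite ltr_wpDl// np_ge0.
    have E : (e' * (np q phi + 1) = e / 3)%R by rewrite /e' mulfVK// gt_eqF.
    by rewrite -E ler_wpM2l ?lerDl// (ltW e'0).
  rewrite mulrC -ler_pdivlMr//; apply: HK2; exact: leq_maxr.
have -> : (pairing g phi - L phi = (pairing (w k) phi - L phi) -
  (pairing (w k) phi - pairing g phi))%R by ring.
apply: le_trans (ler_normB _ _) _; apply: le_trans (lerD H1 H2) _; lra.
Qed.

End weak_limit.

End Lp_functions.

(** * Test functions and the fundamental lemma *)

Section flat_function.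
Context {R : realType}.
Implicit Types (P : {poly R}) (t : R).

(* With a polynomial factor in [1 / t], the class is stable under differentiation. *)
Definition flat P t : R := if 0 < t then P.[t^-1] * expR (- t^-1) else 0.

(** Induction on the polynomial: each new factor [y] is absorbed by half of the exponent through 1 +
    x <= exp x. *)
Lemma horner_le_expR P (a : R) : 0 < a ->
  exists2 C, 0 <= C & forall y, 0 <= y -> `|P.[y]| <= C * expR (a * y).
Proof.
elim/poly_ind: P a => [|P c IH] a a0.
  by exists 0 => // y _; rewrite horner0 normr0 mul0r.
have a20 : 0 < a / 2 by rewrite divr_gt0.
have [C C0 HC] := IH _ a20.
exists (C * (a / 2)^-1 + `|c|); first by rewrite addr_ge0// mulr_ge0// invr_ge0 ltW.
move=> y y0; rewrite !hornerE; apply: le_trans (ler_normD _ _) _.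
rewrite mulrDl lerD//; last first.
  by rewrite ler_peMr// (le_trans _ (expR_ge1Dx _))// lerDl mulr_ge0// ltW.
rewrite normrM (ger0_norm y0).
apply: (@le_trans _ _ (C * expR (a / 2 * y) * ((a / 2)^-1 * expR (a / 2 * y)))).
  apply: ler_pM => //; first exact: HC.
  rewrite ler_pdivlMl//; apply: le_trans (expR_ge1Dx _); by rewrite lerDr.
have -> : a * y = a / 2 * y + a / 2 * y by field.
by rewrite expRD le_eqVlt; apply/orP; left; apply/eqP; ring.
Qed.

(** Apply the exponential bound to P X^2. Quadratic decay is all that differentiability at 0
    requires. *)
Lemma flat_le_sqr P : exists2 C, 0 <= C & forall t, `|flat P t| <= C * t ^+ 2.
Proof.
have [C C0 HC] := @horner_le_expR (P * 'X^2) 1 ltr01.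
exists C => // t; rewrite /flat; case: ifPn => t0; last first.
  by rewrite normr0 mulr_ge0// sqr_ge0.
have := HC t^-1; rewrite invr_ge0 (ltW t0) => /(_ isT).
rewrite hornerM hornerXn mul1r normrM (ger0_norm (_ : 0 <= t^-1 ^+ 2)) ?sqr_ge0//.
rewrite exprVn ler_pdivrMr ?exprn_gt0// => H.
rewrite normrM (ger0_norm (expR_ge0 _)) expRN ler_pdivrMr ?expR_gt0//.
by apply: le_trans H _; rewrite le_eqVlt; apply/orP; left; apply/eqP; ring.
Qed.

(** For t > 0 the chain rule turns P(1/t) exp(-1/t) into t^(-2) (P - P')(1/t) exp(-1/t), whence the
    new polynomial; at 0 the quadratic bound makes the quotient vanish. *)
Lemma is_derive_flat P t :
  is_derive t 1 (flat P) (flat ('X^2 * (P - P^`())) t).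
Proof.
have [t0|t0|->] := ltgtP t 0.
- rewrite {2}/flat ifF; last by apply/negbTE; rewrite -leNgt ltW.
  have d0 : is_derive t 1 (cst (0 : R)) 0 by exact: is_derive_cst.
  apply: near_eq_is_derive d0.
  near=> u; rewrite /flat ifF//; apply/negbTE; rewrite -leNgt ltW//.
  by near: u; exact: lt_nbhsl.
- have tn0 : t != 0 by rewrite gt_eqF.
  rewrite {2}/flat t0.
  have dV : is_derive t 1 (fun u : R => u^-1) (- t ^- 2).
    split; first exact: derivableV.
    by rewrite deriveV// derive_id [_ *: _]mulr1.
  have dP : is_derive t 1 (horner P \o (fun u => u^-1)) (P^`().[t^-1] * - t ^- 2).
    exact: is_derive1_comp.
  have dE : is_derive t 1 (expR \o (fun u => - u^-1)) (expR (- t^-1) * - - t ^- 2).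
    exact: is_derive1_comp.
  have -> : ('X^2 * (P - P^`())).[t^-1] * expR (- t^-1) =
      P.[t^-1] *: (expR (- t^-1) * - - t ^- 2) + expR (- t^-1) *: (P^`().[t^-1] * - t ^- 2).
    by rewrite hornerM hornerXn hornerD hornerN /GRing.scale/= exprVn; ring.
  apply: near_eq_is_derive (is_deriveM dP dE).
  near=> u; rewrite /flat ifT//.
  by near: u; exact: lt_nbhsr.
- rewrite {2}/flat ltxx.
  have [C C0 HC] := flat_le_sqr P.
  have H : (fun h : R => h^-1 *: ((flat P \o shift 0) (h *: 1) - flat P 0)) @ 0^' --> (0 : R).
    have C1 : 0 < C + 1 by rewrite ltr_wpDl.
    apply/cvgrPdist_le => e e0; have r0 : 0 < e / (C + 1) by rewrite divr_gt0.
    near=> h; rewrite sub0r normrN /= addr0.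
    rewrite [flat P 0]/flat ltxx subr0 [h *: 1]mulr1 normrM normfV.
    have h0 : h != 0 by near: h; exact: nbhs_dnbhs_neq.
    rewrite ler_pdivrMl ?normr_gt0//; apply: le_trans (HC h) _.
    rewrite -(ger0_norm (sqr_ge0 h)) expr2 normrM mulrCA ler_wpM2l//.
    have hC : `|h| <= e / (C + 1) by near: h; exact: dnbhs0_le.
    rewrite ler_pdivlMr// mulrDr mulr1 in hC; rewrite mulrC.
    by apply: le_trans hC; rewrite lerDl.
  split; first by apply/cvg_ex; exists 0.
  exact: cvg_lim H.
Unshelve. all: by end_near. Qed.

Lemma continuous_flat P : continuous (flat P).
Proof.
move=> t; apply/differentiable_continuous/derivable1_diffP.
exact: (@ex_derive _ _ _ _ _ _ _ (is_derive_flat P t)).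
Qed.

Lemma flat1_ge0 t : 0 <= flat 1 t.
Proof. by rewrite /flat; case: ifP => // _; rewrite hornerE mul1r expR_ge0. Qed.

Lemma flat1_gt0 t : (flat 1 t != 0) = (0 < t).
Proof.
rewrite /flat; case: ifP => [t0|_]; last by rewrite eqxx.
by rewrite hornerE mul1r gt_eqF// expR_gt0.
Qed.

Lemma flat1_le1 t : flat 1 t <= 1.
Proof.
rewrite /flat; case: ifP => // t0; rewrite hornerE mul1r -expR0 ler_expR.
by rewrite oppr_le0 invr_ge0 ltW.
Qed.

Lemma flat1_cvg t : 0 < t -> flat 1 (k.+1%:R * t) @[k --> \oo] --> (1 : R).
Proof.
move=> t0.
have H : expR (- (k.+1%:R^-1 * t^-1)) @[k --> \oo] --> (expR (- (0 * t^-1)) : R).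
  apply: continuous_cvg; first exact: continuous_expR.
  by apply: cvgN; apply: cvgM; [exact: cvg_harmonic|exact: cvg_cst].
rewrite mul0r oppr0 expR0 in H; apply: cvg_trans H; apply: near_eq_cvg.
by apply: nearW => k; rewrite /flat mulr_gt0// hornerE mul1r invfM.
Qed.

End flat_function.

Section smooth_functions.
Context {R : realType} {n : nat}.
Implicit Types (f g phi : 'rV[R]_n -> R) (i : 'I_n) (x v : 'rV[R]_n).

(** A class stable under partial derivatives and made of continuous functions: membership gives
    smoothness at once, without formulas for iterated derivatives. *)
Inductive flat_algebra : ('rV[R]_n -> R) -> Prop :=
| FlatCoord i P (c a : R) : flat_algebra (fun x => flat P (c * x 0 i + a))
| FlatCst (c : R) : flat_algebra (fun=> c)
| FlatAdd f g of flat_algebra f & flat_algebra g : flat_algebra (fun x => f x + g x)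
| FlatMul f g of flat_algebra f & flat_algebra g : flat_algebra (fun x => f x * g x).

Lemma flat_algebra_continuous f : flat_algebra f -> continuous f.
Proof.
elim => {f} [i P c a|c|f g _ cf _ cg|f g _ cf _ cg] x.
- apply: (@continuous_comp _ _ _ (fun x : 'rV[R]_n => c * x 0 i + a)); last exact: continuous_flat.
  apply: (@continuous_comp _ _ _ (fun y : 'rV[R]_n => y 0 i) (fun t : R => c * t + a)).
    exact: coord_continuous.
  by apply: cvgD; [apply: cvgM; [exact: cvg_cst|exact: cvg_id]|exact: cvg_cst].
- exact: cst_continuous.
- exact: continuousD (cf x) (cg x).
- exact: continuousM (cf x) (cg x).
Qed.

Lemma is_derive_line f v x (l : R) :
  is_derive (0 : R) 1 (fun h : R => f (h *: v + x)) l -> is_derive x v f l.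
Proof.
move=> [df <-]; split; first exact/derivable1P.
rewrite /derive; set g1 := fun h => h^-1 *: _; set g2 := fun h => h^-1 *: _.
suff -> : g1 = g2 by [].
apply/funext => h; rewrite /g1 /g2 /=.
by rewrite addr0 scale0r add0r [_%:A]mulr1.
Qed.

Lemma flat_algebra_derive f i : flat_algebra f -> exists2 g, flat_algebra g &
  forall x, is_derive x (delta_mx 0 i : 'rV[R]_n) f (g x).
Proof.
elim => {f} [j P c a|c|f g Ff [f' Ff' Hf] Fg [g' Fg' Hg]|f g Ff [f' Ff' Hf] Fg [g' Fg' Hg]].
- exists (fun x => (c * (i == j)%:R) * flat ('X^2 * (P - P^`())) (c * x 0 j + a)).
    by apply: FlatMul; [exact: FlatCst|exact: FlatCoord].
  move=> x; apply: is_derive_line.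
  pose y := c * x 0 j + a; pose b := c * (i == j)%:R.
  have -> : (fun h : R => flat P (c * (h *: (delta_mx 0 i : 'rV[R]_n) + x) 0 j + a)) =
      flat P \o (fun h => b * h + y).
    apply/funext => h /=; rewrite !mxE/= (eq_sym j) /b /y.
    by congr flat; ring.
  have d1 : is_derive (0 : R) 1 (fun h => b * h + y) b.
    have E : (b%:A + 0 *: (0 : R)) + (0 : R) = b by rewrite /GRing.scale/= mulr1 mul0r !addr0.
    rewrite -[X in is_derive _ _ _ X]E.
    exact: is_deriveD (is_deriveM (is_derive_cst b (0 : R) (1 : R)) (is_derive_id (0 : R) (1 : R))) (is_derive_cst y (0 : R) (1 : R)).
  rewrite mulrC; apply: (@is_derive1_comp _ (flat P) (fun h => b * h + y)) => //.
  by rewrite mulr0 add0r; exact: is_derive_flat.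
- by exists (fun=> 0); [exact: FlatCst|move=> x; exact: is_derive_cst].
- by exists (fun x => f' x + g' x); [exact: FlatAdd|move=> x; exact: is_deriveD].
- exists (fun x => f x * g' x + g x * f' x).
    by apply: FlatAdd; apply: FlatMul.
  by move=> x; exact: is_deriveM.
Qed.

Lemma flat_algebra_iter_partial (l : seq 'I_n) f :
  flat_algebra f -> flat_algebra (iter_partial l f).
Proof.
elim: l => // i l IH Ff /=; have [g Fg Hg] := flat_algebra_derive i (IH Ff).
by rewrite (_ : (fun x => _) = g)//; apply/funext => x; exact: derive_val.
Qed.

Lemma flat_algebra_test_function f (a b : 'I_n -> R) : flat_algebra f ->
  (forall x, f x != 0 -> forall i, a i <= x 0 i <= b i) -> test_function f.
Proof.
move=> Ff fab; split.
- move=> l i x; have [g _ Hg] := flat_algebra_derive i (flat_algebra_iter_partial l Ff).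
  exact: ex_derive.
- by move=> l; exact/flat_algebra_continuous/flat_algebra_iter_partial.
- have cK : compact [set x : 'rV[R]_n | forall i, `[a i, b i]%classic (x 0 i)].
    by apply: (@rV_compact _ _ (fun i => `[a i, b i]%classic)) => i; exact: segment_compact.
  apply: (subclosed_compact _ cK); first exact: closed_closure.
  rewrite [X in _ `<=` X](closure_id _).1; last exact: compact_closed.
  by apply: closure_subset => x /= /fab H i /=; rewrite in_itv/=.
Qed.

(** The factor [k.+1] steepens the edges, so that the bumps converge boundedly to the indicator of
    the open box. *)
Definition bump (a b : 'I_n -> R) (k : nat) x : R :=
  \prod_i (flat 1 (k.+1%:R * (x 0 i - a i)) * flat 1 (k.+1%:R * (b i - x 0 i))).

Lemma bump_neq0 a b k x : (bump a b k x != 0) = `[< obox a b x >].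
Proof.
apply/idP/asboolP => [|H]; rewrite prodf_seq_neq0; last first.
  apply/allP => i _ /=; rewrite mulf_eq0 negb_or !flat1_gt0.
  by rewrite !pmulr_rgt0// !subr_gt0.
move=> /allP H i; have := H i; rewrite mem_index_enum => /(_ isT)/=.
by rewrite mulf_eq0 negb_or !flat1_gt0 !pmulr_rgt0// !subr_gt0.
Qed.

Lemma bump_test_function a b k : test_function (bump a b k).
Proof.
apply: (@flat_algebra_test_function _ a b); last first.
  by move=> x; rewrite bump_neq0 => /asboolP H i; have /andP[? ?] := H i; rewrite !ltW.
rewrite /bump; elim: (index_enum _) => [|i r IH].
  by under eq_fun do rewrite big_nil; exact: FlatCst.
under eq_fun do rewrite big_cons; apply: FlatMul => //; apply: FlatMul.
- have := @FlatCoord i 1 k.+1%:R (- (k.+1%:R * a i)).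
  by under eq_fun do rewrite -mulrBr.
- have := @FlatCoord i 1 (- k.+1%:R) (k.+1%:R * b i).
  by under eq_fun do rewrite mulNr addrC -mulrBr.
Qed.

Lemma bump_ge0 a b k x : 0 <= bump a b k x.
Proof. by apply: prodr_ge0 => i _; rewrite mulr_ge0// flat1_ge0. Qed.

Lemma bump_le1 a b k x : bump a b k x <= 1.
Proof.
apply: prodr_ile1 => i _; rewrite mulr_ge0 ?flat1_ge0//=.
by rewrite mulr_ile1 ?flat1_ge0 ?flat1_le1.
Qed.

Lemma bump_cvg a b x : bump a b k x @[k --> \oo] --> (\1_(obox a b) x : R).
Proof.
rewrite indicE; have [ab|ab] := boolP (x \in obox a b); last first.
  rewrite (_ : (fun k => _) = fun=> 0); first exact: cvg_cst.
  apply/funext => k; apply/eqP; rewrite -[_ == _]negbK bump_neq0.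
  by apply/asboolPn => H; move: ab; rewrite (mem_set H).
rewrite inE in ab; rewrite /bump; elim: (index_enum _) => [|i r IH].
  by under eq_cvg do rewrite big_nil; exact: cvg_cst.
under eq_cvg do rewrite big_cons.
have /andP[ai bi] := ab i.
have H (c : R) : 0 < c -> flat 1 (k.+1%:R * c) @[k --> \oo] --> (1 : R) by exact: flat1_cvg.
have -> : true%:R = (1 * 1) * true%:R :> R by rewrite !mul1r.
by apply: cvgM => //; apply: cvgM; apply: H; rewrite subr_gt0.
Qed.

Lemma test_function_continuous phi : test_function phi -> continuous phi.
Proof. by case=> _ /(_ [::]). Qed.

Lemma continuous_addr v : continuous (fun x => x + v).
Proof.
by move=> x; apply: (@cvgD R 'rV[R]_n _ (nbhs x) _ (fun y => y) (cst v) x v);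
  [exact: cvg_id|exact: cvg_cst].
Qed.

Lemma test_function_shift phi v :
  test_function phi -> test_function (fun x => phi (x + v)).
Proof.
move=> [dphi cphi Kphi].
have E l : iter_partial l (fun x => phi (x + v)) = fun x => iter_partial l phi (x + v).
  elim: l => // i l IH /=; rewrite -/(iter_partial _ _) IH; apply/funext => x.
  rewrite /derive; set g1 := fun h => h^-1 *: _; set g2 := fun h => h^-1 *: _.
  suff -> : g1 = g2 by [].
  by apply/funext => h; rewrite /g1 /g2 /= addrA.
split.
- move=> l i x; rewrite E; have := dphi l i (x + v).
  rewrite /derivable; set g1 := fun h => h^-1 *: _; set g2 := fun h => h^-1 *: _.
  suff -> : g1 = g2 by [].
  by apply/funext => h; rewrite /g1 /g2 /= addrA.
- move=> l x; rewrite E.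
  apply: (@cvg_comp _ _ _ (fun y => y + v) (iter_partial l phi) _ (nbhs (x + v))); last exact: cphi.
  exact: continuous_addr.
- have cK : compact [set y - v | y in closure [set x | phi x != 0]].
    apply: continuous_compact => //; apply: continuous_subspaceT => x.
    exact: continuous_addr.
  apply: (subclosed_compact _ cK); first exact: closed_closure.
  rewrite [X in _ `<=` X](closure_id _).1; last exact: compact_closed.
  apply: closure_subset => x /= phix; exists (x + v); last by rewrite addrK.
  exact: subset_closure.
Qed.

End smooth_functions.

(** * The power kernel around the origin *)

Section kernel_integral.
Context {R : realType}.
Local Notation leb := (@lebesgue_measure R).
Local Open Scope ereal_scope.

Lemma integral_powR_itv (al a b : R) : (0 < al)%R -> (0 < a)%R -> (a < b)%R ->
  \int[leb]_(h in `[a, b]) (`|h| `^ (al - 1))%:E = (al^-1 * (b `^ al - a `^ al))%:E.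
Proof.
move=> al0 a0 ab.
have pos (h : R) : h \in `[a, b] -> (0 < h)%R.
  by rewrite in_itv/= => /andP[ah _]; exact: lt_le_trans ah.
have dF (h : R) : (0 < h)%R -> is_derive h (1%R : R) (fun h : R => al^-1 * h `^ al)%R (h `^ (al - 1))%R.
  move=> h0; have -> : (h `^ (al - 1) = al^-1 *: (al * h `^ (al - 1)))%R.
    by rewrite /GRing.scale/= mulKf// gt_eqF.
  exact: (@is_deriveZ _ _ _ (fun h => (h `^ al)%R) al^-1%R h 1%R _ (is_derive1_powR al h0)).
have cF (h : R) : (0 < h)%R -> {for h, continuous (fun h : R => al^-1 * h `^ al)%R}.
  move=> /dF dFh; apply/differentiable_continuous/derivable1_diffP.
  exact: (@ex_derive _ _ _ _ _ _ _ dFh).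
under eq_integral => h.
  by rewrite inE/= => /pos h0; rewrite ger0_norm ?(ltW h0)//; over.
rewrite (@continuous_FTC2 _ (fun h => (h `^ (al - 1))%R) (fun h => al^-1 * h `^ al)%R)//.
- by rewrite -EFinB mulrBr.
- apply: derivable_within_continuous => h /pos h0.
  exact: (@ex_derive _ _ _ _ _ _ _ (is_derive1_powR _ h0)).
- split.
  + by move=> h /subset_itv_oo_cc/pos /dF dFh; exact: (@ex_derive _ _ _ _ _ _ _ dFh).
  + by apply: cvg_at_right_filter; apply: cF.
  + by apply: cvg_at_left_filter; apply: cF; exact: lt_trans ab.
- move=> h /subset_itv_oo_cc/pos /dF dFh; rewrite derive1E.
  exact: derive_val.
Qed.

Lemma derivable_powR_abs (be h : R) : (h < 0)%R ->
  derivable (fun t : R => `|t| `^ be)%R h 1%R.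
Proof.
move=> h0; have h0' : (0 < - h)%R by rewrite oppr_gt0.
have dN : is_derive h (1%R : R) (-%R : R -> R) (- 1)%R by exact: is_deriveNid.
have := is_derive1_comp (is_derive1_powR be h0') dN.
move=> /(@ex_derive _ _ _ _ _ _ _); apply: near_eq_derivable.
near=> t; rewrite /= ltr0_norm//; near: t; exact: lt_nbhsl.
Unshelve. all: by end_near. Qed.

Lemma measurable_powR_abs (be : R) :
  measurable_fun setT (fun h : R => (`|h| `^ be)%:E : \bar R).
Proof.
by apply/measurable_EFinP; exact: measurable_fun_powR_norm.
Qed.

Lemma measurable_norm_le_setD (d : R) :
  measurable ([set h : R | (`|h| <= d)%R] `\ (0 : R)%R).
Proof. by apply: measurableD => //; exact: measurable_norm_le. Qed.

Lemma integral_ball_setD1 (f : R -> \bar R) (d : R) : measurable_fun setT f ->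
  \int[leb]_(h in [set h : R | (`|h| <= d)%R]) f h =
  \int[leb]_(h in [set h : R | (`|h| <= d)%R] `\ (0 : R)%R) f h.
Proof.
move=> mf; apply/esym/integral_setD1; first exact: measurable_norm_le_setD.
by apply: measurable_funTS; exact: mf.
Qed.

(** The kernel may be singular at 0, so the fundamental theorem is used on a <= |h| <= d and
    monotone convergence lets a tend to 0. For al = p (1 - s) this is the origin of the constant
    2/(p(1-s)) in [J0]. *)
Lemma integral_powR_ball (al d : R) : (0 < al)%R -> (0 < d)%R ->
  \int[leb]_(h in [set h : R | (`|h| <= d)%R]) (`|h| `^ (al - 1))%:E =
  (2 / al * d `^ al)%:E.
Proof.
move=> al0 d0.
rewrite (integral_ball_setD1 d (measurable_powR_abs (al - 1))).
(* With [k.+2] the inner radius is strictly below [d] already for k = 0. *)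
pose a k : R := (d / k.+2%:R)%R.
have a0 k : (0 < a k)%R by rewrite divr_gt0.
have ad k : (a k < d)%R by rewrite ltr_pdivrMr// ltr_pMr// ltr1n.
pose F k : set R := [set` `[(- d)%R, (- a k)%R]] `|` [set` `[a k, d]].
have mF k : measurable (F k) by apply: measurableU.
have F0 k (h : R) : F k h -> 0 <= (`|h| `^ (al - 1))%:E.
  by move=> _; rewrite lee_fin powR_ge0.
have FE : [set h : R | (`|h| <= d)%R] `\ (0 : R)%R = \bigcup_k F k.
  apply/seteqP; split=> h.
    move=> [/= hd /eqP h0].
    have h0' : (0 < `|h|)%R by rewrite normr_gt0.
    have [k hk] : exists k, (a k <= `|h|)%R.
      exists (Num.truncn (d / `|h|)); rewrite ler_pdivrMr// mulrC -ler_pdivrMr//.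
      apply: ltW; apply: lt_le_trans (truncnS_gt _) _; by rewrite ler_nat.
    exists k => //; rewrite /F /=; move: hd hk; rewrite !in_itv/=; have [h1|h1] := leP 0%R h => hd hk.
      by move: hd hk; rewrite (ger0_norm h1) => hd hk; right; apply/andP.
    move: hd hk; rewrite (ltr0_norm h1) => hd hk; left; apply/andP; split; lra.
  move=> [k _]; rewrite /F /= !in_itv/= => H.
  have := a0 k; have := ad k; split => /=.
    by rewrite ler_norml; case: H => /andP[? ?]; apply/andP; split; lra.
  by move=> h0; case: H => /andP[? ?]; lra.
have ndF : nondecreasing_seq F.
  move=> k l kl; apply/subsetPset => h.
  have : (a l <= a k)%R by rewrite ler_pM2l// lef_pV2 ?posrE// ler_nat !ltnS.
  rewrite /F /= !in_itv/= => alk [/andP[? ?]|/andP[? ?]]; [left|right];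
    apply/andP; split; lra.
have IF k : \int[leb]_(h in F k) (`|h| `^ (al - 1))%:E =
    (2 * (al^-1 * (d `^ al - a k `^ al)))%:E.
  rewrite ge0_integral_setU//=; last 2 first.
  - by apply: measurable_funTS; exact: measurable_powR_abs.
  - apply/disj_setPLR => h /=; rewrite !in_itv/= => /andP[? ?] /andP[? ?].
    have := a0 k; lra.
  rewrite integration_by_substitution_oppr ?(ltW (ad k))//; last first.
    apply: derivable_within_continuous => h; rewrite in_itv/= => /andP[_ hk].
    have h0 : (h < 0)%R by apply: le_lt_trans hk _; rewrite oppr_lt0.
    exact: derivable_powR_abs.
  rewrite (_ : \int[leb]_(x in `[a k, d]) _ = \int[leb]_(h in `[a k, d]) (`|h| `^ (al - 1))%:E).
    by rewrite integral_powR_itv// -EFinD mulrDl mul1r.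
  by apply: eq_integral => h _ /=; rewrite normrN.
have mfF k : measurable_fun (F k) (fun h : R => (`|h| `^ (al - 1))%:E : \bar R).
  by apply: measurable_funTS; exact: measurable_powR_abs.
have C1 : \int[leb]_(h in F k) (`|h| `^ (al - 1))%:E @[k --> \oo] -->
    \int[leb]_(h in \bigcup_k F k) (`|h| `^ (al - 1))%:E.
  by apply: ge0_nondecreasing_set_cvg_integral => // k; exact: mfF.
rewrite FE; apply: (cvg_unique _ C1) => //.
rewrite /=; under eq_cvg do rewrite IF.
apply: cvg_EFin; first exact: nearW.
rewrite (_ : 2 / al * d `^ al = 2 * (al^-1 * (d `^ al - 0)))%R; last by rewrite subr0 mulrA.
apply: cvgM; first exact: cvg_cst.
apply: cvgM; first exact: cvg_cst.
apply: cvgB; first exact: cvg_cst.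
have alim : a k @[k --> \oo] --> (0 : R)%R.
  rewrite -(mulr0 d); apply: cvgM; first exact: cvg_cst.
  by have := @cvg_harmonic R; rewrite -(cvg_shiftS (@GRing.inv R \o (fun k => k.+1%:R)%R)).
have := cvg_comp _ _ alim (continuous_norm_powR al0 (x := 0%R)).
rewrite normr0 powR0 ?gt_eqF//; apply: cvg_trans; apply: near_eq_cvg.
by apply: nearW => k /=; rewrite gtr0_norm.
Unshelve. all: by end_near. Qed.

End kernel_integral.

Section dint_gagliardo.
Context {R : realType} {n : nat}.
Local Notation leb := (@lebesgue_measure R).
Local Open Scope ereal_scope.
Implicit Types (i : 'I_n) (s p d c : R) (u : 'rV[R]_n -> R).

Lemma gkernel_powR s p (h : R) c : (0 < `|h|)%R ->
  ((`|h| `^ p * c) * `|h| `^ (- (1 + s * p)) = c * `|h| `^ (p * (1 - s) - 1))%R.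
Proof.
move=> h0; rewrite mulrAC -powRD; last by apply/implyP => _; rewrite gt_eqF.
by rewrite mulrC; congr (_ * _ `^ _)%R; ring.
Qed.

Lemma gagliardo_le_dint i s p d u c : (1 < p)%R -> (0 < s < 1)%R -> (0 < d)%R ->
  (0 <= c)%R -> measurable_fun setT u ->
  (forall h, dint i p u h <= (`|h| `^ p * c)%:E) ->
  gagliardo i s p d u <= (c * (2 / (p * (1 - s)) * d `^ (p * (1 - s))))%:E.
Proof.
move=> p1 /andP[s0 s1] d0 c0 mu_ H.
have al0 : (0 < p * (1 - s))%R by rewrite mulr_gt0 ?subr_gt0// (lt_trans ltr01).
have mK := measurable_powR_abs (p * (1 - s) - 1).
have mG := measurable_gkernel i s p mu_.
have mD := measurable_norm_le_setD d.
have K0 (h : R) : 0 <= (`|h| `^ (p * (1 - s) - 1))%:E by rewrite lee_fin powR_ge0.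
rewrite gagliardoE// EFinM -integral_powR_ball//.
rewrite (integral_ball_setD1 d mG) (integral_ball_setD1 d mK).
rewrite -(ge0_integralZl_leb mD mK K0 c0).
apply: (ge0_le_integral_leb mD mG (measurable_funeM c%:E mK)).
- by move=> h _; exact: gkernel_ge0.
- move=> h [_ /eqP h0]; rewrite /gkernel -EFinM -(@gkernel_powR s p) ?normr_gt0// EFinM.
  by apply: lee_wpmul2r; rewrite ?lee_fin ?powR_ge0.
Qed.

(** If every increment were worse than the average, integration would contradict the strict bound.
    The origin is a null set and is left out, as [h] will serve as a divisor. *)
Lemma exists_dint_le i s p d u c : (1 < p)%R -> (0 < s < 1)%R -> (0 < d)%R ->
  (0 <= c)%R -> measurable_fun setT u ->
  gagliardo i s p d u < (c * (2 / (p * (1 - s)) * d `^ (p * (1 - s))))%:E ->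
  exists h : R, [/\ h != 0%R, (`|h| <= d)%R & dint i p u h <= (`|h| `^ p * c)%:E].
Proof.
move=> p1 /andP[s0 s1] d0 c0 mu_; apply: contraPP => /forallNP H; apply/negP.
have al0 : (0 < p * (1 - s))%R by rewrite mulr_gt0 ?subr_gt0// (lt_trans ltr01).
have mK := measurable_powR_abs (p * (1 - s) - 1).
have mG := measurable_gkernel i s p mu_.
have mD := measurable_norm_le_setD d.
have K0 (h : R) : 0 <= (`|h| `^ (p * (1 - s) - 1))%:E by rewrite lee_fin powR_ge0.
rewrite -leNgt gagliardoE// EFinM -integral_powR_ball//.
rewrite (integral_ball_setD1 d mG) (integral_ball_setD1 d mK).
rewrite -(ge0_integralZl_leb mD mK K0 c0).
apply: (ge0_le_integral_leb mD (measurable_funeM c%:E mK) mG).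
- by move=> h _; rewrite mule_ge0.
- move=> h [/= hd /eqP h0]; rewrite /gkernel -EFinM -(@gkernel_powR s p) ?normr_gt0// EFinM.
  apply: lee_wpmul2r; first by rewrite lee_fin powR_ge0.
  rewrite leNgt; apply/negP => hd'; apply: (H h); split => //.
  exact: ltW.
Qed.

End dint_gagliardo.

(** * Test functions, and the functions orthogonal to all of them *)

Section test_functions.
Context {R : realType} {n : nat}.
Local Notation mu := (@lebesgue_rV R n).
Local Notation "''e_' i" := (delta_mx 0%R i : 'rV[R]_n)
  (at level 8, i at level 2).
Implicit Types (i : 'I_n) (w v g phi : 'rV[R]_n -> R).
Local Open Scope ereal_scope.

Lemma continuous_measurable_rV phi : continuous phi -> measurable_fun setT phi.
Proof.
move=> /continuousP cphi.
apply: (measurability _ (RGenOpens.measurableE R)) => _ [_ [a [b ->]] <-].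
by rewrite setTI; apply: measurable_open_rV; apply: cphi; exact: interval_open.
Qed.

Definition tsupport phi := closure [set x | phi x != 0%R].

Lemma tsupport_derive phi i :
  tsupport (fun x => 'D_('e_i) phi x) `<=` tsupport phi.
Proof.
rewrite [X in _ `<=` X](closure_id _).1; last exact: closed_closure.
apply: closure_subset => x /= Dx; apply: contrapT => xK; move/eqP: Dx; apply.
have nx : \near x, cst (0 : R)%R x = phi x.
  have : nbhs x (~` tsupport phi).
    by apply: open_nbhs_nbhs; split => //; exact/closed_openC/closed_closure.
  apply: filterS => y yK; apply/eqP; rewrite eq_sym; apply/negPn/negP => y0.
  by apply: yK; apply: subset_closure.
by rewrite -(near_eq_derive _ nx) derive_cst.
Qed.

Lemma test_function_derive phi i : test_function phi ->
  test_function (fun x => 'D_('e_i) phi x).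
Proof.
move=> [dphi cphi Kphi].
have E l : iter_partial l (fun x => 'D_('e_i) phi x) = iter_partial (rcons l i) phi.
  by rewrite /iter_partial foldr_rcons.
split.
- by move=> l; rewrite E.
- by move=> l; rewrite E.
- apply: (subclosed_compact _ Kphi); first exact: closed_closure.
  exact: tsupport_derive.
Qed.

Lemma test_function_bounded phi : test_function phi ->
  exists2 M : R, (0 <= M)%R & forall x, (`|phi x| <= M)%R.
Proof.
move=> tphi; have [_ _ Kphi] := tphi.
have cphi := test_function_continuous tphi.
have : compact [set phi x | x in closure [set x | phi x != 0%R]].
  by apply: continuous_compact => //; exact: continuous_subspaceT.
move=> /compact_bounded[M [_ HM]]; exists (`|M| + 1)%R; first by rewrite addr_ge0.
move=> x; have [->|x0] := eqVneq (phi x) 0%R; first by rewrite normr0 addr_ge0.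
apply: HM; first by rewrite (le_lt_trans (ler_norm M))// ltrDl.
by exists x => //; exact: subset_closure.
Qed.

Lemma tsupportP phi x : ~ tsupport phi x -> phi x = 0%R.
Proof. by apply: contra_notP => /eqP x0; exact: subset_closure. Qed.

Lemma measurable_tsupport phi : measurable (tsupport phi).
Proof.
rewrite -[tsupport phi]setCK; apply: measurableC; apply: measurable_open_rV.
exact/closed_openC/closed_closure.
Qed.

Lemma tsupport_lty phi : test_function phi -> mu (tsupport phi) < +oo.
Proof.
move=> [_ _ /compact_bounded[M [_ HM]]].
have H : tsupport phi `<=` obox (fun=> - (`|M| + 2))%R (fun=> `|M| + 2)%R.
  move=> x Kx i; rewrite -ltr_norml.
  have M1 : (M < `|M| + 1)%R by rewrite (le_lt_trans (ler_norm M))// ltrDl.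
  apply: (@le_lt_trans _ _ (`|M| + 1)%R); last by rewrite ltrD2l; lra.
  by apply: le_trans (HM _ M1 x Kx); rewrite /Num.norm/= mx_normrE; apply: (le_bigmax _ _ (ord0, i)).
apply: le_lt_trans (obox_lty (fun=> - (`|M| + 2))%R (fun=> `|M| + 2)%R).
by apply: le_measure; rewrite ?inE//; [exact: measurable_tsupport|exact: measurable_obox].
Qed.

Lemma test_function_Lp (q : R) phi : (0 < q)%R -> test_function phi -> Lp mu q phi.
Proof.
move=> q0 tphi; have mphi := continuous_measurable_rV (test_function_continuous tphi).
have [M M0 HM] := test_function_bounded tphi; split => //.
apply: (@le_lt_trans _ _ (\int[mu]_x ((M `^ q)%:E * (\1_(tsupport phi) x)%:E))).
  apply: ge0_le_integralT.
  - exact: measurable_powR_normE.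
  - by apply: measurable_funeM; apply/measurable_EFinP; apply: measurable_indic; exact: measurable_tsupport.
  - by move=> x; rewrite lee_fin powR_ge0.
  - move=> x; rewrite -EFinM lee_fin indicE; have [_|] := boolP (x \in tsupport phi).
      by rewrite mulr1; apply: ler_powRl => //; exact: ltW.
    by rewrite notin_setE => /tsupportP ->; rewrite normr0 powR0 ?gt_eqF// mulr0.
rewrite ge0_integralZlT ?powR_ge0//; last first.
  by apply/measurable_EFinP; apply: measurable_indic; exact: measurable_tsupport.
rewrite integral_indic ?setIT//; last exact: measurable_tsupport.
by rewrite lte_mul_pinfty// ?lee_fin ?powR_ge0// tsupport_lty.
Qed.

Section fundamental.
Variable w : 'rV[R]_n -> R.
Hypothesis mw : measurable_fun setT w.
Hypothesis iw : forall a b, mu.-integrable (obox a b) (EFin \o w).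
Hypothesis w0 : forall phi, test_function phi -> \int[mu]_x (w x * phi x)%:E = 0.

Let mE : measurable_fun setT (EFin \o w).
Proof. exact/measurable_EFinP. Qed.

(** Bumps are test functions, and dominated convergence replaces them by the indicator of the
    box. *)
Lemma integral_obox0 a b : \int[mu]_(x in obox a b) (w x)%:E = 0.
Proof.
have iab : mu.-integrable setT ((EFin \o w) \_ (obox a b)).
  exact: (integrable_mkcond _ (measurable_obox a b)).1 (iw a b).
rewrite integral_mkcond.
have /cvg_lim <- // : \int[mu]_x (w x * bump a b k x)%:E @[k --> \oo] -->
    \int[mu]_x ((EFin \o w) \_ (obox a b)) x.
  apply: (@dominated_cvg _ _ _ mu setT measurableT _ _
      (fun x => `|((EFin \o w) \_ (obox a b)) x|)).
  - move=> k; apply/measurable_EFinP; apply: measurable_funM => //.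
    apply: continuous_measurable_rV; apply: test_function_continuous.
    exact: bump_test_function.
  - move=> x _.
    have H : (w x * bump a b k x)%R @[k --> \oo] --> (w x * \1_(obox a b) x)%R.
      by apply: cvgM; [exact: cvg_cst|exact: bump_cvg].
    rewrite (_ : ((EFin \o w) \_ (obox a b)) x = (w x * \1_(obox a b) x)%:E).
      by apply: cvg_EFin; [exact: nearW|].
    by rewrite patchE indicE; case: ifPn => xab; rewrite ?mulr1 ?mulr0.
  - by move=> x _; rewrite patchE; case: ifP.
  - exact: integrable_abse.
  - move=> k x _; rewrite patchE; case: ifPn => xab.
      rewrite /= lee_fin normrM (ger0_norm (bump_ge0 _ _ _ _)) ler_piMr//.
      exact: bump_le1.
    rewrite (_ : bump a b k x = 0%R) ?mulr0 ?normr0 ?abse0//.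
    apply/eqP; rewrite -[_ == _]negbK bump_neq0; apply/asboolPn.
    by move: xab; rewrite notin_setE.
rewrite (_ : (fun k => _) = cst 0); first exact: lim_cst.
by apply/funext => k; rewrite w0//; exact: bump_test_function.
Qed.

Let density (f : 'rV[R]_n -> \bar R) (mf : measurable_fun setT f)
  (f0 : forall x, 0 <= f x) :
  exists m : {measure set 'rV[R]_n -> \bar R}, forall A, m A = \int[mu]_(x in A) f x.
Proof.
pose m0 := integral_set0 mu f.
have mge0 A : 0 <= \int[mu]_(x in A) f x by apply: integral_ge0.
pose mm := isMeasure.Build _ _ _ (fun A => \int[mu]_(x in A) f x) m0 mge0
  (semi_sigma_additive_nng_induced mf f0).
pose m : {measure set 'rV[R]_n -> \bar R} := HB.pack (fun A => \int[mu]_(x in A) f x) mm.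
by exists m.
Qed.

Let wpos := (EFin \o w)^\+.
Let wneg := (EFin \o w)^\-.

(** The two parts are densities of measures that agree, and are finite, on boxes. *)
Let integral_pos_neg A : measurable A ->
  \int[mu]_(x in A) wpos x = \int[mu]_(x in A) wneg x.
Proof.
move=> mA.
have [m1 m1E] := density (measurable_funepos mE) (funepos_ge0 _).
have [m2 m2E] := density (measurable_funeneg mE) (funeneg_ge0 _).
rewrite -m1E -m2E; apply: obox_measure_unique => // a b; last first.
  rewrite m1E -ge0_fin_numE; last by apply: integral_ge0 => x _; exact: funepos_ge0.
  exact: (integrable_pos_fin_num (measurable_obox a b) (iw a b)).
rewrite m1E m2E; have := integral_obox0 a b; rewrite integralE.
have fpos : \int[mu]_(x in obox a b) wpos x \is a fin_num.
  exact: (integrable_pos_fin_num (measurable_obox a b) (iw a b)).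
have fneg : \int[mu]_(x in obox a b) wneg x \is a fin_num.
  exact: (integrable_neg_fin_num (measurable_obox a b) (iw a b)).
rewrite -(fineK fpos) -(fineK fneg) -EFinB => -[/eqP]; rewrite subr_eq0 => /eqP ->.
by [].
Qed.

(** Where [w] is positive its negative part vanishes, so the positive part has zero integral there;
    symmetrically where [w] is negative. *)
Lemma fundamental_lemma : {ae mu, forall x, w x = 0%R}.
Proof.
pose A := [set x | 0 < w x]%R; pose B := [set x | w x < 0]%R.
have mA : measurable A.
  rewrite /A; have := mw measurableT (measurable_itv `]0%R, +oo[).
  by rewrite setTI; congr measurable; apply/seteqP; split => x /=; rewrite in_itv/= andbT.
have mB : measurable B.
  rewrite /B; have := mw measurableT (measurable_itv `]-oo, 0%R[).
  by rewrite setTI; congr measurable; apply/seteqP; split => x /=; rewrite in_itv/=.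
have A0 : \int[mu]_(x in A) `|wpos x| = 0.
  rewrite (eq_integral wpos); last by move=> x _; rewrite gee0_abs ?funepos_ge0.
  rewrite integral_pos_neg// integral0_eq// => x /= x0.
  by rewrite /wneg funenegE/= max_r// lee_fin oppr_le0 ltW.
have B0 : \int[mu]_(x in B) `|wneg x| = 0.
  rewrite (eq_integral wneg); last by move=> x _; rewrite gee0_abs ?funeneg_ge0.
  rewrite -integral_pos_neg// integral0_eq// => x /= x0.
  by rewrite /wpos funeposE/= max_r// lee_fin ltW.
have mp : measurable_fun A wpos by apply: measurable_funTS; exact: measurable_funepos.
have mn : measurable_fun B wneg by apply: measurable_funTS; exact: measurable_funeneg.
have := (ae_eq_integral_abs mu mA mp).1 A0; have := (ae_eq_integral_abs mu mB mn).1 B0.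
apply: filterS2 => x HB HA; apply/eqP; rewrite eq_le !leNgt; apply/andP; split; apply/negP => x0.
- have := HA x0; rewrite /wpos funeposE/= max_l ?lee_fin ?(ltW x0)// => -[wx].
  by rewrite wx ltxx in x0.
- have := HB x0; rewrite /wneg funenegE/= max_l; last by rewrite lee_fin oppr_ge0 ltW.
  by move=> [/eqP]; rewrite oppr_eq0 lt_eqF.
Qed.

End fundamental.

End test_functions.

(** * Difference quotients and weak derivatives *)

Section weak_derivative.
Context {R : realType} {n : nat}.
Local Notation mu := (@lebesgue_rV R n).
Local Notation "''e_' i" := (delta_mx 0%R i : 'rV[R]_n)
  (at level 8, i at level 2).
Implicit Types (i : 'I_n) (w v g phi : 'rV[R]_n -> R) (y : 'rV[R]_n).
Local Open Scope ereal_scope.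

Lemma derive_shift phi y (e : 'rV[R]_n) x :
  'D_e (fun x => phi (x + y)%R) x = 'D_e phi (x + y)%R.
Proof.
rewrite /derive; set g1 := fun h => h^-1 *: _; set g2 := fun h => h^-1 *: _.
suff -> : g1 = g2 by [].
by apply/funext => h; rewrite /g1 /g2 /= addrA.
Qed.

Lemma is_derive_along phi i x (t : R) : test_function phi ->
  is_derive t (1%R : R) (fun t => phi (x + t *: 'e_i)%R) ('D_('e_i) phi (x + t *: 'e_i)%R).
Proof.
move=> [dphi _ _]; have := dphi [::] i (x + t *: 'e_i)%R => /=.
have E : (fun h : R => h^-1 *: (((fun t : R => phi (x + t *: 'e_i)) \o shift t) (h *: 1) -
    phi (x + t *: 'e_i)))%R =
  (fun h : R => h^-1 *: ((phi \o shift (x + t *: 'e_i)) (h *: 'e_i) - phi (x + t *: 'e_i)))%R.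
  apply/funext => h; congr (_ *: _)%R; congr (phi _ - _)%R => /=.
  by rewrite [(h *: 1)%R]mulr1 scalerDl addrCA.
by move=> d; split; rewrite /derivable /derive E.
Qed.

Lemma test_function_mvt phi i x (h : R) : test_function phi ->
  exists2 t : R, (`|t| <= `|h|)%R &
    (phi (x + h *: 'e_i) - phi x = h * 'D_('e_i) phi (x + t *: 'e_i))%R.
Proof.
move=> tphi; pose f t := phi (x + t *: 'e_i)%R; pose f' t := 'D_('e_i) phi (x + t *: 'e_i)%R.
have df (t : R) : is_derive t (1%R : R) f (f' t) by exact: is_derive_along.
have cf : continuous f.
  move=> t; apply/differentiable_continuous/derivable1_diffP.
  exact: (@ex_derive _ _ _ _ _ _ _ (df t)).
have f0 : phi x = f 0%R by rewrite /f scale0r addr0.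
rewrite f0 -/(f h); have [h0|h0|->] := ltgtP h 0%R.
- have [|c] := @MVT _ f f' h 0%R h0 (fun t _ => df t).
  + exact: continuous_subspaceT.
  rewrite in_itv/= => /andP[hc c0] E; exists c.
    by rewrite !ltr0_norm// lerN2 ltW.
  by rewrite -opprB E sub0r mulrN opprK mulrC.
- have [|c] := @MVT _ f f' 0%R h h0 (fun t _ => df t).
  + exact: continuous_subspaceT.
  rewrite in_itv/= => /andP[c0 hc] E; exists c.
    by rewrite !gtr0_norm// ltW.
  by rewrite E subr0 mulrC.
- by exists 0%R => //; rewrite subrr mul0r.
Qed.

Lemma test_function_taylor phi i x (h M : R) : test_function phi ->
  (forall x, `|'D_('e_i) (fun x => 'D_('e_i) phi x) x| <= M)%R ->
  (`|phi (x + h *: 'e_i) - phi x - h * 'D_('e_i) phi x| <= M * h ^+ 2)%R.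
Proof.
move=> tphi HM; have [t th ->] := test_function_mvt i x h tphi.
have [t' _ E] := test_function_mvt i x t (test_function_derive i tphi).
rewrite -mulrBr E mulrA normrM mulrC ler_pM//.
rewrite normrM -(ger0_norm (sqr_ge0 h)) expr2 [in leRHS]normrM.
by rewrite ler_wpM2l.
Qed.

Lemma tsupport_shift phi y :
  tsupport (fun x => phi (x + y)%R) `<=` [set x | tsupport phi (x + y)%R].
Proof.
have cl : closed [set x | tsupport phi (x + y)%R].
  apply: (@preimage_closed 'rV[R]_n 'rV[R]_n (fun x => x + y)%R (tsupport phi)) => [x _|];
    last exact: closed_closure.
  exact: continuous_addr.
rewrite [X in _ `<=` X](closure_id _).1//.
by apply: closure_subset => x /= x0; exact: subset_closure.
Qed.

Lemma measurable_tsupport_shift phi y : measurable [set x | tsupport phi (x + y)%R].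
Proof.
rewrite -[X in measurable X]setTI.
by apply: (measurable_translation y) => //; exact: measurable_tsupport.
Qed.

Lemma measure_tsupport_shift phi y :
  mu [set x | tsupport phi (x + y)%R] = mu (tsupport phi).
Proof. exact: (lebesgue_rV_translation y (measurable_tsupport phi)). Qed.

Section exponent.
Variables (p q : R).
Hypothesis p1 : (1 < p)%R.
Hypothesis qE : q = (p / (p - 1))%R.

Let p0 : (0 < p)%R. Proof. exact: lt_trans ltr01 p1. Qed.
Let q0 : (0 < q)%R. Proof. by rewrite qE divr_gt0// subr_gt0. Qed.
Let q1 : (1 <= q)%R.
Proof. by rewrite qE ler_pdivlMr ?subr_gt0// mul1r gerBl. Qed.

Local Notation I := (pairing mu).
Local Notation Np := (np mu p).
Local Notation L := (Lp mu p).

Lemma Lp_shift (r : R) w y : Lp mu r w -> Lp mu r (fun x => w (x + y)%R).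
Proof.
move=> [mw iw]; split; first exact: measurable_shift.
rewrite (@ge0_integral_translation _ _ y (fun x => (`|w x| `^ r)%:E))//.
exact: measurable_powR_normE.
Qed.

Lemma np_shift w y : measurable_fun setT w -> Np (fun x => w (x + y)%R) = Np w.
Proof.
move=> mw; rewrite /np (@ge0_integral_translation _ _ y (fun x => (`|w x| `^ p)%:E))//.
exact: measurable_powR_normE.
Qed.

Lemma pairing_shift w phi y : measurable_fun setT w -> measurable_fun setT phi ->
  I (fun x => w (x + y)%R) phi = I w (fun x => phi (x - y)%R).
Proof.
move=> mw mphi; rewrite /pairing /Rintegral.
rewrite -(@integral_translation _ _ y (fun x => (w x * phi (x - y)%R)%:E)).
  by under [in RHS]eq_integral do rewrite addrK.
by apply/measurable_EFinP; apply: measurable_funM => //; exact: measurable_shift.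
Qed.

Lemma pairing_addl w v phi : L w -> L v -> Lp mu q phi ->
  I (fun x => w x + v x)%R phi = (I w phi + I v phi)%R.
Proof.
move=> Lw L1 L2; rewrite /pairing -RintegralD//; [|exact: (Lp_mul_integrable p1 qE)..].
by apply: eq_Rintegral => x _; rewrite mulrDl.
Qed.

Lemma pairing_subr w phi psi : L w -> Lp mu q phi -> Lp mu q psi ->
  I w (fun x => phi x - psi x)%R = (I w phi - I w psi)%R.
Proof.
move=> Lw L1 L2; rewrite /pairing -RintegralB//; [|exact: (Lp_mul_integrable p1 qE)..].
by apply: eq_Rintegral => x _; rewrite mulrBr.
Qed.

Lemma pairing_scalel w phi (k : R) : L w -> Lp mu q phi ->
  I (fun x => k * w x)%R phi = (k * I w phi)%R.
Proof.
move=> Lw Lphi; rewrite /pairing -RintegralZl//; last exact: (Lp_mul_integrable p1 qE).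
by apply: eq_Rintegral => x _; rewrite mulrA.
Qed.

Lemma pairing_scaler w phi (k : R) : L w -> Lp mu q phi ->
  I w (fun x => k * phi x)%R = (k * I w phi)%R.
Proof.
move=> Lw Lphi; rewrite /pairing -RintegralZl//; last exact: (Lp_mul_integrable p1 qE).
by apply: eq_Rintegral => x _; rewrite mulrCA.
Qed.

Lemma np_add_le w v : L w -> L v ->
  (Np (fun x => w x + v x) <= 2 `^ p / 2 * (Np w + Np v))%R.
Proof.
move=> Lw Lv; have Ls := Lp_add (ltW p1) Lw Lv.
have Mw := measurable_powR_normE p Lw.1; have Mv := measurable_powR_normE p Lv.1.
have P0 (u : 'rV[R]_n -> R) x : 0 <= (`|u x| `^ p)%:E by rewrite lee_fin powR_ge0.
have c0 : (0 <= 2 `^ p / 2 :> R)%R by rewrite divr_ge0// powR_ge0.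
rewrite -lee_fin EFinM EFinD -(npE Ls) -(npE Lw) -(npE Lv) -(ge0_integralDT _ Mw Mv (P0 _) (P0 _)).
have MD : measurable_fun setT (fun x => (`|w x| `^ p)%:E + (`|v x| `^ p)%:E).
  exact: emeasurable_funD.
have PD x : 0 <= (`|w x| `^ p)%:E + (`|v x| `^ p)%:E by rewrite adde_ge0.
rewrite -(ge0_integralZlT _ MD PD c0).
apply: (ge0_le_integralT _ (measurable_powR_normE p Ls.1) (measurable_funeM _ MD)).
- by move=> x.
- by move=> x; rewrite -EFinD -EFinM lee_fin; apply: powR_normD_le; exact: ltW.
Qed.

Lemma np_scale (k : R) w : L w -> Np (fun x => k * w x)%R = (`|k| `^ p * Np w)%R.
Proof.
move=> Lw; apply: EFin_inj; rewrite EFinM -(npE Lw) -(npE (Lp_scale k Lw)).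
rewrite -ge0_integralZlT ?powR_ge0//; last exact: (measurable_powR_normE p Lw.1).
by apply: eq_integral => x _; rewrite normrM powRM.
Qed.

(** Uses |v| <= |v|^p + 1 on [S]: cruder than Hoelder, but linear in the p-th power of the norm. *)
Lemma pairing_bounded_le v phi (S : set 'rV[R]_n) (c m : R) : (0 <= c)%R ->
  measurable S -> mu S <= m%:E -> L v -> Lp mu q phi ->
  (forall x, `|phi x| <= c)%R -> (forall x, ~ S x -> phi x = 0%R) ->
  (`|I v phi| <= c * (Np v + m))%R.
Proof.
move=> c0 mS Sm Lv Lphi phic phiS.
have iv := Lp_mul_integrable p1 qE Lv Lphi.
rewrite -lee_fin -abse_EFin -(pairingE p1 qE Lv Lphi).
have miv : measurable_fun setT (fun x => (v x * phi x)%:E) by case/integrableP: iv.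
apply: le_trans (le_abse_integral _ measurableT miv) _.
have Mv := measurable_powR_normE p Lv.1.
have MS : measurable_fun setT (fun x : 'rV[R]_n => (\1_S x)%:E : \bar R).
  by apply/measurable_EFinP; exact: measurable_indic.
have P0 (u : 'rV[R]_n -> R) x : 0 <= (`|u x| `^ p)%:E by rewrite lee_fin powR_ge0.
have S0 (x : 'rV[R]_n) : 0 <= (\1_S x)%:E :> \bar R by rewrite lee_fin.
have MD : measurable_fun setT (fun x => (`|v x| `^ p)%:E + (\1_S x)%:E).
  exact: emeasurable_funD.
have PD x : 0 <= (`|v x| `^ p)%:E + (\1_S x)%:E by rewrite adde_ge0.
apply: (@le_trans _ _ (\int[mu]_x (c%:E * ((`|v x| `^ p)%:E + (\1_S x)%:E)))).
  apply: (ge0_le_integralT _ _ (measurable_funeM _ MD)).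
  - exact: measurableT_comp.
  - by move=> x.
  - move=> x; rewrite abse_EFin -EFinD -EFinM lee_fin normrM mulrC.
    rewrite indicE; have [xS|] := boolP (x \in S); last first.
      rewrite notin_setE => /phiS ->; rewrite normr0 mul0r addr0.
      by rewrite mulr_ge0// powR_ge0.
    apply: ler_pM => //.
    have [v1|v1] := leP `|v x|%R 1%R; first by rewrite (le_trans v1)// lerDr powR_ge0.
    rewrite (@le_trans _ _ (`|v x| `^ p)%R)//; last by rewrite lerDl.
    by rewrite -[leLHS]powRr1//; apply: ler_powR; rewrite ltW.
rewrite (ge0_integralZlT _ MD PD c0) (ge0_integralDT _ Mv MS (P0 _) S0).
rewrite (npE Lv) integral_indic// setIT EFinM EFinD.
by apply: lee_wpmul2l; [rewrite lee_fin|exact: leeD2l].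
Qed.

Lemma Lp_integrable_obox w a b : L w -> mu.-integrable (obox a b) (EFin \o w).
Proof.
move=> Lw; have mab := @measurable_obox R n a b.
apply/(integrable_mkcond _ mab).
have LS : Lp mu q (\1_(obox a b) : 'rV[R]_n -> R).
  split; first exact: measurable_indic.
  rewrite (eq_integral (fun x => (\1_(obox a b) x)%:E)).
    by rewrite integral_indic// setIT obox_lty.
  move=> x _; rewrite indicE; case: (x \in _); first by rewrite normr1 powR1.
  by rewrite normr0 powR0// gt_eqF.
have := Lp_mul_integrable p1 qE Lw LS; congr (integrable _ _ _).
apply/funext => x; rewrite patchE indicE; case: ifP => _ /=; first by rewrite mulr1.
by rewrite mulr0.
Qed.

Lemma pairing0_ae w : L w -> (forall phi, test_function phi -> I w phi = 0%R) ->
  {ae mu, forall x, w x = 0%R}.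
Proof.
move=> Lw w0; apply: fundamental_lemma; first exact: Lw.1.
  by move=> a b; exact: Lp_integrable_obox.
move=> phi tphi; rewrite (pairingE p1 qE Lw (test_function_Lp q0 tphi)).
by rewrite w0.
Qed.

Lemma weak_partial_pairing i v g phi : L v -> L g -> is_weak_partial i v g ->
  test_function phi -> I v (fun x => 'D_('e_i) phi x) = (- I g phi)%R.
Proof.
move=> Lv Lg vg tphi; have := vg phi tphi.
rewrite (pairingE p1 qE Lg (test_function_Lp q0 tphi)).
rewrite (pairingE p1 qE Lv (test_function_Lp q0 (test_function_derive i tphi))).
by rewrite -EFinN => -[].
Qed.

Lemma is_weak_partial_pairing i v g : L v -> L g ->
  (forall phi, test_function phi -> I v (fun x => 'D_('e_i) phi x) = (- I g phi)%R) ->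
  is_weak_partial i v g.
Proof.
move=> Lv Lg H phi tphi.
rewrite (pairingE p1 qE Lg (test_function_Lp q0 tphi)).
rewrite (pairingE p1 qE Lv (test_function_Lp q0 (test_function_derive i tphi))).
by rewrite H.
Qed.

Lemma ae_eq_np w v : measurable_fun setT w -> measurable_fun setT v ->
  {ae mu, forall x, w x = v x} -> Np w = Np v.
Proof.
move=> mw mv wv; congr fine; apply: ae_eq_integral => //.
- exact: measurable_powR_normE.
- exact: measurable_powR_normE.
- by apply: filterS wv => x -> _.
Qed.

(** [J0] selects a weak derivative by choice; two of them agree almost everywhere by the fundamental
    lemma, so any one gives the value. *)
Lemma J0E i s v g : L v -> L g -> is_weak_partial i v g ->
  J0 i s p v = (2 / (p * (1 - s)) * Np g)%:E.
Proof.
move=> Lv Lg vg; rewrite /J0.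
set D := [set g | _ /\ _].
have Dg : D g by split => //; exact/(Lp_Lfun _ _ p0).
have Dne : D !=set0 by exists g.
rewrite asboolT//; set g' := xget _ _.
have [Lg' vg'] : D g' by exact: xgetPex.
have {}Lg' : L g' by exact/(Lp_Lfun _ _ p0).
rewrite powR_Lnorm ?gt_eqF// [RHS]EFinM; congr (_ * _).
have E x : `|(EFin \o g') x| `^ p = (`|g' x| `^ p)%:E by [].
under eq_integral do rewrite E.
rewrite (npE Lg'); congr EFin; apply: ae_eq_np; [exact: Lg'.1|exact: Lg.1|].
have Lgg := Lp_sub (ltW p1) Lg' Lg.
have := @pairing0_ae (fun x => g' x - g x)%R Lgg.
move=> H; have {H} : {ae mu, forall x, g' x - g x = 0}%R.
  apply: H => phi tphi; have Lphi := test_function_Lp q0 tphi.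
  rewrite (pairing_sub p1 qE Lg' Lg Lphi).
  have := weak_partial_pairing Lv Lg' vg' tphi.
  by rewrite (weak_partial_pairing Lv Lg vg tphi) => /oppr_inj ->; rewrite subrr.
by apply: filterS => x /eqP; rewrite subr_eq0 => /eqP.
Qed.

(** Moved onto the test function, the increment leaves a Taylor remainder of size M h^2, supported
    in the support of [phi] and its translate; hence the 2m. *)
Lemma pairing_increment_le i v phi (h M m : R) : L v -> test_function phi ->
  (forall x, `|'D_('e_i) (fun x => 'D_('e_i) phi x) x| <= M)%R ->
  mu (tsupport phi) <= m%:E ->
  (`|I (fun x => v (x + h *: 'e_i) - v x) phi + h * I v (fun x => 'D_('e_i) phi x)| <=
    M * h ^+ 2 * (Np v + 2 * m))%R.
Proof.
move=> Lv tphi HM Hm.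
pose dphi x := 'D_('e_i) phi x.
pose phi' x := phi (x - h *: 'e_i)%R.
have tphi' : test_function phi' by exact: test_function_shift.
have Lphi := test_function_Lp q0 tphi; have Lphi' := test_function_Lp q0 tphi'.
have Ldphi : Lp mu q dphi := test_function_Lp q0 (test_function_derive i tphi).
have Lvh := Lp_shift (h *: 'e_i) Lv.
have L1 : Lp mu q (fun x => phi' x - phi x)%R by exact: Lp_sub.
have Ld : Lp mu q (fun x => (- h) * dphi x)%R by exact: Lp_scale.
have L2 : Lp mu q (fun x => phi' x - phi x - (- h) * dphi x)%R by exact: Lp_sub.
have -> : (I (fun x => v (x + h *: 'e_i) - v x) phi + h * I v dphi =
    I v (fun x => phi' x - phi x - (- h) * dphi x))%R.
  rewrite (pairing_subr Lv L1 Ld) (pairing_subr Lv Lphi' Lphi).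
  rewrite (pairing_scaler _ Lv Ldphi) (pairing_sub p1 qE Lvh Lv Lphi).
  by rewrite (pairing_shift _ Lv.1 Lphi.1) mulNr opprK.
have M0 : (0 <= M)%R by exact: le_trans (HM 0%R).
apply: (@pairing_bounded_le _ _
  (tsupport phi `|` [set x | tsupport phi (x + - (h *: 'e_i))%R])) => //.
- by rewrite mulr_ge0// sqr_ge0.
- by apply: measurableU; [exact: measurable_tsupport|exact: measurable_tsupport_shift].
- apply: (@le_trans _ _ (mu (tsupport phi) + mu [set x | tsupport phi (x + - (h *: 'e_i))%R])).
    by apply: measureU2; [exact: measurable_tsupport|exact: measurable_tsupport_shift].
  by rewrite mulrDl mul1r EFinD; apply: leeD => //; rewrite measure_tsupport_shift.
- move=> x; have := test_function_taylor x (- h) tphi HM.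
  by rewrite sqrrN scaleNr.
- move=> x /not_orP[x1 x2]; rewrite /phi' (tsupportP x2) (tsupportP x1).
  have x3 : ~ tsupport dphi x by move=> /tsupport_derive.
  by rewrite (tsupportP x3) mulr0 !subr0.
Qed.

(* Both estimates are additive along the splitting of an increment of length
   [h] into two increments of length [h / 2]. *)
Lemma increment_approx N i v g (h : R) : L v -> L g -> is_weak_partial i v g ->
  exists G, [/\ L G, (Np G <= `|h| `^ p * Np g)%R &
    forall phi (M m : R), test_function phi ->
      (forall x, `|'D_('e_i) (fun x => 'D_('e_i) phi x) x| <= M)%R ->
      mu (tsupport phi) <= m%:E ->
      (`|I G phi - I (fun x => v (x + h *: 'e_i) - v x) phi| <=
        2^-1 ^+ N * (M * h ^+ 2 * (Np v + 2 * m)))%R].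
Proof.
move=> Lv Lg vg; elim: N h => [|N IH] h.
  (* Without splitting, the increment is replaced by its linearization, which has exactly the
     required norm. *)
  exists (fun x => h * g x)%R; split.
  - exact: Lp_scale.
  - by rewrite np_scale.
  - move=> phi M m tphi HM Hm; rewrite expr0 mul1r.
    rewrite (pairing_scalel _ Lg (test_function_Lp q0 tphi)).
    have := pairing_increment_le h Lv tphi HM Hm.
    by rewrite (weak_partial_pairing Lv Lg vg tphi) mulrN distrC.
have [G [LG NG HG]] := IH (h / 2)%R.
pose y : 'rV[R]_n := ((h / 2) *: 'e_i)%R.
have LGy := Lp_shift y LG.
exists (fun x => G (x + y) + G x)%R; split.
- exact: Lp_add (ltW p1) LGy LG.
- apply: le_trans (np_add_le LGy LG) _; rewrite (np_shift y LG.1).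
  (* The factor 2^p is exactly what [|h / 2|^p] loses, so the norm bound persists with its sharp
     constant, while the error, quadratic in the step, is halved. *)
  have -> : (2 `^ p / 2 * (Np G + Np G) = 2 `^ p * Np G)%R by field.
  have h2 : (`|h| = 2 * `|h / 2|)%R by rewrite normrM (gtr0_norm (_ : 0 < 2^-1))%R ?invr_gt0//; field.
  by rewrite h2 powRM// -mulrA ler_wpM2l ?powR_ge0.
- move=> phi M m tphi HM Hm.
  pose phi' x := phi (x - y)%R.
  have tphi' : test_function phi' by exact: test_function_shift.
  have Lphi := test_function_Lp q0 tphi; have Lphi' := test_function_Lp q0 tphi'.
  have Lvy := Lp_shift y Lv.
  pose Dv x := (v (x + y) - v x)%R.
  have LDv : L Dv by exact: Lp_sub (ltW p1) Lvy Lv.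
  have LDvy := Lp_shift y LDv.
  rewrite (pairing_addl LGy LG Lphi) (pairing_shift _ LG.1 Lphi.1).
  have -> : (fun x => v (x + h *: 'e_i) - v x)%R = (fun x => Dv (x + y) + Dv x)%R.
    apply/funext => x; rewrite /Dv [RHS]addrA subrK -addrA /y -scalerDl.
    by rewrite (_ : h / 2 + h / 2 = h)%R//; field.
  rewrite (pairing_addl LDvy LDv Lphi) (pairing_shift _ LDv.1 Lphi.1).
  have H1 := HG phi M m tphi HM Hm.
  have H2 : (`|I G phi' - I Dv phi'| <= 2^-1 ^+ N * (M * (h / 2) ^+ 2 * (Np v + 2 * m)))%R.
    apply: (HG _ _ _ tphi').
      have E : (fun z => 'D_('e_i) phi' z) = (fun z => 'D_('e_i) phi (z - y)%R).
        by apply/funext => z; exact: (derive_shift phi (- y)).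
      move=> x; rewrite E (derive_shift (fun z => 'D_('e_i) phi z) (- y)).
      exact: HM.
    apply: le_trans _ Hm; rewrite -(measure_tsupport_shift phi (- y)).
    apply: le_measure; rewrite ?inE.
    + exact: measurable_tsupport.
    + exact: measurable_tsupport_shift.
    + exact: tsupport_shift.
  have -> : (I G phi' + I G phi - (I Dv phi' + I Dv phi) =
    (I G phi' - I Dv phi') + (I G phi - I Dv phi))%R by ring.
  apply: le_trans (ler_normD _ _) _; apply: le_trans (lerD H2 H1) _.
  by rewrite [in leRHS](exprS 2^-1) le_eqVlt; apply/orP; left; apply/eqP; field.
Qed.

(** The approximations of [increment_approx] all satisfy the bound and converge weakly to the
    increment as the number of halvings grows. Their weak limit inherits the bound and equals the
    increment almost everywhere; no density of smooth functions is involved. *)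
Lemma weak_partial_dint_le i v g (h : R) : L v -> L g -> is_weak_partial i v g ->
  dint i p v h <= (`|h| `^ p * Np g)%:E.
Proof.
move=> Lv Lg vg.
have /choice[W HW] := fun N => increment_approx N h Lv Lg vg.
have LW N : L (W N) by have [] := HW N.
pose Dv x := (v (x + h *: 'e_i) - v x)%R.
have LDv : L Dv by exact: Lp_sub (ltW p1) (Lp_shift _ Lv) Lv.
have LD phi : test_function phi -> Lp mu q phi by exact: test_function_Lp.
have [] := @weak_limit _ _ R mu p q p1 qE W [set phi | test_function phi] (I Dv) (`|h| `^ p * Np g)%R LW.
- by move=> N; have [] := HW N.
- exact: LD.
- move=> phi tphi.
  have [M M0 HM] := test_function_bounded (test_function_derive i (test_function_derive i tphi)).
  have Km := tsupport_lty tphi.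
  pose m := fine (mu (tsupport phi)).
  have mE : mu (tsupport phi) <= m%:E by rewrite fineK// ge0_fin_numE.
  have key N := (let: And3 _ _ H := HW N in H) phi M m tphi HM mE.
  pose C := (M * h ^+ 2 * (Np v + 2 * m))%R.
  have C0 : (2^-1 ^+ k * C)%R @[k --> \oo] --> (0 * C : R)%R.
    by apply: cvgM; [apply: cvg_expr; rewrite ger0_norm//; lra|exact: cvg_cst].
  rewrite mul0r in C0; apply/cvgrPdist_le => e e0.
  have /cvgrPdist_le/(_ _ e0) := C0; apply: filterS => N.
  rewrite sub0r normrN => HN; rewrite distrC; apply: le_trans (key N) _.
  exact: le_trans (ler_norm _) HN.
move=> G [LG NG HG].
have DG : {ae mu, forall x, Dv x - G x = 0}%R.
  apply: pairing0_ae; first exact: Lp_sub (ltW p1) LDv LG.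
  by move=> phi tphi; rewrite (pairing_sub p1 qE LDv LG (LD _ tphi)) HG// subrr.
rewrite /dint (npE LDv) lee_fin; apply: le_trans NG.
rewrite (@ae_eq_np Dv G)//; [exact: LDv.1|exact: LG.1|].
by apply: filterS DG => x /eqP; rewrite subr_eq0 => /eqP.
Qed.

(** Up to an error of order [d k], the chosen quotients act on a test function as minus the pairing
    of [u k] with its derivative, so a weak limit of them is a weak derivative of [v]. *)
Lemma weak_partial_liminf i s (d : nat -> R) (u : nat -> 'rV[R]_n -> R) v (B c : R) :
  (0 < s < 1)%R -> (forall k, 0 < d k)%R -> d k @[k --> \oo] --> (0 : R)%R ->
  (forall k, L (u k)) -> (forall k, Np (u k) <= B)%R -> L v -> (0 <= c)%R ->
  (forall phi, test_function phi -> I (u k) phi @[k --> \oo] --> I v phi) ->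
  (forall k, gagliardo i s p (d k) (u k) <
    (c * (2 / (p * (1 - s)) * d k `^ (p * (1 - s))))%:E) ->
  exists g, [/\ L g, is_weak_partial i v g & (Np g <= c)%R].
Proof.
move=> s01 d0 dlim Lu uB Lv c0 uv Hg.
have /choice[h Hh] := fun k => exists_dint_le p1 s01 (d0 k) c0 (Lu k).1 (Hg k).
pose Du k x := (u k (x + h k *: 'e_i) - u k x)%R.
have LDu k : L (Du k) by exact: Lp_sub (ltW p1) (Lp_shift _ (Lu k)) (Lu k).
have LD phi : test_function phi -> Lp mu q phi by exact: test_function_Lp.
have [] := @weak_limit _ _ R mu p q p1 qE (fun k x => (h k)^-1 * Du k x)%R
  [set phi | test_function phi] (fun phi => - I v (fun x => 'D_('e_i) phi x))%R c.
- by move=> k; exact: Lp_scale.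
- move=> k; rewrite (np_scale _ (LDu k)); have [hk0 _ +] := Hh k.
  rewrite /dint (npE (LDu k)) lee_fin normfV => Hk.
  have hp : (0 < `|h k| `^ p)%R by rewrite powR_gt0// normr_gt0.
  have -> : (`|h k|^-1 `^ p = (`|h k| `^ p)^-1)%R.
    by rewrite -[(`|h k|^-1)%R]powR_inv1// -powRrM mulN1r powRN.
  by rewrite mulrC ler_pdivrMr// mulrC.
- exact: LD.
- move=> phi tphi.
  have [M M0 HM] := test_function_bounded (test_function_derive i (test_function_derive i tphi)).
  pose m := fine (mu (tsupport phi)).
  have mE : mu (tsupport phi) <= m%:E by rewrite fineK// ge0_fin_numE// tsupport_lty.
  pose C := (M * (B + 2 * m))%R.
  have C0 : (0 <= M * (B + 2 * m))%R.
    by rewrite mulr_ge0// addr_ge0 ?mulr_ge0 ?fine_ge0// (le_trans (np_ge0 _ _ _) (uB 0%N)).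
  have key k : (`|I (fun x => (h k)^-1 * Du k x) phi + I (u k) (fun x => 'D_('e_i) phi x)|
      <= d k * C)%R.
    have [hk0 hkd _] := Hh k.
    rewrite (pairing_scalel _ (LDu k) (LD _ tphi)).
    set a := I _ _; set b := I _ _.
    have -> : ((h k)^-1 * a + b = (h k)^-1 * (a + h k * b))%R by field.
    rewrite normrM normfV ler_pdivrMl ?normr_gt0//.
    apply: le_trans (pairing_increment_le (h k) (Lu k) tphi HM mE) _.
    rewrite -(ger0_norm (sqr_ge0 (h k))) expr2 normrM.
    have -> : (M * (`|h k| * `|h k|) * (Np (u k) + 2 * m) =
      `|h k| * (`|h k| * (M * (Np (u k) + 2 * m))))%R by ring.
    rewrite ler_wpM2l//; apply: ler_pM => //.
      by rewrite mulr_ge0// addr_ge0 ?np_ge0// mulr_ge0// fine_ge0.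
    by rewrite ler_wpM2l// lerD2r.
  have C1 : (d k * C)%R @[k --> \oo] --> (0 * C : R)%R.
    by apply: cvgM; [exact: dlim|exact: cvg_cst].
  rewrite mul0r in C1.
  have D1 : (I (fun x => (h k)^-1 * Du k x) phi + I (u k) (fun x => 'D_('e_i) phi x))%R
      @[k --> \oo] --> (0 : R)%R.
    apply/cvgrPdist_le => e e0; have /cvgrPdist_le/(_ _ e0) := C1; apply: filterS => k.
    rewrite sub0r normrN => HN; rewrite sub0r normrN; apply: le_trans (key k) _.
    exact: le_trans (ler_norm _) HN.
  have D2 := uv _ (test_function_derive i tphi).
  have D3 : (I (fun x => (h k)^-1 * Du k x) phi + I (u k) (fun x => 'D_('e_i) phi x) -
      I (u k) (fun x => 'D_('e_i) phi x))%R @[k --> \oo] -->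
      (0 - I v (fun x => 'D_('e_i) phi x) : R)%R by exact: cvgB.
  rewrite sub0r in D3; apply: cvg_trans D3; apply: near_eq_cvg.
  by apply: nearW => k /=; rewrite addrK.
move=> g [Lg Ng HG]; exists g; split => //.
apply: is_weak_partial_pairing => // phi tphi.
by rewrite HG// opprK.
Qed.

End exponent.

End weak_derivative.

(** * Weak convergence from almost everywhere convergence and bounded norms *)

Section weak_convergence.
Context {R : realType} {n : nat}.
Local Notation mu := (@lebesgue_rV R n).
Implicit Types (v phi : 'rV[R]_n -> R).
Local Open Scope ereal_scope.
Variables (p q : R).
Hypothesis p1 : (1 < p)%R.
Hypothesis qE : q = (p / (p - 1))%R.

Let p0 : (0 < p)%R. Proof. exact: lt_trans ltr01 p1. Qed.

(** Young splits the product into a part below C |phi|^q, to which dominated convergence applies,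
    and an excess below eta |w_k - v|^p, whose integral is small uniformly in k. *)
Lemma ae_cvg_pairing (w : nat -> 'rV[R]_n -> R) v phi (B : R) :
  (forall k, Lp mu p (w k)) -> (forall k, np mu p (w k) <= B)%R -> Lp mu p v ->
  {ae mu, forall x, w k x @[k --> \oo] --> v x} -> Lp mu q phi ->
  pairing mu (w k) phi @[k --> \oo] --> pairing mu v phi.
Proof.
move=> Lw wB Lv wv Lphi.
pose W k x := (w k x - v x)%R.
have LW k : Lp mu p (W k) by exact: Lp_sub (ltW p1) (Lw k) Lv.
pose B' := (2 `^ p / 2 * (B + np mu p v))%R.
have WB k : (np mu p (W k) <= B')%R.
  have := np_add_le p1 (Lw k) (Lp_scale (- 1) Lv).
  rewrite (np_scale _ Lv) normrN normr1 powR1 mul1r.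
  under [X in np mu p X]eq_fun do rewrite mulN1r.
  move=> /le_trans; apply; rewrite ler_wpM2l ?divr_ge0 ?powR_ge0//.
  by rewrite lerD2r.
have B0 : (0 <= B')%R by apply: le_trans (WB 0%N); exact: np_ge0.
apply/cvgrPdist_le => e e0.
pose eta := (e / 2 / (B' + 1))%R.
have B1 : (0 < B' + 1)%R by rewrite ltr_wpDl.
have eta0 : (0 < eta)%R by rewrite !divr_gt0.
pose C := (eta `^ (1 - p)^-1)%R.
have C0 : (0 < C)%R by exact: powR_gt0.
have CE : (C `^ (1 - p) = eta)%R.
  by rewrite /C -powRrM mulVf ?powRr1 ?(ltW eta0)// subr_eq0 lt_eqF.
pose m k x := Num.min `|W k x * phi x|%R (C * `|phi x| `^ q)%R.
have mWphi k : measurable_fun setT (fun x => `|W k x * phi x|%R).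
  by apply: measurableT_comp => //; apply: measurable_funM; [exact: (LW k).1|exact: Lphi.1].
have mphi : measurable_fun setT (fun x => C * `|phi x| `^ q)%R.
  by apply: measurable_funM => //; apply: measurable_fun_powR_norm; exact: Lphi.1.
have mm k : measurable_fun setT (fun x => (m k x)%:E).
  by apply/measurable_EFinP; exact: measurable_minr.
have m0 k x : (0 <= m k x)%R by rewrite le_min normr_ge0 mulr_ge0 ?powR_ge0 ?(ltW C0).
have ig : mu.-integrable setT (fun x => (C * `|phi x| `^ q)%:E).
  apply/integrableP; split; first exact/measurable_EFinP.
  rewrite (eq_integral (fun x => C%:E * (`|phi x| `^ q)%:E)); last first.
    by move=> x _; rewrite gee0_abs ?EFinM// lee_fin mulr_ge0 ?powR_ge0 ?(ltW C0).
  rewrite ge0_integralZlT ?(ltW C0)//; last exact: measurable_powR_normE Lphi.1.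
  by rewrite lte_mul_pinfty// ?lee_fin ?(ltW C0)//; exact: Lphi.2.
have aelim : {ae mu, forall x, setT x -> (m k x)%:E @[k --> \oo] --> cst (0 : \bar R) x}.
  apply: filterS wv => x wx _; apply: cvg_EFin; first exact: nearW.
  have H : `|W k x * phi x|%R @[k --> \oo] --> (0 : R)%R.
    rewrite -(normr0 R) -(mul0r (phi x)) -(subrr (v x)).
    apply: cvg_norm; apply: cvgM; last exact: cvg_cst.
    by apply: cvgB => //; exact: cvg_cst.
  apply: squeeze_cvgr (cvg_cst (0 : R)%R) H; apply: nearW => k /=.
  by rewrite m0 /m ge_min lexx.
have aedom : {ae mu, forall x, forall k, setT x -> `|(m k x)%:E| <= (C * `|phi x| `^ q)%:E}.
  apply: aeW => x k _; rewrite gee0_abs ?lee_fin//.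
  by rewrite /m ge_min lexx orbT.
have [_ _] := dominated_convergence measurableT mm (measurable_cst (0 : \bar R)) aelim ig aedom.
rewrite integral_cst// mul0e.
move=> /fine_cvgP[mfin /cvgrPdist_le/(_ _ (divr_gt0 e0 (ltr0n _ 2)))] mlim.
near=> k.
have mk : \int[mu]_x (m k x)%:E \is a fin_num by near: k.
have mk2 : (`|0 - fine (\int[mu]_x (m k x)%:E)| <= e / 2)%R by near: k.
rewrite distrC -(pairing_sub p1 qE (Lw k) Lv Lphi).
rewrite -lee_fin -abse_EFin -(pairingE p1 qE (LW k) Lphi).
have iw := Lp_mul_integrable p1 qE (LW k) Lphi.
apply: le_trans (le_abse_integral _ measurableT _) _; first by case/integrableP: iw.
have MW := measurable_powR_normE p (LW k).1.
have P0 x : 0 <= (`|W k x| `^ p)%:E by rewrite lee_fin powR_ge0.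
have MeW : measurable_fun setT (fun x => eta%:E * (`|W k x| `^ p)%:E).
  exact: measurable_funeM.
have PeW x : 0 <= eta%:E * (`|W k x| `^ p)%:E by rewrite mule_ge0// lee_fin ltW.
have Pm x : 0 <= (m k x)%:E by rewrite lee_fin.
apply: (@le_trans _ _ (\int[mu]_x (eta%:E * (`|W k x| `^ p)%:E + (m k x)%:E))).
  apply: ge0_le_integralT.
  - by apply: measurableT_comp => //; case/integrableP: iw.
  - exact: emeasurable_funD.
  - by move=> x.
  - move=> x; rewrite abse_EFin -EFinM -EFinD lee_fin /m.
    have := young_eps p1 qE (normr_ge0 (W k x)) (normr_ge0 (phi x)) C0.
    rewrite CE -normrM => H; rewrite -lerBlDl le_min; apply/andP; split.
      by rewrite gerBl mulr_ge0 ?powR_ge0 ?(ltW eta0).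
    by rewrite lerBlDl addrC.
rewrite (ge0_integralDT _ MeW (mm k) PeW Pm) (ge0_integralZlT _ MW P0 (ltW eta0)).
rewrite (npE (LW k)) -(fineK mk) -EFinM -EFinD lee_fin (splitr e); apply: lerD.
  have -> : (e / 2 = eta * (B' + 1))%R by rewrite /eta divfK ?gt_eqF.
  by rewrite ler_wpM2l ?(ltW eta0)// (le_trans (WB k))// lerDl.
by apply: le_trans mk2; rewrite sub0r normrN ler_norm.
Unshelve. all: by end_near. Qed.

End weak_convergence.

(** * Lower semicontinuity and coercivity *)

Section lower_semicontinuity.
Context {R : realType} {n : nat}.
Local Notation mu := (@lebesgue_rV R n).
Local Notation leb := (@lebesgue_measure R).
Local Notation "''e_' i" := (delta_mx 0%R i : 'rV[R]_n)
  (at level 8, i at level 2).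
Implicit Types (i : 'I_n) (u v : 'rV[R]_n -> R) (s p d c : R).
Local Open Scope ereal_scope.

Lemma ae_translation (P : 'rV[R]_n -> Prop) y :
  {ae mu, forall x, P x} -> {ae mu, forall x, P (x + y)%R}.
Proof.
move=> [N [mN N0 NP]]; exists [set x | N (x + y)%R]; split.
- rewrite -[X in measurable X]setTI.
  by apply: (measurable_translation y) => //.
- by rewrite -N0; exact: (lebesgue_rV_translation y mN).
- by move=> x /= Px; apply: NP.
Qed.

Lemma gkernel_liminf i s p (h : R) (u_ : nat -> 'rV[R]_n -> R) u : (0 < p)%R ->
  (forall k, measurable_fun setT (u_ k)) -> measurable_fun setT u ->
  {ae mu, forall x, u_ k x @[k --> \oo] --> u x} ->
  gkernel i s p u h <= limn_einf (fun k => gkernel i s p (u_ k) h).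
Proof.
move=> p0 mu_ mu' cu.
have E (w : 'rV[R]_n -> R) : measurable_fun setT w -> gkernel i s p w h =
    \int[mu]_x ((`|w (x + h *: 'e_i) - w x| `^ p * `|h| `^ (- (1 + s * p)))%R)%:E.
  move=> mw; rewrite /gkernel /dint -ge0_integralZrT ?powR_ge0//.
  by apply: measurable_powR_normE; exact: measurable_diff.
have M (w : 'rV[R]_n -> R) : measurable_fun setT w -> measurable_fun setT
    (fun x : 'rV[R]_n => ((`|w (x + h *: 'e_i) - w x| `^ p * `|h| `^ (- (1 + s * p)))%R)%:E).
  move=> mw; apply/measurable_EFinP; apply: measurable_funM => //.
  by apply: measurable_fun_powR_norm; exact: measurable_diff.
rewrite E// (_ : (fun k => _) = fun k => \int[mu]_x
  ((`|u_ k (x + h *: 'e_i) - u_ k x| `^ p * `|h| `^ (- (1 + s * p)))%R)%:E).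
  apply: ae_fatou_liminf.
  - by move=> k; exact: M.
  - by move=> k x; rewrite lee_fin mulr_ge0 ?powR_ge0.
  - exact: M.
  - by move=> x; rewrite lee_fin mulr_ge0 ?powR_ge0.
  - have := ae_translation (h *: 'e_i) cu; apply: filterS2 cu => x c1 c2.
    apply: cvg_EFin; first exact: nearW.
    apply: cvgM; last exact: cvg_cst.
    have c3 : (u_ k (x + h *: 'e_i) - u_ k x)%R @[k --> \oo] --> (u (x + h *: 'e_i) - u x)%R.
      exact: cvgB.
    exact: (cvg_comp _ _ c3 (continuous_norm_powR p0 (x := (u (x + h *: 'e_i) - u x)%R))).
by apply/funext => k; rewrite E.
Qed.

(** Fatou twice: in x for each fixed increment, then in the increment. *)
Lemma gagliardo_fatou i s p d (u_ : nat -> 'rV[R]_n -> R) u (c : \bar R) : (0 < p)%R ->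
  (forall k, measurable_fun setT (u_ k)) -> measurable_fun setT u ->
  {ae mu, forall x, u_ k x @[k --> \oo] --> u x} ->
  (forall k, gagliardo i s p d (u_ k) <= c) -> gagliardo i s p d u <= c.
Proof.
move=> p0 mu_ mu' cu Hc; rewrite gagliardoE//.
have mK k : measurable_fun setT (gkernel i s p (u_ k)) by exact: measurable_gkernel.
apply: (@le_trans _ _ (\int[leb]_(h in [set h : R | (`|h| <= d)%R])
  limn_einf (fun k => gkernel i s p (u_ k) h))).
  apply: (ge0_le_integral_leb (measurable_norm_le d)).
  - exact: measurable_gkernel.
  - exact: measurable_fun_limn_einf.
  - by move=> h _; exact: gkernel_ge0.
  - by move=> h _; exact: gkernel_liminf.
apply: le_trans (fatou leb (measurable_norm_le d)
  (fun k => measurable_funTS (mK k)) (fun k h _ => gkernel_ge0 i s p (u_ k) h)) _.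
by apply: limn_einf_le => k; apply: le_trans (Hc k); rewrite gagliardoE.
Qed.

Lemma Jdelta_fatou i s p d (u_ : nat -> 'rV[R]_n -> R) u (c : R) : (0 < p)%R -> (0 < d)%R ->
  (forall k, measurable_fun setT (u_ k)) -> measurable_fun setT u ->
  {ae mu, forall x, u_ k x @[k --> \oo] --> u x} ->
  (forall k, Jdelta i s p d (u_ k) <= c%:E) -> Jdelta i s p d u <= c%:E.
Proof.
move=> p0 d0 mu_ mu' cu Hc.
have dp : (0 < d `^ (- (p * (1 - s))))%R by rewrite powR_gt0.
rewrite /Jdelta -lee_pdivlMl//; apply: (gagliardo_fatou p0 mu_ mu' cu) => k.
by rewrite lee_pdivlMl//; exact: Hc.
Qed.

(** The slack [e] supplies the strict inequality that selecting an increment requires. The mass of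
    the weight and the factor in [J0] are the same constant [ka], so the bound returns as c + e. *)
Lemma J0_liminf i s p (d : nat -> R) (u_ : nat -> 'rV[R]_n -> R) u (B c : R) :
  (1 < p)%R -> (0 < s < 1)%R -> (forall k, 0 < d k)%R -> d k @[k --> \oo] --> (0 : R)%R ->
  (forall k, Lp mu p (u_ k)) -> (forall k, np mu p (u_ k) <= B)%R -> Lp mu p u ->
  {ae mu, forall x, u_ k x @[k --> \oo] --> u x} ->
  (forall k, Jdelta i s p (d k) (u_ k) <= c%:E) -> J0 i s p u <= c%:E.
Proof.
move=> p1 s01 d0 dlim Lu uB Lu' cu Hc; have /andP[s0 s1] := s01.
have p0 : (0 < p)%R by exact: lt_trans ltr01 p1.
have c0 : (0 <= c)%R by rewrite -lee_fin; apply: le_trans (Hc 0%N); exact: Jdelta_ge0.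
have al0 : (0 < p * (1 - s))%R by rewrite mulr_gt0// subr_gt0.
have ka0 : (0 < 2 / (p * (1 - s)))%R by rewrite divr_gt0.
apply/lee_addgt0Pr => e e0; set ka := (2 / (p * (1 - s)))%R in ka0.
have ce0 : (0 <= (c + e) / ka)%R by rewrite divr_ge0 ?addr_ge0 ?(ltW e0) ?(ltW ka0).
have p10 : (0 < p - 1)%R by rewrite subr_gt0.
have uv phi : test_function phi -> pairing mu (u_ k) phi @[k --> \oo] --> pairing mu u phi.
  move=> tphi; apply: (ae_cvg_pairing p1 erefl Lu uB Lu' cu).
  by apply: test_function_Lp => //; rewrite divr_gt0.
have Hg k : gagliardo i s p (d k) (u_ k) < ((c + e) / ka * (ka * d k `^ (p * (1 - s))))%:E.
  have dp : (0 < d k `^ (p * (1 - s)))%R by rewrite powR_gt0.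
  have := Hc k; rewrite /Jdelta powRN -lee_pdivlMl ?invr_gt0// invrK -EFinM.
  move=> /le_lt_trans; apply; rewrite lte_fin mulrA divfK ?gt_eqF// mulrC.
  by rewrite ltr_pM2r// ltrDl.
have [g [Lg gu Ng]] := weak_partial_liminf p1 erefl s01 d0 dlim Lu uB Lu' ce0 uv Hg.
rewrite (J0E p1 erefl s Lu' Lg gu) -EFinD lee_fin.
by rewrite mulrC -ler_pdivlMr.
Qed.

(** Without a weak derivative in L^p the right side is infinite. Otherwise the scale cancels, the
    mass of the weight being proportional to d^(p(1-s)). *)
Lemma J0_ge_Jdelta i s p d v : (1 < p)%R -> (0 < s < 1)%R -> (0 < d)%R -> Lp mu p v ->
  Jdelta i s p d v <= J0 i s p v.
Proof.
move=> p1 s01 d0 Lv; have /andP[s0 s1] := s01.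
have p0 : (0 < p)%R by exact: lt_trans ltr01 p1.
have [[g [/(Lp_Lfun _ _ p0) Lg vg]]|D0] := pselect (exists g,
    g \in Lfun mu p%:E /\ is_weak_partial i v g); last first.
  rewrite /J0 asboolF ?leey// => -[g Dg]; apply: D0; by exists g.
rewrite (J0E p1 erefl s Lv Lg vg) /Jdelta.
have dp : (0 < d `^ (- (p * (1 - s))))%R by rewrite powR_gt0.
have H := gagliardo_le_dint p1 s01 d0 (np_ge0 _ _ g) Lv.1
  (fun h => weak_partial_dint_le p1 erefl h Lv Lg vg).
apply: le_trans (lee_wpmul2l _ H) _; first by rewrite lee_fin ltW.
rewrite -EFinM lee_fin powRN le_eqVlt; apply/orP; left; apply/eqP.
have : (d `^ (p * (1 - s)) != 0)%R by rewrite gt_eqF// powR_gt0.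
set a := (_ `^ _)%R; set b := (p * (1 - s))%R.
have : (b != 0)%R by rewrite gt_eqF// mulr_gt0// subr_gt0.
by move=> b0 a0; field; rewrite a0 b0.
Qed.

End lower_semicontinuity.

Section coercivity_bound.
Context {R : realType}.

(** Beyond the threshold [T], C (1+Y)^a is at most half of 1 + Y and can be absorbed. *)
Lemma sublinear_bound (M C a : R) : 0 <= C -> a < 1 ->
  exists Y0, forall Y, 0 <= Y -> Y <= M + C * (1 + Y) `^ a -> Y <= Y0.
Proof.
move=> C0 a1; pose T := (2 * C) `^ (1 - a)^-1.
exists (T + 2 * (`|M| + 1)) => Y Y0 HY.
have t0 : 0 < 1 + Y by rewrite ltr_pwDl.
have [tT|tT] := leP (1 + Y) T.
  have := normr_ge0 M; lra.
have a10 : 0 < 1 - a by rewrite subr_gt0.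
have T0 : 0 <= T by exact: powR_ge0.
have H : C * (1 + Y) `^ a <= (1 + Y) / 2.
  have : T `^ (1 - a) <= (1 + Y) `^ (1 - a) by apply: ler_powRl => //; exact: ltW.
  rewrite /T -powRrM mulVf ?gt_eqF// powRr1 ?mulr_ge0// => H1.
  have E : 1 + Y = (1 + Y) `^ (1 - a) * (1 + Y) `^ a.
    by rewrite -powRD ?subrK ?powRr1 ?(ltW t0)//; apply/implyP => _; rewrite gt_eqF.
  rewrite ler_pdivlMr// [leRHS]E -mulrA [X in _ * X]mulrC.
  by rewrite mulrCA mulrA ler_wpM2r ?powR_ge0.
have := ler_norm M; lra.
Qed.

End coercivity_bound.

(** * Uniform energy bounds and lower semicontinuity of the sum over directions *)

Section compactness.
Context {R : realType} {n : nat}.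
Local Notation mu := (@lebesgue_rV R n).
Implicit Types (i : 'I_n) (u v : 'rV[R]_n -> R).
Local Open Scope ereal_scope.

Variables (Omega : set 'rV[R]_n) (rho : R).
Hypothesis mOmega : measurable Omega.
Hypothesis rho0 : (0 < rho)%R.
Hypothesis Omegarho : forall x, Omega x -> forall i, (`|x ord0 i| <= rho)%R.
Variables (s p delta : 'I_n -> R).
Hypothesis s01 : forall i, (0 < s i < 1)%R.
Hypothesis p1 : forall i, (1 < p i)%R.
Hypothesis delta0 : forall i, (0 < delta i)%R.
Let sigma : R := (\sum_i (s i * p i)^-1)%R.
Let S : R := (\sum_i (s i)^-1)%R.
Hypothesis sigma1 : (1 < sigma)%R.
Variable q : R.
Hypothesis qE : (q * (sigma - 1) = S)%R.
Hypothesis q1 : (1 < q)%R.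
Variable f : 'rV[R]_n -> R.
Hypothesis Lf : Lp mu (q / (q - 1)) f.

Let p0 i : (0 < p i)%R. Proof. exact: lt_trans ltr01 (p1 i). Qed.
Let q0 : (0 < q)%R. Proof. exact: lt_trans ltr01 q1. Qed.

Let al i : R := (p i * (1 - s i))%R.

(** Vanishing holds everywhere outside [Omega], as for a zero extension, and the scales [delta] are
    fixed reference scales. Integrability follows from the Poincare and Sobolev inequalities. *)
Definition admissible u := [/\ measurable_fun setT u,
  forall x, ~ Omega x -> u x = 0%R &
  forall i, gagliardo i (s i) (p i) (delta i) u < +oo].

Lemma admissible_Jdelta_lty u (e : R) i : admissible u -> (0 < e)%R ->
  Jdelta i (s i) (p i) e u < +oo.
Proof.
move=> [mu' _ gu] e0; have /andP[_ s1] := s01 i.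
rewrite /Jdelta lte_mul_pinfty ?lee_fin ?powR_ge0//.
apply: le_lt_trans (gagliardo_le i (ltW (p1 i)) s1 e0 (delta0 i) mu') _.
rewrite lte_mul_pinfty ?lee_fin ?powR_ge0//.
by rewrite /Jdelta lte_mul_pinfty ?lee_fin ?powR_ge0.
Qed.

Lemma admissible_Lp u : admissible u -> Lp mu q u.
Proof.
move=> [mu' u0 gu].
have [C C0 HC] := anisotropic_sobolev mOmega rho0 Omegarho s01 p1 delta0 sigma1 qE q0.
by split => //; apply: le_lt_trans (HC u mu' u0 gu) _; rewrite ltry.
Qed.

(** The scales [e] may be arbitrarily small: passing to the reference scales costs a constant [K]
    that depends only on their upper bounds [E]. The total energy Y then satisfies Y <= M + C3
    (1+Y)^a with a = sigma/S < 1. *)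
Lemma energy_bound (E : 'I_n -> R) (M : R) : (forall i, (0 < E i)%R) ->
  exists Y0 : R, forall u (e : 'I_n -> R), admissible u ->
    (forall i, (0 < e i <= E i)%R) ->
    \sum_i Jdelta i (s i) (p i) (e i) u <= (M + pairing mu u f)%:E ->
    [/\ (forall i, Jdelta i (s i) (p i) (e i) u <= Y0%:E),
        (forall i, gagliardo i (s i) (p i) (delta i) u <= Y0%:E),
        (forall i, Lp mu (p i) u /\ (np mu (p i) u <= Y0)%R),
        Lp mu q u & (np mu q u <= Y0)%R].
Proof.
have aux (x y z w : R) : (0 <= x -> 0 <= y -> 0 <= z -> 0 <= w ->
    [/\ x <= x + y + z + w, y <= x + y + z + w, z <= x + y + z + w & w <= x + y + z + w])%R.
  by move=> ? ? ? ?; split; lra.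
move=> E0.
have [C C0 HC] := anisotropic_sobolev mOmega rho0 Omegarho s01 p1 delta0 sigma1 qE q0.
have /choice[D HD] : forall i, exists D : R, (0 <= D)%R /\ forall u,
    measurable_fun setT u -> (forall x, ~ Omega x -> u x = 0%R) ->
    \int[mu]_x (`|u x| `^ p i)%:E <= D%:E * gagliardo i (s i) (p i) (delta i) u.
  move=> i; have [D D0 H] := norm_le_gagliardo rho0 Omegarho i (ltW (p1 i)) (s01 i) (delta0 i).
  by exists D.
pose K := (1 + \sum_i (2 * delta i + E i) `^ al i)%R.
have K0 : (1 <= K)%R by rewrite lerDl sumr_ge0// => i _; exact: powR_ge0.
have K0' : (0 < K)%R by exact: lt_le_trans K0.
have Ki i : ((2 * delta i + E i) `^ al i <= K)%R.
  rewrite /K (bigD1 i)//= addrCA lerDl addr_ge0// sumr_ge0// => k _.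
  exact: powR_ge0.
pose t := (sigma / (sigma - 1))%R; pose a := (t / q)%R.
have sg0 : (0 < sigma - 1)%R by rewrite subr_gt0.
have t0 : (0 < t)%R by rewrite divr_gt0// (lt_trans ltr01).
(* Strict since every s_i p_i exceeds s_i and, as sigma > 1, the sum is not empty. *)
have sS : (sigma < S)%R.
  have /existsP[i0 _] : [exists i : 'I_n, true].
    apply: contraT => /existsPn n0; have := sigma1; rewrite /sigma big1 ?ltr10// => i _.
    by have := n0 i.
  apply: ltr_sum; first by apply/hasP; exists i0; rewrite ?mem_index_enum.
  move=> i _; have /andP[s0 _] := s01 i.
  by rewrite ltf_pV2 ?posrE ?mulr_gt0// ltr_pMr.
have a1 : (a < 1)%R.
  rewrite /a ltr_pdivrMr// mul1r /t ltr_pdivrMr// qE.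
  exact: sS.
have aE : (a * (1 - q) + t = a)%R by rewrite /a; field; rewrite gt_eqF.
pose C2 := (C * (K * n.+1%:R) `^ t)%R.
have C20 : (0 <= C2)%R by rewrite mulr_ge0// powR_ge0.
pose C3 := (np mu (q / (q - 1)) f + C2)%R.
have C30 : (0 <= C3)%R by rewrite addr_ge0// np_ge0.
have [Y1 HY1] := sublinear_bound M C30 a1.
pose Y2 := Num.max 0%R Y1.
pose Y0 := (Y2 + K * Y2 + \sum_i D i * (K * Y2) + C2 * (1 + Y2) `^ t)%R.
exists Y0 => u e Au eE HM.
have [mu' u0 gu] := Au.
have Jfin i : Jdelta i (s i) (p i) (e i) u = (fine (Jdelta i (s i) (p i) (e i) u))%:E.
  have /andP[e0 _] := eE i.
  by rewrite fineK// ge0_fin_numE ?Jdelta_ge0//; exact: admissible_Jdelta_lty.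
pose J i := fine (Jdelta i (s i) (p i) (e i) u).
have J0' i : (0 <= J i)%R by rewrite fine_ge0// Jdelta_ge0.
pose Y := (\sum_i J i)%R.
have Ypos : (0 <= Y)%R by rewrite sumr_ge0.
have JY i : (J i <= Y)%R.
  by rewrite /Y (bigD1 i)//= lerDl sumr_ge0.
have HMY : (Y <= M + pairing mu u f)%R.
  rewrite -lee_fin; apply: le_trans HM; rewrite /Y -sumEFin.
  by apply: lee_sum => i _; rewrite [leRHS]Jfin.
have gK i : gagliardo i (s i) (p i) (delta i) u <= (K * J i)%:E.
  have /andP[e0 eEi] := eE i; have /andP[_ s1] := s01 i.
  apply: le_trans (gagliardo_le i (ltW (p1 i)) s1 (delta0 i) e0 mu') _.
  rewrite Jfin -EFinM lee_fin; apply: (ler_wpM2r (J0' i)); apply: le_trans (Ki i).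
  apply: ler_powRl; rewrite ?lerD2l//.
    by rewrite mulr_ge0 ?subr_ge0 ?(ltW (p0 i)) ?(ltW s1).
  by rewrite addr_ge0 ?(ltW e0)// mulr_ge0 ?(ltW (delta0 i)).
have gfin i : (fine (gagliardo i (s i) (p i) (delta i) u) <= K * J i)%R.
  rewrite -lee_fin fineK//.
  by rewrite ge0_fin_numE ?gagliardo_ge0.
have Sob : \int[mu]_x (`|u x| `^ q)%:E <= (C2 * (1 + Y) `^ t)%:E.
  apply: le_trans (HC u mu' u0 gu) _; rewrite lee_fin /C2 -mulrA ler_wpM2l//.
  have KN : (0 <= K * n.+1%:R)%R by rewrite mulr_ge0// ltW.
  have Yge : (0 <= 1 + Y)%R by rewrite addr_ge0.
  rewrite -(powRM t KN Yge); apply: ler_powRl; first exact: ltW.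
    by rewrite addr_ge0// sumr_ge0// => i _; rewrite fine_ge0// gagliardo_ge0.
  apply: (@le_trans _ _ (1 + \sum_i K * J i)%R); first by rewrite lerD2l ler_sum.
  rewrite -mulr_sumr -/Y.
  apply: (@le_trans _ _ (K * (1 + Y))%R).
    by rewrite mulrDr mulr1 lerD2r.
  rewrite -mulrA ler_wpM2l ?(ltW K0')// ler_peMl ?addr_ge0//.
  by rewrite ler1n.
have Lq := admissible_Lp Au.
have npq : (np mu q u <= C2 * (1 + Y) `^ t)%R by rewrite -lee_fin -npE.
have Y1p : (0 < 1 + Y)%R by rewrite ltr_pwDl.
have YY : (Y <= Y2)%R.
  rewrite le_max; apply/orP; right; apply: HY1 => //.
  apply: le_trans HMY _; rewrite lerD2l; apply: le_trans (ler_norm _) _.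
  (* This Young parameter balances the two terms: a (1 - q) + t = a, so both grow like (1 + Y)^a. *)
  have e0 : (0 < (1 + Y) `^ a)%R by exact: powR_gt0.
  apply: le_trans (pairing_le q1 erefl e0 Lq Lf) _.
  rewrite /C3 mulrDl; apply: lerD; first by rewrite mulrC.
  apply: le_trans (ler_wpM2l (powR_ge0 _ _) npq) _.
  rewrite mulrCA ler_wpM2l// -powRrM -powRD ?aE//.
  by apply/implyP => _; rewrite gt_eqF.
have Y20 : (0 <= Y2)%R by rewrite le_max lexx.
have KY : (0 <= K * Y2)%R by rewrite mulr_ge0// ltW.
have DY i : (0 <= D i * (K * Y2))%R by rewrite mulr_ge0//; have [] := HD i.
have CY : (0 <= C2 * (1 + Y2) `^ t)%R by rewrite mulr_ge0// powR_ge0.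
have SD : (0 <= \sum_i D i * (K * Y2))%R by rewrite sumr_ge0.
have gY i : gagliardo i (s i) (p i) (delta i) u <= (K * Y2)%:E.
  apply: le_trans (gK i) _; rewrite lee_fin ler_wpM2l ?(ltW K0')//.
  exact: le_trans (JY i) YY.
have nY i : \int[mu]_x (`|u x| `^ p i)%:E <= (D i * (K * Y2))%:E.
  have [D0 H] := HD i; apply: le_trans (H u mu' u0) _.
  by rewrite EFinM; apply: lee_wpmul2l; rewrite ?lee_fin.
have LY i : Lp mu (p i) u by split => //; apply: le_lt_trans (nY i) _; rewrite ltry.
have Dsum i : (D i * (K * Y2) <= \sum_i D i * (K * Y2))%R.
  by rewrite (bigD1 i)//= lerDl sumr_ge0.
have [b1 b2 b3 b4] := aux _ _ _ _ Y20 KY SD CY.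
split.
- by move=> i; rewrite Jfin lee_fin; exact: le_trans (le_trans (JY i) YY) b1.
- by move=> i; apply: le_trans (gY i) _; rewrite lee_fin.
- move=> i; split; first exact: LY.
  have := nY i; rewrite (npE (LY i)) lee_fin => H.
  exact: le_trans H (le_trans (Dsum i) b3).
- exact: Lq.
- apply: le_trans npq _; apply: le_trans b4.
  rewrite ler_wpM2l//; apply: ler_powRl; [exact: ltW|exact: ltW|].
  by rewrite lerD2l.
Qed.

(** [psi] is not assumed increasing: m <= psi m already sends tails into tails, which spares
    monotone extraction. *)
Lemma ae_subseq (u_ : nat -> 'rV[R]_n -> R) u (psi : nat -> nat) :
  (forall m, (m <= psi m)%N) -> {ae mu, forall x, u_ k x @[k --> \oo] --> u x} ->
  {ae mu, forall x, u_ (psi k) x @[k --> \oo] --> u x}.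
Proof.
move=> psim; apply: filterS => x; apply: cvg_trans.
move=> A [N _ NA]; exists N => // k Nk; apply: NA.
exact: leq_trans (psim k).
Qed.

Section liminf.
Variables (j : nat) (d : 'I_n -> R) (E : 'I_n -> R).
Hypothesis d0 : forall i, (j <= i)%N -> (0 < d i)%R.

Definition limit_energy u i : \bar R :=
  if (i < j)%N then J0 i (s i) (p i) u else Jdelta i (s i) (p i) (d i) u.

(** In one direction, a common bound along a sequence passes to the limit. Applied to subsequences
    this shows, by contradiction, that each term is eventually at least its limit minus any [e]; the
    terms can then be added at one large index. The linear term converges by [ae_cvg_pairing]. *)
Lemma energy_liminf (u_ : nat -> 'rV[R]_n -> R) u (e_ : nat -> 'I_n -> R) (M : R) :
  (forall k, admissible (u_ k)) -> measurable_fun setT u ->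
  (forall x, ~ Omega x -> u x = 0%R) ->
  (forall k i, (0 < e_ k i <= E i)%R) ->
  (forall i, (i < j)%N -> e_ k i @[k --> \oo] --> (0 : R)%R) ->
  (forall k i, (j <= i)%N -> e_ k i = d i) ->
  {ae mu, forall x, u_ k x @[k --> \oo] --> u x} ->
  (forall k, \sum_i Jdelta i (s i) (p i) (e_ k i) (u_ k) <= (M + pairing mu (u_ k) f)%:E) ->
  [/\ admissible u, forall i, Lp mu (p i) u, Lp mu q u &
      \sum_i limit_energy u i <= (M + pairing mu u f)%:E].
Proof.
move=> Au_ mu' u0 eE elim ed cu HM.
have E0 i : (0 < E i)%R by have /andP[/lt_le_trans] := eE 0%N i; apply.
have [Y0 HY0] := energy_bound M E0.
have {}HY0 k := HY0 (u_ k) (e_ k) (Au_ k) (eE k) (HM k).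
have mu_ k : measurable_fun setT (u_ k) by have [] := Au_ k.
have JY k i : Jdelta i (s i) (p i) (e_ k i) (u_ k) <= Y0%:E by have [] := HY0 k.
have Lu_ k i : Lp mu (p i) (u_ k) by have [_ _ H _ _] := HY0 k; have [] := H i.
have nu_ k i : (np mu (p i) (u_ k) <= Y0)%R by have [_ _ H _ _] := HY0 k; have [] := H i.
have Lqu_ k : Lp mu q (u_ k) by have [] := HY0 k.
have nqu_ k : (np mu q (u_ k) <= Y0)%R by have [] := HY0 k.
have fatou_Lp r : (0 < r)%R -> (forall k, Lp mu r (u_ k)) ->
    (forall k, np mu r (u_ k) <= Y0)%R -> Lp mu r u.
  move=> r0 Lr nr; split => //; apply: le_lt_trans (ltry Y0).
  apply: (ae_fatou (H := fun k x => (`|u_ k x| `^ r)%:E)).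
  - by move=> k; exact: measurable_powR_normE.
  - by move=> k x; rewrite lee_fin powR_ge0.
  - exact: measurable_powR_normE.
  - by move=> x; rewrite lee_fin powR_ge0.
  - apply: filterS cu => x cx; apply: cvg_EFin; first exact: nearW.
    exact: (cvg_comp _ _ cx (continuous_norm_powR r0 (x := u x))).
  - by move=> k; rewrite (npE (Lr k)) lee_fin; exact: nr.
have Lu i : Lp mu (p i) u by exact: fatou_Lp.
have Lqu : Lp mu q u by exact: fatou_Lp.
have gY k i : gagliardo i (s i) (p i) (delta i) (u_ k) <= Y0%:E.
  by have [_ H _ _ _] := HY0 k.
have Au : admissible u.
  split; [exact: mu'|exact: u0|move=> i; apply: le_lt_trans (ltry Y0)].
  exact: (gagliardo_fatou (p0 i) mu_ mu' cu (fun k => gY k i)).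
have lsc (psi : nat -> nat) i c : (forall m, (m <= psi m)%N) ->
    (forall m, Jdelta i (s i) (p i) (e_ (psi m) i) (u_ (psi m)) <= c%:E) ->
    limit_energy u i <= c%:E.
  move=> psim Hc; have cpsi := ae_subseq psim cu.
  rewrite /limit_energy; case: ltnP => ij.
    have epos m : (0 < e_ (psi m) i)%R by have /andP[] := eE (psi m) i.
    have ecvg : e_ (psi m) i @[m --> \oo] --> (0 : R)%R.
      apply: cvg_trans (elim i ij) => A [N _ NA]; exists N => // k Nk; apply: NA.
      exact: leq_trans (psim k).
    exact: (J0_liminf (p1 i) (s01 i) epos ecvg (fun m => Lu_ (psi m) i)
      (fun m => nu_ (psi m) i) (Lu i) cpsi Hc).
  apply: (Jdelta_fatou (p0 i) (d0 ij) (fun m => mu_ (psi m)) mu' cpsi) => m.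
  by rewrite -(ed (psi m) i ij).
have lim_lty i : limit_energy u i <= Y0%:E.
  by apply: (lsc id) => // m; exact: JY.
have lim_ge0 i : 0 <= limit_energy u i.
  rewrite /limit_energy; case: ifP => _; last exact: Jdelta_ge0.
  have /andP[_ s1] := s01 i.
  apply: le_trans (J0_ge_Jdelta i (p1 i) (s01 i) ltr01 (Lu i)).
  exact: Jdelta_ge0.
have limE i : limit_energy u i = (fine (limit_energy u i))%:E.
  by rewrite fineK// ge0_fin_numE//; apply: le_lt_trans (lim_lty i) _; rewrite ltry.
have key i (e : R) : (0 < e)%R -> exists K, forall k, (K <= k)%N ->
    (fine (limit_energy u i) - e)%:E <= Jdelta i (s i) (p i) (e_ k i) (u_ k).
  move=> e0; apply: contrapT => /forallNP H.
  have /choice[psi Hpsi] : forall m, exists k, (m <= k)%N /\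
      Jdelta i (s i) (p i) (e_ k i) (u_ k) <= (fine (limit_energy u i) - e)%:E.
    move=> m; have /existsNP[k /not_implyP[mk /negP]] := H m.
    by rewrite -ltNge => /ltW Hk; exists k.
  have := lsc psi i _ (fun m => (Hpsi m).1) (fun m => (Hpsi m).2).
  by rewrite {1}limE lee_fin lerBrDr gerDl leNgt e0.
have cf := ae_cvg_pairing q1 erefl Lqu_ nqu_ Lqu cu Lf.
split => //.
under eq_bigr do rewrite limE.
rewrite sumEFin lee_fin; apply/ler_addgt0Pr => e e0.
(* One share for each of the [n] directions and one for the linear term. *)
pose e' := (e / (n.+1)%:R)%R.
have e'0 : (0 < e')%R by rewrite divr_gt0.
have /choice[K HK] := fun i => key i e' e'0.
have /cvgrPdist_le/(_ _ e'0)[K' _ HK'] := cf.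
pose k := (K' + \sum_i K i)%N.
have kK i : (K i <= k)%N by rewrite /k (bigD1 i)//= addnCA leq_addr.
have H1 : (\sum_i (fine (limit_energy u i) - e') <= M + pairing mu (u_ k) f)%R.
  rewrite -lee_fin; apply: le_trans (HM k); rewrite -sumEFin.
  by apply: lee_sum => i _; exact: HK.
have H2 := HK' k (leq_addr _ _).
have : (pairing mu (u_ k) f - pairing mu u f <= e')%R.
  by apply: le_trans H2; rewrite distrC ler_norm.
move: H1; rewrite sumrB big_const card_ord iter_addr addr0 => H1 H3.
have E' : (e' *+ n + e' = e)%R by rewrite -mulrSr -mulr_natr divfK.
lra.
Qed.

End liminf.

End compactness.

(** * Gamma-convergence *)

Section extended_reals.
Context {R : realType}.
Local Open Scope ereal_scope.

Lemma limn_einf_lt_frequently (h : nat -> \bar R) (c : \bar R) (N : nat) :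
  limn_einf h < c -> exists2 k, (N <= k)%N & h k < c.
Proof.
move=> hc; apply: contrapT => /forall2NP H; move: hc; apply/negP; rewrite -leNgt.
rewrite limn_einf_lim (cvg_lim _ (@cvg_einfs_sup _ h))//.
apply: (@le_trans _ _ (einfs h N)); last by apply: ereal_sup_ubound; exists N.
apply: le_ereal_inf_tmp => _ [k Nk <-]; rewrite leNgt.
by have [/(_ Nk)|/negP] := H k.
Qed.

Lemma limn_esup_le (h : nat -> \bar R) (c : \bar R) :
  (forall k, h k <= c) -> limn_esup h <= c.
Proof.
move=> hc; rewrite limn_esup_lim; apply: lime_le; first exact: is_cvg_esups.
by apply: nearW => N; apply: ge_ereal_sup => _ [k _ <-].
Qed.

(** Reduces the lower bound to sequences whose energies lie below a real [M], whatever infinite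
    values occur. *)
Lemma le_from_above (x y : \bar R) :
  (forall M : R, x < M%:E -> y <= M%:E) -> y <= x.
Proof.
case: x => [x||] H; last 2 first.
- exact: leey.
- case: y H => [y||] H//; last by have := H 0%R (ltNyr _).
  by have := H (y - 1)%R (ltNyr _); rewrite lee_fin lerBrDr gerDl ler10.
- by apply/lee_addgt0Pr => e e0; rewrite -EFinD; apply: H; rewrite lte_fin ltrDl.
Qed.

End extended_reals.

Section Lnorm_subsequence.
Context d (T : measurableType d) (R : realType) (mu : {measure set T -> \bar R}).
Local Open Scope ereal_scope.

Lemma Lnorm_small (r e : R) (w : T -> R) : (0 < r)%R -> (0 <= e)%R ->
  'N[mu]_r%:E[EFin \o w] <= (e `^ r^-1)%:E -> \int[mu]_x (`|w x| `^ r)%:E <= e%:E.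
Proof.
move=> r0 e0 H.
have -> : \int[mu]_x (`|w x| `^ r)%:E = 'N[mu]_r%:E[EFin \o w] `^ r.
  by rewrite powR_Lnorm// gt_eqF.
apply: le_trans (gt0_ler_poweR (ltW r0) _ _ H) _.
- by rewrite in_itv/= leey andbT Lnorm_ge0.
- by rewrite in_itv/= leey andbT lee_fin powR_ge0.
by rewrite poweR_EFin -powRrM mulVf ?gt_eqF// powRr1.
Qed.

(** The integrals are summable, so almost everywhere the series of [|w k x|^r] converges and its
    terms tend to 0. *)
Lemma ae_cvg_of_summable (r : R) (w : nat -> T -> R) : (0 < r)%R ->
  (forall k, measurable_fun setT (w k)) ->
  (forall k, \int[mu]_x (`|w k x| `^ r)%:E <= (2^-1 ^+ k)%:E) ->
  {ae mu, forall x, w k x @[k --> \oo] --> (0 : R)%R}.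
Proof.
move=> r0 mw wk.
have : {ae mu, forall x, \sum_(k <oo) (`|w k x| `^ r)%:E < +oo}.
  apply: ae_summable.
  - by move=> k; exact: measurable_powR_normE.
  - by move=> k x; rewrite lee_fin powR_ge0.
  - by apply: nneseries_geometric_lty => // k; exact: int_powR_ge0.
apply: filterS => x Sx.
have H0 : (`|w k x| `^ r)%R @[k --> \oo] --> (0 : R)%R.
  have P0 k : 0 <= (`|w k x| `^ r)%:E by rewrite lee_fin powR_ge0.
  have ht := nneseries_tail_cvg Sx (fun k _ => P0 k).
  have : (`|w k x| `^ r)%:E @[k --> \oo] --> (0 : \bar R).
    apply: squeeze_cvge (cvg_cst (0 : \bar R)) ht; apply: nearW => k /=; rewrite P0/=.
    apply: (@le_trans _ _ (\sum_(k <= i < k.+1) (`|w i x| `^ r)%:E)).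
      by rewrite big_nat1.
    by apply: nneseries_lim_ge => i _ _.
  by move=> /fine_cvgP[].
have ri0 : (0 < r^-1)%R by rewrite invr_gt0.
have := cvg_comp _ _ H0 (continuous_norm_powR ri0 (x := 0%R)).
rewrite normr0 powR0 ?gt_eqF// => /cvgr0Pnorm_lt H1.
apply/cvgr0Pnorm_lt => e e0; near=> k.
have : (`|(`|w k x| `^ r)|%R `^ r^-1 < e)%R.
  rewrite -[ltLHS]ger0_norm ?powR_ge0//; near: k.
  exact: H1 e e0.
by rewrite ger0_norm ?powR_ge0// -powRrM mulfV ?gt_eqF// powRr1.
Unshelve. all: by end_near. Qed.

End Lnorm_subsequence.

Section exponents.
Context {R : realType} {n : nat}.
Variables (s p : 'I_n -> R).
Hypothesis n0 : (0 < n)%N.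
Hypothesis hs : forall i, 0 < s i < 1.
Hypothesis hp : forall i, 1 < p i.
Let sigma := \sum_i (s i * p i)^-1.

Let n0R : (0 : R) < n%:R. Proof. by rewrite ltr0n. Qed.
Let p0 i : 0 < p i. Proof. exact: lt_trans ltr01 (hp i). Qed.

(** [spbar s p] is n/sigma. *)
Lemma spbar_lt : spbar s p < n%:R -> 1 < sigma.
Proof.
rewrite /spbar -/sigma invfM invrK => H.
have sg0 : 0 < sigma.
  rewrite /sigma (bigD1 (Ordinal n0))//= ltr_wpDr ?sumr_ge0//.
    by move=> i _; have /andP[s0 _] := hs i; rewrite invr_ge0 mulr_ge0// ltW.
  by have /andP[s0 _] := hs (Ordinal n0); rewrite invr_gt0 mulr_gt0.
by rewrite gtr_pMr// invf_lt1 in H.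
Qed.

(** Identifies [pstar] with S/(sigma - 1), the exponent that the level recursion produces. *)
Lemma pstarE : 1 < sigma ->
  pstar s p * (sigma - 1) = \sum_i (s i)^-1.
Proof.
move=> sg1; rewrite /pstar /spbar /sbar -/sigma.
have sg0 : sigma != 0 by rewrite gt_eqF// (lt_trans ltr01).
have sg1' : sigma - 1 != 0 by rewrite subr_eq0 gt_eqF.
have S0 : \sum_i (s i)^-1 != 0.
  rewrite gt_eqF// (bigD1 (Ordinal n0))//= ltr_wpDr ?sumr_ge0//.
    by move=> i _; have /andP[s0 _] := hs i; rewrite invr_ge0 ltW.
  by have /andP[s0 _] := hs (Ordinal n0); rewrite invr_gt0.
have n0' : n%:R != 0 :> R by rewrite gt_eqF.
set S := \sum_i (s i)^-1 in S0 *.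
have -> : n%:R - (n%:R^-1 * sigma)^-1 = n%:R * (sigma - 1) / sigma.
  by field; rewrite n0' sg0.
by field; rewrite n0' sg0 sg1' S0.
Qed.

Lemma pmin_fin : exists2 r : R, 1 <= r & pmin p = r%:E.
Proof.
have : (pmin p <= (p (Ordinal n0))%:E)%E by exact: bigmin_le_cond.
have := pmin_ge1 hp; case: (pmin p) => [r||]//; rewrite lee_fin => r1 _.
by exists r.
Qed.

Lemma le_pmax i : ((p i)%:E <= pmax p)%E.
Proof. exact: le_bigmax. Qed.

End exponents.

Lemma hoelder_conjugate_EFin (R : realType) (q : R) : 1 < q ->
  hoelder_conjugate q%:E = (q / (q - 1))%:E.
Proof.
move=> q1; have q0 : q != 0 by rewrite gt_eqF// (lt_trans ltr01).
have q10 : q - 1 != 0 by rewrite subr_eq0 gt_eqF.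
by rewrite /hoelder_conjugate /= eqe (negbTE q0) -EFinB inver (negbTE q10) EFinM.
Qed.

(** * From functions on the domain to their extensions by zero *)

Section zero_extension.
Context {R : realType} {n : nat}.
Local Notation mu := (@lebesgue_rV R n).
Variables (Omega : set 'rV[R]_n) (oOmega : open Omega).
Local Notation muO := (mrestr mu (measurable_open_rV oOmega)).
Implicit Types w : 'rV[R]_n -> R.
Local Open Scope ereal_scope.

Let ext w := patch (fun=> 0%R) Omega w.

Lemma measurable_ext w : measurable_fun setT w -> measurable_fun setT (ext w).
Proof.
move=> mw; have -> : ext w = (fun x => w x * \1_Omega x)%R.
  by apply/funext => x; rewrite /ext patchE indicE; case: (x \in _); rewrite ?mulr1 ?mulr0.
apply: measurable_funM => //; apply: measurable_indic.
exact: measurable_open_rV.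
Qed.

Lemma ext_out w x : ~ Omega x -> ext w x = 0%R.
Proof. by move=> Ox; rewrite /ext patchE memNset. Qed.

Lemma integral_powR_ext (r : R) w : (0 < r)%R -> measurable_fun setT w ->
  \int[muO]_x (`|w x| `^ r)%:E = \int[mu]_x (`|ext w x| `^ r)%:E.
Proof.
move=> r0 mw; rewrite ge0_integral_mrestr; last 2 first.
- exact: measurable_powR_normE.
- by move=> x; rewrite lee_fin powR_ge0.
rewrite integral_mkcond; apply: eq_integral => x _; rewrite /ext !patchE.
by case: ifP => // _; rewrite normr0 powR0 ?gt_eqF.
Qed.

Lemma integral_mul_ext f w : \int[mu]_(x in Omega) (f x * w x)%:E =
  \int[mu]_x (w x * ext f x)%:E.
Proof.
rewrite integral_mkcond; apply: eq_integral => x _; rewrite /ext !patchE.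
by case: ifP => _; rewrite ?mulr0// mulrC.
Qed.

End zero_extension.

Theorem theorem3p11 (R : realType) (n : nat) (Omega : set 'rV[R]_n)
  (oOmega : open Omega) (bOmega : bounded_set Omega)
  (s p : 'I_n -> R)
  (hs : forall i, 0 < s i < 1) (hp : forall i, 1 < p i)
  (hsp : spbar s p < n%:R) (hpmax : (pmax p < (pstar s p)%:E)%E)
  (f : 'rV[R]_n -> R)
  (hf : f \in Lfun (mrestr (lebesgue_rV R n) (measurable_open_rV oOmega))
                   (hoelder_conjugate (pstar s p)%:E))
  (j : nat) (hj : (1 <= j <= n)%N)
  (dk : nat -> 'I_n -> R)
  (dk_gt0 : forall k (i : 'I_n), (i < j)%N -> 0 < dk k i)
  (dk_cvg0 : forall i : 'I_n, (i < j)%N -> dk k i @[k --> \oo] --> 0)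
  (d : 'I_n -> R) (d_gt0 : forall i : 'I_n, (j <= i)%N -> 0 < d i)
  (delta : 'I_n -> R) (delta_gt0 : forall i, 0 < delta i) :
  Gamma_cvg (@Lp_cvg R n Omega oOmega (pmin p) (pmin_ge1 hp))
    (fun k => extend_pinfty (W0 s p delta Omega) (Idelta j s p (dk k) d Omega f))
    (extend_pinfty (W0 s p delta Omega) (I0 j s p d Omega f)).
Proof.
have n0 : (0 < n)%N by have /andP[/leq_trans] := hj; apply.
pose mu := lebesgue_rV R n.
pose sigma := \sum_i (s i * p i)^-1.
have sigma1 : 1 < sigma by exact: spbar_lt.
pose q := pstar s p.
have qE : q * (sigma - 1) = \sum_i (s i)^-1 by exact: pstarE.
have q1 : 1 < q.
  by rewrite -lte_fin (le_lt_trans _ hpmax)// (le_trans _ (le_pmax p (Ordinal n0)))// lee_fin ltW.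
have q0 : 0 < q by exact: lt_trans ltr01 q1.
have q10 : 0 < q - 1 by rewrite subr_gt0.
have q'0 : 0 < q / (q - 1) by rewrite divr_gt0.
have mO : measurable Omega by exact: measurable_open_rV.
have [rho rho0 Orho] : exists2 rho : R, 0 < rho &
    forall x, Omega x -> forall i, `|x ord0 i| <= rho.
  have [M [_ HM]] := bOmega; exists (`|M| + 1); first by rewrite ltr_wpDl.
  have M1 : M < `|M| + 1 by rewrite (le_lt_trans (ler_norm M))// ltrDl.
  move=> x Ox i; apply: le_trans (HM _ M1 x Ox).
  by rewrite /Num.norm/= mx_normrE; apply: (le_bigmax _ _ (ord0, i)).
have mf : measurable_fun setT f.
  by move: hf; rewrite inE => /andP[]; rewrite inE.
(* Extending [f] by zero turns the linear term into a pairing over the whole space. *)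
pose f0 : 'rV[R]_n -> R := patch (fun=> 0) Omega f.
have mf0 : measurable_fun setT f0 by exact: measurable_ext.
have Lf : Lp mu (q / (q - 1)) f0.
  split => //; rewrite -(integral_powR_ext oOmega q'0 mf).
  have := hf; rewrite hoelder_conjugate_EFin// => /(Lp_Lfun _ _ q'0) [_].
  by [].
have [r r1 rE] := pmin_fin n0 hp.
have r0 : 0 < r by exact: lt_le_trans r1.
pose L := LpOmega oOmega (pmin_ge1 hp).
have mL (v : L) : measurable_fun setT (v : 'rV[R]_n -> R) by exact: (measurable_funPT (repr (LebesgueSpace.sort v))).
have mext (v : L) : measurable_fun setT (zero_ext v) by exact: measurable_ext.
have ext0 (v : L) x : ~ Omega x -> zero_ext v x = 0 by exact: ext_out.
pose adm := admissible Omega s p delta.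
have W0_adm (v : L) : W0 s p delta Omega (zero_ext v) -> adm (zero_ext v).
  move=> [Wv _]; split; [exact: mext|exact: ext0|].
  by move=> i; have [_] := Wv i I.
have W0_Lp (v : L) i : W0 s p delta Omega (zero_ext v) -> Lp mu (p i) (zero_ext v).
  move=> [Wv _]; have [Lv _] := Wv i I.
  by apply/(Lp_Lfun _ _ (lt_trans ltr01 (hp i))).
have adm_W0 (v : L) : adm (zero_ext v) -> (forall i, Lp mu (p i) (zero_ext v)) ->
    W0 s p delta Omega (zero_ext v).
  move=> [_ _ gv] Lv; split; last by apply: aeW => x; exact: ext0.
  move=> i _; split; last exact: gv.
  by apply/(Lp_Lfun _ _ (lt_trans ltr01 (hp i))).
have fvE (v : L) : Lp mu q (zero_ext v) ->
    (\int[mu]_(x in Omega) (f x * zero_ext v x)%:E = (pairing mu (zero_ext v) f0)%:E)%E.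
  by move=> Lv; rewrite integral_mul_ext (pairingE q1 erefl Lv Lf).
have split_sum (G : 'I_n -> \bar R) (A B : 'I_n -> \bar R) :
    (forall i, G i = if (i < j)%N then A i else B i) ->
    (\sum_(i < n | (i < j)%N) A i + \sum_(i < n | (j <= i)%N) B i = \sum_i G i)%E.
  move=> HG; rewrite [RHS](bigID (fun i : 'I_n => (i < j)%N))/=; congr (_ + _)%E.
    by apply: eq_bigr => i ij; rewrite HG ij.
  apply: eq_big => [i|i ij]; first by rewrite leqNgt.
  by rewrite HG ltnNge ij.
pose e_ k (i : 'I_n) : R := if (i < j)%N then dk k i else d i.
have IkE k (v : L) : Lp mu q (zero_ext v) ->
    (Idelta j s p (dk k) d Omega f (zero_ext v) =
     \sum_i Jdelta i (s i) (p i) (e_ k i) (zero_ext v) - (pairing mu (zero_ext v) f0)%:E)%E.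
  move=> Lv; rewrite /Idelta (fvE v Lv); congr (_ - _)%E; apply: split_sum => i.
  by rewrite /e_; case: ifP.
have I0E (v : L) : Lp mu q (zero_ext v) ->
    (I0 j s p d Omega f (zero_ext v) =
     \sum_i limit_energy s p j d (zero_ext v) i - (pairing mu (zero_ext v) f0)%:E)%E.
  by move=> Lv; rewrite /I0 (fvE v Lv); congr (_ - _)%E; apply: split_sum.
move=> x; split; last first.
  exists (fun=> x).
    rewrite /Lp_cvg; under eq_fun do under [X in 'N[_]__[X]%E]eq_fun do rewrite subrr.
    rewrite Lnorm0; first exact: cvg_cst.
    by rewrite rE eqe gt_eqF.
  apply: limn_esup_le => k; rewrite /extend_pinfty; case: asboolP => Wx; last by rewrite leey.
  rewrite /Idelta /I0; apply: leeD2r; apply: leeD2r; apply: lee_sum => i ij.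
  exact: (J0_ge_Jdelta i (hp i) (hs i) (dk_gt0 k i ij) (W0_Lp x i Wx)).
(* For a real [M] above the lower limit, energies below [M] occur at arbitrarily large indices. *)
move=> x_ xx; apply: le_from_above => M HM.
pose muO := mrestr mu (measurable_open_rV oOmega).
have Ncvg : ('N[muO]_r%:E[EFin \o (fun y => x_ k y - x y)%R] @[k --> \oo] --> 0)%E.
  have gen (w : nat -> 'rV[R]_n -> R) :
      ('N[muO]_(pmin p)[(fun y => (w k y)%:E)] @[k --> \oo] --> 0)%E ->
      ('N[muO]_r%:E[(fun y => (w k y)%:E)] @[k --> \oo] --> 0)%E by rewrite rE.
  exact: gen xx.
have Nsmall m : exists N, forall k, (N <= k)%N ->
    (\int[mu]_y (`|zero_ext (x_ k) y - zero_ext x y| `^ r)%:E <= (2^-1 ^+ m)%:E)%E.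
  have c0 : 0 <= 2^-1 ^+ m :> R by rewrite exprn_ge0// invr_ge0.
  have c1 : 0 < (2^-1 ^+ m) `^ r^-1 :> R by rewrite powR_gt0// exprn_gt0// invr_gt0.
  move/fine_cvgP : Ncvg => [[N1 _ HN1] /cvgrPdist_le/(_ _ c1)[N2 _ HN2]].
  exists (maxn N1 N2) => k; rewrite geq_max => /andP[k1 k2].
  have mw : measurable_fun setT (fun y => x_ k y - x y).
    exact: (measurable_funB (mL (x_ k)) (mL x)).
  rewrite (eq_integral (fun y => (`|patch (fun=> 0) Omega (fun y => x_ k y - x y) y| `^ r)%:E)).
    rewrite -(integral_powR_ext oOmega r0 mw); apply: Lnorm_small => //.
    rewrite -(fineK (HN1 k k1)) lee_fin; apply: le_trans (HN2 k k2).
    by rewrite sub0r normrN ler_norm.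
  by move=> y _; rewrite /zero_ext !patchE; case: ifP; rewrite ?subrr.
(* One selection combines what happens frequently, energy below [M], with what happens eventually,
   closeness to the limit at the summable rate 2^(-m). *)
have /choice[psi Hpsi] : forall m, exists k, [/\ (m <= k)%N,
    (extend_pinfty (W0 s p delta Omega) (Idelta j s p (dk k) d Omega f) (x_ k) < M%:E)%E &
    (\int[mu]_y (`|zero_ext (x_ k) y - zero_ext x y| `^ r)%:E <= (2^-1 ^+ m)%:E)%E].
  move=> m; have [N HN] := Nsmall m.
  have [k mNk Fk] := limn_einf_lt_frequently (maxn m N) HM.
  by move: mNk; rewrite geq_max => /andP[mk Nk]; exists k; split => //; exact: HN.
pose u_ m := zero_ext (x_ (psi m)).
have Wu m : W0 s p delta Omega (u_ m) /\
    (Idelta j s p (dk (psi m)) d Omega f (u_ m) < M%:E)%E.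
  by have [_ + _] := Hpsi m; rewrite /extend_pinfty; case: asboolP.
have adm_u m : adm (u_ m) by apply: W0_adm; exact: (Wu m).1.
have admLq v : adm v -> Lp mu q v.
  exact: (admissible_Lp mO rho0 Orho hs hp delta_gt0 sigma1 qE q1).
(* [energy_bound] needs an upper bound for the scales in each direction; convergent scales are
   bounded. *)
have /choice[E HE] : forall i : 'I_n, exists E : R, forall k, e_ k i <= E.
  move=> i; rewrite /e_; have [ij|ij] := ltnP i j; last by exists (d i).
  have [A [_ HA]] := cvg_seq_bounded (cvgP _ (dk_cvg0 i ij)).
  exists (`|A| + 1) => k; apply: le_trans (ler_norm _) _.
  by apply: (HA _ _ k I); rewrite (le_lt_trans (ler_norm A))// ltrDl.
have eE k i : 0 < e_ k i <= E i.
  rewrite HE andbT /e_; case: ltnP => ij; [exact: dk_gt0|exact: d_gt0].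
have cu : {ae mu, forall y, u_ m y @[m --> \oo] --> zero_ext x y}.
  have : {ae mu, forall y, u_ m y - zero_ext x y @[m --> \oo] --> (0 : R)}.
    apply: (ae_cvg_of_summable r0); first by move=> m; exact: (measurable_funB (mext _) (mext x)).
    by move=> m; have [_ _] := Hpsi m.
  apply: filterS => y Hy.
  have Hy' : u_ m y - zero_ext x y + zero_ext x y @[m --> \oo] --> (0 + zero_ext x y : R).
    by apply: cvgD Hy _; exact: cvg_cst.
  rewrite add0r in Hy'; apply: cvg_trans Hy'; apply: near_eq_cvg.
  by apply: nearW => m; rewrite subrK.
have psim m : (m <= psi m)%N by have [] := Hpsi m.
have ecvg (i : 'I_n) : (i < j)%N -> e_ (psi m) i @[m --> \oo] --> (0 : R).
  move=> ij; rewrite /e_ ij; apply: cvg_trans (dk_cvg0 i ij) => A [N _ NA].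
  by exists N => // k Nk; apply: NA; exact: leq_trans (psim k).
have ed m (i : 'I_n) : (j <= i)%N -> e_ (psi m) i = d i by rewrite /e_ leqNgt => /negbTE ->.
have eM m : (\sum_i Jdelta i (s i) (p i) (e_ (psi m) i) (u_ m) <=
    (M + pairing mu (u_ m) f0)%:E)%E.
  have := ltW (Wu m).2; rewrite (IkE _ _ (admLq _ (adm_u m))).
  by rewrite leeBlDr// EFinD.
have [adm_x Lx Lqx xM] := energy_liminf mO rho0 Orho hs hp delta_gt0 sigma1 qE q1 Lf
  d_gt0 adm_u (mext x) (ext0 x) (fun m => eE (psi m)) ecvg ed cu eM.
rewrite /extend_pinfty asboolT; last exact: adm_W0.
by rewrite (I0E _ Lqx) leeBlDr// -EFinD.
Qed.
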